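(* Let $t_0 = \frac{4}{3}\left(\frac{4}{\sqrt{3}}+1\right)^3$. Fix $t \ge 2t_0$ and fix $R \ge 2/\sqrt{3}$. Let $\mathscr{C}=\{C_i\}_{i\in I}$ be a packing of $\mathbb{R}^3$ by capped $t$-cylinders. Then $$\rho(\mathscr{C},R-2/\sqrt{3},R) \le \frac{t+\frac{4}{3}}{\frac{\sqrt{12}}{\pi}(t-2t_0) + 2t_0+\frac{4}{3}}.$$
   Context: A $t$-cylinder is a closed solid circular cylinder in $\mathbb{R}^3$ of unit radius and length $t$. A capped $t$-cylinder is a $t$-cylinder together with solid unit hemispherical caps on its two ends; equivalently, it is the set of points of $\mathbb{R}^3$ at distance at most $1$ from a line segment of length $t$ (its axis). A packing of $\mathbb{R}^3$ by capped $t$-cylinders is a countable family $\mathscr{C}=\{C_i\}_{i\in I}$ of capped $t$-cylinders in $\mathbb{R}^3$ with mutually disjoint interiors. $B(R)$ is the closed ball of radius $R$ centered at $0$. For $R\le R'$, the density is $$\rho(\mathscr{C},R,R')=\sum_{i\in I:\, C_i\subseteq B(R)}\frac{\mathrm{Vol}(C_i)}{\mathrm{Vol}(B(R'))}.$$ *)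

(* Defs.v *)
From HB Require Import structures.
From mathcomp Require Import all_boot all_order all_algebra.
From mathcomp Require Import all_classical all_reals all_analysis.
From mathcomp Require Import ring lra.

Set Implicit Arguments.
Unset Strict Implicit.
Unset Printing Implicit Defensive.

Import Order.TTheory GRing.Theory Num.Theory.
Import numFieldNormedType.Exports.

Local Open Scope classical_set_scope.
Local Open Scope ring_scope.

(* Points of three-dimensional space are triples.  The library norm on a
   product is the sup norm, so the Euclidean one is defined here; it induces
   the same (product) topology, in which interiors are taken below. *)

Definition dot (R : realType) (x y : R * R * R) : R :=
  x.1.1 * y.1.1 + x.1.2 * y.1.2 + x.2 * y.2.

Definition enorm (R : realType) (x : R * R * R) : R := Num.sqrt (dot x x).

Definition cball (R : realType) (r : R) : set (R * R * R) :=
  [set x | enorm x <= r].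

Definition vol (R : realType) (A : set (R * R * R)) : \bar R :=
  ((@lebesgue_measure R \x @lebesgue_measure R) \x @lebesgue_measure R)%E A.

(* In the next three definitions [u] is a unit vector. The axis of the
   cylinder is the segment from [p] to [p + t *: u]. *)
Definition cylinder (R : realType) (t : R) (p u : R * R * R) :
    set (R * R * R) :=
  [set x | 0 <= dot (x - p) u <= t /\
           enorm (x - p - dot (x - p) u *: u) <= 1].

(* The half of the unit ball about [c] on the side to which [u] points. *)
Definition hemisphere (R : realType) (c u : R * R * R) : set (R * R * R) :=
  [set x | enorm (x - c) <= 1 /\ 0 <= dot (x - c) u].

Definition capped (R : realType) (t : R) (p u : R * R * R) :
    set (R * R * R) :=
  cylinder t p u `|` hemisphere p (- u) `|` hemisphere (p + t *: u) u.

Definition capped_cylinder (R : realType) (t : R) (A : set (R * R * R)) : Prop :=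
  exists p u : R * R * R, enorm u = 1 /\ A = capped t p u.

Definition packing (R : realType) (t : R) (I : countType)
    (C : I -> set (R * R * R)) : Prop :=
  (forall i, capped_cylinder t (C i)) /\
  trivIset [set: I] (fun i => (C i)°).

Definition density (R : realType) (I : countType)
    (C : I -> set (R * R * R)) (r r' : R) : \bar R :=
  (\esum_(i in [set i | C i `<=` cball r]) (vol (C i) / vol (cball r')))%E.

Definition t0 (R : realType) : R :=
  4 / 3 * (4 / Num.sqrt 3 + 1) ^+ 3.

Lemma enorm_le1 (R : realType) (x : R * R * R) :
  enorm x <= 1 <-> dot x x <= 1.
Proof. by rewrite /enorm -[X in _ <= X]sqrtr1 ler_sqrt. Qed.

Lemma enorm_eq1 (R : realType) (x : R * R * R) :
  enorm x = 1 -> dot x x = 1.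
Proof.
move=> h; rewrite -[RHS](expr1n _ 2) -h sqr_sqrtr// /dot.
by rewrite !addr_ge0// -expr2 sqr_ge0.
Qed.

Lemma dot_sub_scale (R : realType) (v u : R * R * R) (s : R) :
  dot u u = 1 ->
  dot (v - s *: u) (v - s *: u) = dot v v - 2 * s * dot v u + s ^+ 2.
Proof.
move=> u1; have -> : s ^+ 2 = s ^+ 2 * dot u u by rewrite u1 mulr1.
case: v u {u1} => [[v1 v2] v3] [[u1 u2] u3].
by rewrite /dot /= /GRing.scale /=; ring.
Qed.

Lemma dotrN (R : realType) (v u : R * R * R) : dot v (- u) = - dot v u.
Proof. by case: v u => [[v1 v2] v3] [[u1 u2] u3]; rewrite /dot /=; ring. Qed.

Lemma dot_sub_scalel (R : realType) (v u : R * R * R) (s : R) :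
  dot u u = 1 -> dot (v - s *: u) u = dot v u - s.
Proof.
move=> u1; have -> : dot v u - s = dot v u - s * dot u u by rewrite u1 mulr1.
case: v u {u1} => [[v1 v2] v3] [[u1 u2] u3].
by rewrite /dot /= /GRing.scale /=; ring.
Qed.

(* A capped cylinder is the set of points at distance at most one from its
   axis. *)
Lemma cappedE (R : realType) (t : R) (p u : R * R * R) :
  0 <= t -> enorm u = 1 ->
  capped t p u =
  [set x | exists2 s, 0 <= s <= t & enorm (x - (p + s *: u)) <= 1].
Proof.
move=> tge0 /enorm_eq1 u1; apply/seteqP; split => x /=.
- case=> [[[xt]|[]]|[]].
  + by move=> h; exists (dot (x - p) u) => //; rewrite opprD addrA.
  + move=> h _; exists 0; first by rewrite lexx.
    by rewrite scale0r addr0.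
  + by move=> h _; exists t => //; rewrite tge0 lexx.
- case=> s /andP[s0 st] /enorm_le1.
  rewrite opprD addrA dot_sub_scale// => h.
  have [a0|a0] := ltP (dot (x - p) u) 0.
    left; right; split; last by rewrite dotrN; lra.
    by apply/enorm_le1; nra.
  have [ta|ta] := leP (dot (x - p) u) t.
    left; left; split; first by rewrite a0.
    apply/enorm_le1; rewrite dot_sub_scale//.
    have := sqr_ge0 (s - dot (x - p) u); move: h.
    move: (dot (x - p) (x - p)) (dot (x - p) u) => V d h.
    by rewrite !expr2 in h *; lra.
  right; split; rewrite opprD addrA; last by rewrite dot_sub_scalel//; lra.
  apply/enorm_le1; rewrite dot_sub_scale//.
  move: (dot (x - p) (x - p)) (dot (x - p) u) h ta => V d h td.
  have : 0 <= (t - s) * (d - t + (d - s)) by rewrite mulr_ge0//; lra.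
  by rewrite !expr2 in h *; lra.
Qed.

(* Main.v *)
From HB Require Import structures.
Require Import Defs.
From mathcomp Require Import all_boot all_order all_algebra.
From mathcomp Require Import all_classical all_reals all_analysis.
From mathcomp Require Import measurable_realfun ring lra.

(** The density is a supremum over finite subfamilies. So let [n] capped
    cylinders lie in the ball of radius [r - rho], where [rho = 2 / sqrt 3].
    Disjoint cells around them are found in the ball of radius [r], of total
    volume at least [n * (sqrt 12 * (t - 2 * t0) + 2 * pi * t0 + 4 / 3 * pi)]
    ([finite_packing_vol]); comparing this with [n] times the volume
    [pi * (t + 4 / 3)] of a capped cylinder gives the bound.

    The cell of an axis is its Dirichlet cell among the axes of the subfamily,
    truncated at distance [rho], with a unit half ball added beyond each end.
    Cells are disjoint ([cells_disjoint]) and stay within [rho] of their axes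
    ([cell_sub]). Their volume is computed by slicing orthogonally to the axis.
    Axes are at distance at least 2 from each other, so every slice contains
    the unit disk and has area at least [pi]. If the slicing point is qualified,
    that is, at distance at least [4 / sqrt 3] from the ends of all axes, then
    the area is at least [sqrt 12], the area of the regular hexagon
    circumscribed about the unit disk ([cell_slice_ge]). The parts of the axes
    within [4 / sqrt 3] of a given end carry disjoint tubes of radius 1 in a
    ball of radius [4 / sqrt 3 + 1], whose volume is [pi * t0]; so for each of
    the [2 * n] ends a total length of at most [t0] is not qualified
    ([end_length]).

    Near a qualified point the other relevant axes look like full lines. In the
    plane of the slice, with the slicing point as origin, the squared distance
    to such a line minus the squared distance to the origin is
    [gap z = d ^+ 2 - 2 * d * (e . z) - (u . z) ^+ 2], with [d >= 2]: a concave
    function, positive at the origin, whose zero set is a parabola. The slice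
    is the part of the disk of radius [rho] that is lit, meaning that all gaps
    are positive. On the boundary circle the points where one gap is negative
    form a dark arc. Dark arcs of different lines are disjoint, because in a
    disk of radius [rho] three points at mutual distance at least 2 are on the
    boundary ([three_points]). By concavity, the part of the disk outside the
    sectors over the dark arcs is lit. In each of these sectors at least the
    fraction [kappa = 3 * sqrt 3 / (2 * pi)] of the area is lit ([sector_gap]),
    and [kappa] times the area [4 / 3 * pi] of the disk is [sqrt 12].

    For the sector estimate, a dark arc is an interval of angles with half-width
    [alpha <= 3 / 4] ([dark_arc_axis]), and after a rotation it is symmetric
    about the second coordinate axis. The triangle spanned by the centre and the
    ends of the arc is lit; this suffices for [alpha <= pi / 6]. For larger
    [alpha] the chord of the arc enters the unit disk, which is lit as well: the
    width of the lit region at height [y] is the square root of an affine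
    function of [y] that is still nonnegative at height 1, so above the chord
    there is at least a parabolic segment of height up to 1 ([chord_width],
    [area_ge_cap]). Both resulting inequalities between [alpha] and its sine and
    cosine are concave in [alpha] and need to be checked at the ends of the
    interval only ([sin_concave_le], [cap_concave_le]).

    Rotations are shown to preserve area and volume by writing them as products
    of shears, for which this is Fubini's theorem and translation invariance
    ([preserves_rot2], [exists_frame]). *)

Set Implicit Arguments.
Unset Strict Implicit.
Unset Printing Implicit Defensive.

Import Order.TTheory GRing.Theory Num.Theory.
Import numFieldNormedType.Exports.

Local Open Scope classical_set_scope.
Local Open Scope ring_scope.

(** * Maps preserving area and volume *)

Notation mR := measurableTypeR.

(** On [mR] the sigma-algebra is the one generated by intervals, on which
    [lebesgue_measure] is defined. *)
Definition area (R : realType) : set (mR R * mR R) -> \bar R :=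
  (@lebesgue_measure R \x @lebesgue_measure R)%E.

HB.instance Definition _ (R : realType) := Measure.on (@area R).

(** Makes Fubini's theorem available for volume as the product of area and
    length. *)
Lemma area_sigma_finite (R : realType) : sigma_finite setT (@area R).
Proof.
have /sigma_finiteP[F [TF ndF Foo]] := sigma_finiteT (@lebesgue_measure R).
exists (fun n => F n `*` F n).
  rewrite -setXTT TF predeqE => -[x y]; split.
    move=> [/= [n _ Fnx] [k _ Fky]]; exists (maxn n k) => //; split.
    - by move: x Fnx; exact/subsetPset/ndF/leq_maxl.
    - by move: y Fky; exact/subsetPset/ndF/leq_maxr.
  by move=> [n _ []/= ? ?]; split; exists n.
move=> k; have [? ?] := Foo k; split; first exact: measurableX.
by rewrite /area product_measure1E// lte_mul_pinfty// ge0_fin_numE.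
Qed.

HB.instance Definition _ (R : realType) :=
  Measure_isSigmaFinite.Build _ _ _ (@area R) (@area_sigma_finite R).

Definition preserves d (T : measurableType d) (R : realType)
    (mu : set T -> \bar R) (f : T -> T) : Prop :=
  measurable_fun setT f /\
  forall A, measurable A -> mu (f @^-1` A) = mu A.

Lemma preserves_comp d (T : measurableType d) (R : realType)
    (mu : set T -> \bar R) (f g : T -> T) :
  preserves mu f -> preserves mu g -> preserves mu (f \o g).
Proof.
move=> [mf pf] [mg pg]; split; first exact: measurableT_comp.
move=> A mA; rewrite comp_preimage pg ?pf//.
by rewrite -[X in measurable X]setTI; exact: mf.
Qed.

Lemma measurable_preimage_fun d1 d2 (T1 : measurableType d1)
    (T2 : measurableType d2) (f : T1 -> T2) (A : set T2) :
  measurable_fun setT f -> measurable A -> measurable (f @^-1` A).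
Proof. by move=> mf mA; rewrite -[X in measurable X]setTI; exact: mf. Qed.

(** By uniqueness of the measure that gives each interval its length. *)
Lemma preserves_translation (R : realType) (a : R) :
  preserves (@lebesgue_measure R) (fun x => x + a).
Proof.
have mf : measurable_fun setT (fun x : measurableTypeR R =>
  (x + a : measurableTypeR R)).
  exact: (@measurable_funD _ (measurableTypeR R)).
split=> // A mA.
pose f := fun x : measurableTypeR R => (x + a : measurableTypeR R).
pose m : {measure set (measurableTypeR R) -> \bar R} :=
  measure_function_pushforward__canonical__measure_function_Measure lebesgue_measure mf.
apply/esym/(@lebesgue_measure_unique R m) => {A mA}//.
move=> X /= [[u v] _ <-] /=; rewrite /m /= /pushforward.
rewrite [X in _ = lebesgue_measure X](_ : _ = `]u - a, v - a]%classic); last first.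
  by apply/seteqP; split => x /=; rewrite !in_itv/= ltrBlDr lerBrDr.
rewrite !lebesgue_measure_itv/= !lte_fin ltrD2r.
by case: ifP => // _; rewrite -!EFinD; congr EFin; ring.
Qed.

Section shears.
Context d1 d2 (T1 : measurableType d1) (T2 : measurableType d2) (R : realType).
Variable m1 : {sigma_finite_measure set T1 -> \bar R}.
Variable m2 : {sigma_finite_measure set T2 -> \bar R}.

(** The order of integration is free, so that a set can be sliced along the
    coordinates that a map leaves fixed. *)
Lemma product_measure12E (A : set (T1 * T2)) : measurable A ->
  (m1 \x m2)%E A = (m1 \x^ m2)%E A.
Proof.
move=> mA; apply: (@product_measure_unique _ _ _ _ _ m1 m2 (m1 \x^ m2)%E) => //.
by move=> B C mB mC; rewrite /= product_measure2E.
Qed.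

(** Fubini: the map acts inside each slice on which the second coordinate is
    constant, and preserves its measure. *)
Lemma preserves_fst (tau : T1 * T2 -> T1) :
  measurable_fun setT tau ->
  (forall y, preserves m1 (fun x => tau (x, y))) ->
  preserves (m1 \x m2)%E (fun z => (tau z, z.2)).
Proof.
move=> mt pt; have mf : measurable_fun setT (fun z => (tau z, z.2)).
  exact: measurable_fun_pair.
split=> // A mA; rewrite !product_measure12E//; last first.
  exact: measurable_preimage_fun.
apply: eq_integral => y _ /=.
rewrite -(proj2 (pt y) (ysection A y))//; last exact: measurable_ysection.
Qed.

Lemma preserves_snd (tau : T1 * T2 -> T2) :
  measurable_fun setT tau ->
  (forall x, preserves m2 (fun y => tau (x, y))) ->
  preserves (m1 \x m2)%E (fun z => (z.1, tau z)).
Proof.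
move=> mt pt; have mf : measurable_fun setT (fun z => (z.1, tau z)).
  exact: measurable_fun_pair.
split=> // A mA.
apply: eq_integral => x _ /=.
rewrite -(proj2 (pt x) (xsection A x))//; last exact: measurable_xsection.
Qed.

End shears.

(** The head symbol of the function selects the rule, and the arguments are
    passed explicitly so that no higher-order unification is needed. *)
Ltac measurable_step :=
  lazymatch goal with
  | |- measurable_fun _ (fun _ => ?c) => exact: measurable_cst
  | |- measurable_fun _ (fun x => x) => exact: measurable_id
  | |- measurable_fun _ (fun x => fst (@?f x)) =>
      apply: (@measurableT_comp _ _ _ _ _ _ fst _ f measurable_fst)
  | |- measurable_fun _ (fun x => snd (@?f x)) =>
      apply: (@measurableT_comp _ _ _ _ _ _ snd _ f measurable_snd)
  | |- measurable_fun _ (fun x => (@?f x, @?g x)) =>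
      apply: (@measurable_fun_pair _ _ _ _ _ _ f g)
  | |- measurable_fun _ (fun x => @?f x + @?g x) =>
      apply: (@measurable_funD _ _ _ _ f g)
  | |- measurable_fun _ (fun x => - @?f x) =>
      apply: (@measurableT_comp _ _ _ _ _ _ _ _ f (@oppr_measurable _ setT))
  | |- measurable_fun _ (fun x => @?f x * @?g x) =>
      apply: (@measurable_funM _ _ _ _ f g)
  | |- measurable_fun _ (fun x => @?f x ^+ ?n) =>
      apply: (@measurable_funX _ _ _ _ f n)
  | |- measurable_fun _ (fun x => Num.max (@?f x) (@?g x)) =>
      apply: (@measurable_maxr _ _ _ _ f g)
  | |- measurable_fun _ (fun x => Num.min (@?f x) (@?g x)) =>
      apply: (@measurable_minr _ _ _ _ f g)
  end; cbv beta.

Ltac solve_measurable := repeat first [assumption | measurable_step].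

Lemma measurable_lt_set d (T : measurableType d) (R : realType) (f g : T -> R) :
  measurable_fun setT f -> measurable_fun setT g ->
  measurable [set x | f x < g x].
Proof.
move=> mf mg; rewrite -[X in measurable X]setTI.
by have /(_ measurableT [set true]) := measurable_fun_ltr mf mg; apply.
Qed.

Lemma measurable_le_set d (T : measurableType d) (R : realType) (f g : T -> R) :
  measurable_fun setT f -> measurable_fun setT g ->
  measurable [set x | f x <= g x].
Proof.
move=> mf mg; rewrite -[X in measurable X]setTI.
by have /(_ measurableT [set true]) := measurable_fun_ler mf mg; apply.
Qed.

Definition rot2 (R : realType) (c s : R) (z : R * R) : R * R :=
  (c * z.1 - s * z.2, s * z.1 + c * z.2).

Definition rot13 (R : realType) (c s : R) (z : R * R * R) : R * R * R :=
  (c * z.1.1 - s * z.2, z.1.2, s * z.1.1 + c * z.2).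

Definition shear12 (R : realType) (a : R) (z : R * R) : R * R :=
  (z.1 + a * z.2, z.2).
Definition shear21 (R : realType) (a : R) (z : R * R) : R * R :=
  (z.1, z.2 + a * z.1).
Definition shear13 (R : realType) (a : R) (z : R * R * R) : R * R * R :=
  ((z.1.1 + a * z.2, z.1.2), z.2).
Definition shear31 (R : realType) (a : R) (z : R * R * R) : R * R * R :=
  (z.1, z.2 + a * z.1.1).

Lemma preserves_shear12 (R : realType) (a : R) : preserves (@area R) (shear12 a).
Proof.
apply: (@preserves_fst _ _ _ _ _ lebesgue_measure lebesgue_measure
  (fun z : R * R => z.1 + a * z.2)) => /=.
  by solve_measurable.
by move=> y; exact: preserves_translation.
Qed.

Lemma preserves_shear21 (R : realType) (a : R) : preserves (@area R) (shear21 a).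
Proof.
apply: (@preserves_snd _ _ _ _ _ lebesgue_measure lebesgue_measure
  (fun z : R * R => z.2 + a * z.1)) => /=.
  by solve_measurable.
by move=> y; exact: preserves_translation.
Qed.

Lemma preserves_translation2 (R : realType) (a b : R) :
  preserves (@area R) (fun z => (z.1 + a, z.2 + b)).
Proof.
rewrite -[X in preserves _ X]/((fun z : R * R => (z.1 + a, z.2)) \o (fun z =>
  (z.1, z.2 + b))).
apply: preserves_comp.
- apply: (@preserves_fst _ _ _ _ _ lebesgue_measure lebesgue_measure
    (fun z : R * R => z.1 + a)) => /=; first by solve_measurable.
  by move=> y; exact: preserves_translation.
- apply: (@preserves_snd _ _ _ _ _ lebesgue_measure lebesgue_measure
    (fun z : R * R => z.2 + b)) => /=; first by solve_measurable.
  by move=> y; exact: preserves_translation.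
Qed.

Lemma preserves_shear13 (R : realType) (a : R) : preserves (@vol R) (shear13 a).
Proof.
apply: (@preserves_fst _ _ _ _ _ (@area R)
  lebesgue_measure (fun z : R * R * R => (z.1.1 + a * z.2, z.1.2))) => /=.
  by solve_measurable.
move=> y.
have := @preserves_translation2 R (a * y) 0.
rewrite /preserves; under eq_fun do rewrite addr0.
done.
Qed.

Lemma preserves_shear31 (R : realType) (a : R) : preserves (@vol R) (shear31 a).
Proof.
apply: (@preserves_snd _ _ _ _ _ (@area R)
  lebesgue_measure (fun z : R * R * R => z.2 + a * z.1.1)) => /=.
  by solve_measurable.
by move=> y; exact: preserves_translation.
Qed.

(** A rotation is a product of three shears, the outer ones by the tangent [s
    / (1 + c)] of half the angle. This is undefined for a half turn only. *)
Lemma preserves_rot2 (R : realType) (c s : R) : c ^+ 2 + s ^+ 2 = 1 ->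
  preserves (@area R) (rot2 c s).
Proof.
move=> cs; have [c1|c1] := eqVneq c (-1).
  have s0 : s = 0.
    by apply/eqP; rewrite -sqrf_eq0; apply/eqP; move: cs; rewrite c1; lra.
  (* A half turn is the square of a quarter turn. *)
  suff H : preserves (@area R) (rot2 0 1).
    have -> : rot2 c s = rot2 0 1 \o rot2 0 1.
      by apply/funext => -[x y]; rewrite /rot2 /= c1 s0; congr pair; ring.
    exact: preserves_comp.
  have -> : rot2 (0 : R) 1 = shear12 (-1) \o (shear21 1 \o shear12 (-1)).
    by apply/funext => -[x y]; rewrite /rot2 /shear12 /shear21 /=; congr pair; ring.
  apply: preserves_comp; first exact: preserves_shear12.
  by apply: preserves_comp; [exact: preserves_shear21|exact: preserves_shear12].
have c10 : 1 + c != 0 by apply: contra c1 => /eqP h; apply/eqP; lra.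
have -> : rot2 c s = shear12 (- (s / (1 + c))) \o
  (shear21 s \o shear12 (- (s / (1 + c)))).
  have h : s * (s / (1 + c)) = 1 - c.
    by rewrite mulrA; apply: (mulIf c10); rewrite divfK//; lra.
  have h2 : s / (1 + c) * (1 + c) = s by rewrite divfK.
  move: h h2; set u := s / _ => h h2.
  apply/funext => -[x y]; rewrite /rot2 /shear12 /shear21 /=.
  congr pair; last by ring: h.
  have -> : x + - u * y + - u * (y + s * (x + - u * y)) =
     x * (1 - s * u) - (u * (1 + (1 - s * u))) * y by ring.
  rewrite h; have -> : u * (1 + (1 - (1 - c))) = u * (1 + c) by ring.
  by rewrite h2; ring.
apply: preserves_comp; first exact: preserves_shear12.
by apply: preserves_comp; [exact: preserves_shear21|exact: preserves_shear12].
Qed.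

(** The factorization of [preserves_rot2], in the plane of the first and third
    coordinates. Unlike the first two, these coordinates do not form a factor
    of the nested product, so the slices of [preserves_rot2] are not
    available. *)
Lemma preserves_rot13 (R : realType) (c s : R) : c ^+ 2 + s ^+ 2 = 1 ->
  preserves (@vol R) (rot13 c s).
Proof.
move=> cs; have [c1|c1] := eqVneq c (-1).
  have s0 : s = 0.
    by apply/eqP; rewrite -sqrf_eq0; apply/eqP; move: cs; rewrite c1; lra.
  (* A half turn is the square of a quarter turn. *)
  suff H : preserves (@vol R) (rot13 0 1).
    have -> : rot13 c s = rot13 0 1 \o rot13 0 1.
      by apply/funext => -[[x w] y]; rewrite /rot13 /= c1 s0; congr (_, _, _); ring.
    exact: preserves_comp.
  have -> : rot13 (0 : R) 1 = shear13 (-1) \o (shear31 1 \o shear13 (-1)).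
    apply/funext => -[[x w] y]; rewrite /rot13 /shear13 /shear31 /=.
    by congr (_, _, _); ring.
  apply: preserves_comp; first exact: preserves_shear13.
  by apply: preserves_comp; [exact: preserves_shear31|exact: preserves_shear13].
have c10 : 1 + c != 0 by apply: contra c1 => /eqP h; apply/eqP; lra.
have -> : rot13 c s = shear13 (- (s / (1 + c))) \o
  (shear31 s \o shear13 (- (s / (1 + c)))).
  have h : s * (s / (1 + c)) = 1 - c.
    by rewrite mulrA; apply: (mulIf c10); rewrite divfK//; lra.
  have h2 : s / (1 + c) * (1 + c) = s by rewrite divfK.
  move: h h2; set u := s / _ => h h2.
  apply/funext => -[[x w] y]; rewrite /rot13 /shear13 /shear31 /=.
  congr (_, _, _); last by ring: h.
  have -> : x + - u * y + - u * (y + s * (x + - u * y)) =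
     x * (1 - s * u) - (u * (1 + (1 - s * u))) * y by ring.
  rewrite h; have -> : u * (1 + (1 - (1 - c))) = u * (1 + c) by ring.
  by rewrite h2; ring.
apply: preserves_comp; first exact: preserves_shear13.
by apply: preserves_comp; [exact: preserves_shear31|exact: preserves_shear13].
Qed.

Definition rot12 (R : realType) (c s : R) (z : R * R * R) : R * R * R :=
  (rot2 c s z.1, z.2).

Lemma preserves_rot12 (R : realType) (c s : R) : c ^+ 2 + s ^+ 2 = 1 ->
  preserves (@vol R) (rot12 c s).
Proof.
move=> cs.
apply: (@preserves_fst _ _ _ _ _ (@area R)
  lebesgue_measure (fun z : R * R * R => rot2 c s z.1)) => /=.
  by rewrite /rot2; solve_measurable.
by move=> y; exact: preserves_rot2.
Qed.

Lemma preserves_translation3 (R : realType) (p : R * R * R) :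
  preserves (@vol R) (fun z => p + z).
Proof.
have -> : (fun z => p + z) = (fun z : R * R * R => (z.1, z.2 + p.2)) \o
   (fun z => ((z.1.1 + p.1.1, z.1.2 + p.1.2), z.2)).
  by apply/funext => -[[x y] z]; case: p => [[p1 p2] p3] /=; congr (_, _, _);
    rewrite /= addrC.
apply: preserves_comp.
  apply: (@preserves_snd _ _ _ _ _ (@area R) lebesgue_measure
    (fun z : R * R * R => z.2 + p.2)) => /=; first by solve_measurable.
  by move=> y; exact: preserves_translation.
apply: (@preserves_fst _ _ _ _ _ (@area R) lebesgue_measure
  (fun z : R * R * R => (z.1.1 + p.1.1, z.1.2 + p.1.2))) => /=.
  by solve_measurable.
by move=> y; exact: preserves_translation2.
Qed.

(** Makes a given axis vertical, so that volumes can be computed by horizontal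
    slices. One rotation tilts the vertical axis to the latitude of [u],
    another one about the vertical brings it to the longitude of [u]. *)
Lemma exists_frame (R : realType) (u : R * R * R) : dot u u = 1 ->
  exists M : R * R * R -> R * R * R,
  [/\ preserves (@vol R) M,
      (forall (a : R) x y, M (x + a *: y) = M x + a *: M y),
      (forall x y, dot (M x) (M y) = dot x y) &
      M (0, 0, 1) = u].
Proof.
case: u => [[a b] c]; rewrite /dot /= => u1.
(* [s] is the distance from [u] to the vertical axis; when it vanishes, the
   horizontal angle, with cosine [e] and sine [f], is arbitrary. *)
pose s := Num.sqrt (a ^+ 2 + b ^+ 2).
have s2 : s ^+ 2 = a ^+ 2 + b ^+ 2 by rewrite sqr_sqrtr// addr_ge0// sqr_ge0.
have cs1 : c ^+ 2 + (- s) ^+ 2 = 1 by rewrite sqrrN s2 -u1; ring.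
have [e [f [ef es fs]]] : exists e f : R,
  [/\ e ^+ 2 + f ^+ 2 = 1, s * e = a & s * f = b].
  have [s0|s0] := eqVneq s 0.
    exists 1, 0; split; first by ring.
    - move: s2; rewrite s0 expr0n/= => h.
      by have := sqr_ge0 a; have := sqr_ge0 b; rewrite mul0r; nra.
    - move: s2; rewrite s0 expr0n/= => h.
      by have := sqr_ge0 a; have := sqr_ge0 b; rewrite mul0r; nra.
  exists (a / s), (b / s); split.
  - by rewrite !expr_div_n -mulrDl -s2 divff// sqrf_eq0.
  - by rewrite mulrC divfK.
  - by rewrite mulrC divfK.
exists (rot12 e f \o rot13 c (- s)); split.
- by apply: preserves_comp; [exact: preserves_rot12|exact: preserves_rot13].
- move=> k [[x1 x2] x3] [[y1 y2] y3].
  rewrite /rot12 /rot13 /rot2 /=.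
  by congr (_, _, _); rewrite /GRing.scale /= /GRing.scale /=; ring.
- move=> [[x1 x2] x3] [[y1 y2] y3].
  rewrite /rot12 /rot13 /rot2 /=.
  transitivity ((e ^+ 2 + f ^+ 2) * (c * x1 + s * x3) * (c * y1 + s * y3) +
    (e ^+ 2 + f ^+ 2) * (x2 * y2) + (- s * x1 + c * x3) * (- s * y1 + c * y3)).
    by ring.
  rewrite ef.
  transitivity ((c ^+ 2 + (- s) ^+ 2) * (x1 * y1 + x3 * y3) + x2 * y2); first by ring.
  by rewrite cs1; ring.
- rewrite /rot12 /rot13 /rot2 /=; congr (_, _, _).
  + by rewrite -es; ring.
  + by rewrite -fs; ring.
  + by ring.
Qed.

(** * Numerical bounds for sine, cosine and pi *)

Section derive_rules.
Context (R : realType).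
Implicit Types (f g : R -> R) (x df dg : R).

Lemma derC (c x : R) : is_derive x 1 (fun=> c) 0.
Proof. exact: is_derive_cst. Qed.
Lemma derI (x : R) : is_derive x 1 (fun y : R => y) 1.
Proof. exact: is_derive_id. Qed.
Lemma derD f g x df dg : is_derive x 1 f df -> is_derive x 1 g dg ->
  is_derive x 1 (fun y => f y + g y) (df + dg).
Proof. by move=> ? ?; exact: is_deriveD. Qed.
Lemma derN f x df : is_derive x 1 f df -> is_derive x 1 (fun y => - f y) (- df).
Proof. by move=> ?; exact: is_deriveN. Qed.
Lemma derM f g x df dg : is_derive x 1 f df -> is_derive x 1 g dg ->
  is_derive x 1 (fun y => f y * g y) (df * g x + f x * dg).
Proof.
move=> hf hg; rewrite (_ : df * g x + f x * dg = f x *: dg + g x *: df).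
  exact: is_deriveM.
by rewrite addrC; congr (_ + _); rewrite /GRing.scale/= mulrC.
Qed.
Lemma derX f n x df : is_derive x 1 f df ->
  is_derive x 1 (fun y => f y ^+ n) (n%:R * f x ^+ n.-1 * df).
Proof.
move=> hf; rewrite (_ : (fun y => f y ^+ n) = f ^+ n).
  exact: is_deriveX.
by apply/funext => y; rewrite exprfctE.
Qed.
Lemma der_eq f x df df' : is_derive x 1 f df -> df = df' -> is_derive x 1 f df'.
Proof. by move=> ? <-. Qed.

Lemma is_derive_continuous f x df : is_derive x 1 f df -> {for x, continuous f}.
Proof. by move=> [d _]; exact/differentiable_continuous/derivable1_diffP. Qed.

End derive_rules.

(** As in [measurable_step], the rule is chosen by the head symbol; the value
    of the derivative is compared at the end with [der_eq]. *)
Ltac derive_step :=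
  lazymatch goal with
  | |- is_derive _ _ (fun _ => ?c) _ => exact (derC c _)
  | |- is_derive _ _ (fun y => y) _ => exact (derI _)
  | |- is_derive _ _ (fun y => sin y) _ => exact (is_derive_sin _)
  | |- is_derive _ _ (fun y => cos y) _ => exact (is_derive_cos _)
  | |- is_derive _ _ (fun y => @?f y + @?g y) _ =>
      simple notypeclasses refine (@derD _ f g _ _ _ _ _)
  | |- is_derive _ _ (fun y => - @?f y) _ =>
    simple notypeclasses refine (@derN _ f _ _ _)
  | |- is_derive _ _ (fun y => @?f y * @?g y) _ =>
      simple notypeclasses refine (@derM _ f g _ _ _ _ _)
  | |- is_derive _ _ (fun y => @?f y ^+ ?n) _ =>
    simple notypeclasses refine (@derX _ f n _ _ _)
  end; cbv beta.

Ltac solve_derive :=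
  eapply der_eq; cbv beta; [ repeat derive_step | rewrite /=; try ring; try field ].

Section mean_value.
Context (R : realType).
Implicit Types (f df : R -> R).

Lemma mean_value f df (a b : R) : a < b ->
  (forall x : R, is_derive x 1 f (df x)) ->
  exists2 c, a < c < b & f b - f a = df c * (b - a).
Proof.
move=> ab fdf.
have h1 (x : R) : x \in `]a, b[ -> is_derive x 1 f (df x) by move=> _; exact: fdf.
have h2 : {within `[a, b], continuous f}.
  by apply: continuous_subspaceT => x; exact: is_derive_continuous (fdf x).
have [c] := MVT ab h1 h2.
by rewrite in_itv/= => cab e; exists c.
Qed.

Lemma nonneg_of_derive f df : (forall x : R, is_derive x 1 f (df x)) ->
  (forall x, 0 <= x -> 0 <= df x) -> f 0 = 0 ->
  forall x, 0 <= x -> 0 <= f x.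
Proof.
move=> fdf df0 f0 x; rewrite le_eqVlt => /predU1P[<-|x0]; first by rewrite f0.
have [c /andP[c0 cx]] := mean_value x0 fdf.
rewrite f0 !subr0 => ->.
by rewrite mulr_ge0 ?df0// ltW.
Qed.

(** Below zero in the interior, the function would have to descend first and
    ascend later, against the sign of its second derivative. *)
Lemma concave_ge0 f df ddf (a b : R) :
  (forall x : R, is_derive x 1 f (df x)) ->
  (forall x : R, is_derive x 1 df (ddf x)) ->
  (forall x, a <= x <= b -> ddf x <= 0) ->
  0 <= f a -> 0 <= f b -> forall x, a <= x <= b -> 0 <= f x.
Proof.
move=> fdf dfddf ddf0 fa fb x /andP[ax xb].
have [<-//|nax] := eqVneq a x.
have [->//|nxb] := eqVneq x b.
have {nax}ax' : a < x by rewrite lt_neqAle nax.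
have {nxb}xb' : x < b by rewrite lt_neqAle nxb.
rewrite leNgt; apply/negP => fx.
have [c /andP[ac cx] e1] := mean_value ax' fdf.
have [d /andP[xd db] e2] := mean_value xb' fdf.
have cd : c < d by rewrite (lt_trans cx).
have [e /andP[ce ed] e3] := mean_value cd dfddf.
have dfc : df c < 0.
  rewrite ltNge; apply/negP => h; have : 0 <= df c * (x - a) by apply: mulr_ge0 => //;
    rewrite subr_ge0 ltW.
  by rewrite -e1; lra.
have dfd : 0 < df d.
  rewrite ltNge; apply/negP => h; have : df d * (b - x) <= 0 by apply: mulr_le0_ge0 =>
    //; rewrite subr_ge0 ltW.
  by rewrite -e2 => h'; lra.
have : ddf e * (d - c) <= 0.
  apply: mulr_le0_ge0; last by rewrite subr_ge0 ltW.
  by apply: ddf0; lra.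
by rewrite -e3; lra.
Qed.

End mean_value.

Section trig_bounds.
Context (R : realType).
Implicit Types x : R.

(** Integrating [cos x <= 1] again and again gives the Taylor polynomials of
    sine and cosine as alternately upper and lower bounds on the half-line. *)
Lemma sin_leid x : 0 <= x -> 0 <= x - sin x.
Proof.
move=> x0.
have D (y : R) : is_derive y 1 (fun x => x - sin x) ((fun x => 1 - cos x) y).
  by solve_derive.
refine (@nonneg_of_derive _ (fun x => x - sin x) (fun x => 1 - cos x) D _ _ _ x0).
- by move=> y _; rewrite subr_ge0 cos_le1.
- by rewrite sin0 subr0.
Qed.

Lemma cos_ge2 x : 0 <= x -> 0 <= cos x - (1 - x ^+ 2 / 2).
Proof.
move=> x0.
have D (y : R) : is_derive y 1 (fun x => cos x - (1 - x ^+ 2 / 2))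
  ((fun x => x - sin x) y).
  by solve_derive.
refine (@nonneg_of_derive _ (fun x => cos x - (1 - x ^+ 2 / 2)) (fun x =>
  x - sin x) D _ _ _ x0).
- exact: sin_leid.
- by rewrite cos0; lra.
Qed.

Lemma sin_ge3 x : 0 <= x -> 0 <= sin x - (x - x ^+ 3 / 6).
Proof.
move=> x0.
have D (y : R) : is_derive y 1 (fun x => sin x - (x - x ^+ 3 / 6))
  ((fun x => cos x - (1 - x ^+ 2 / 2)) y).
  by solve_derive.
refine (@nonneg_of_derive _ (fun x => sin x - (x - x ^+ 3 / 6)) (fun x =>
  cos x - (1 - x ^+ 2 / 2)) D _ _ _ x0).
- exact: cos_ge2.
- by rewrite sin0; lra.
Qed.

Lemma cos_le4 x : 0 <= x -> 0 <= 1 - x ^+ 2 / 2 + x ^+ 4 / 24 - cos x.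
Proof.
move=> x0.
have D (y : R) : is_derive y 1 (fun x => 1 - x ^+ 2 / 2 + x ^+ 4 / 24 - cos x)
  ((fun x => sin x - (x - x ^+ 3 / 6)) y).
  by solve_derive.
refine (@nonneg_of_derive _ (fun x => 1 - x ^+ 2 / 2 + x ^+ 4 / 24 - cos x) (fun x =>
  sin x - (x - x ^+ 3 / 6)) D _ _ _ x0).
- exact: sin_ge3.
- by rewrite cos0; lra.
Qed.

Lemma sin_le5 x : 0 <= x -> 0 <= x - x ^+ 3 / 6 + x ^+ 5 / 120 - sin x.
Proof.
move=> x0.
have D (y : R) : is_derive y 1 (fun x => x - x ^+ 3 / 6 + x ^+ 5 / 120 - sin x)
  ((fun x => 1 - x ^+ 2 / 2 + x ^+ 4 / 24 - cos x) y).
  by solve_derive.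
refine (@nonneg_of_derive _ (fun x => x - x ^+ 3 / 6 + x ^+ 5 / 120 - sin x) (fun x =>
  1 - x ^+ 2 / 2 + x ^+ 4 / 24 - cos x) D _ _ _ x0).
- exact: cos_le4.
- by rewrite sin0; lra.
Qed.

Lemma cos_ge6 x : 0 <= x ->
  0 <= cos x - (1 - x ^+ 2 / 2 + x ^+ 4 / 24 - x ^+ 6 / 720).
Proof.
move=> x0.
have D (y : R) : is_derive y 1 (fun x =>
  cos x - (1 - x ^+ 2 / 2 + x ^+ 4 / 24 - x ^+ 6 / 720))
  ((fun x => x - x ^+ 3 / 6 + x ^+ 5 / 120 - sin x) y).
  by solve_derive.
refine (@nonneg_of_derive _ (fun x =>
  cos x - (1 - x ^+ 2 / 2 + x ^+ 4 / 24 - x ^+ 6 / 720)) (fun x =>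
  x - x ^+ 3 / 6 + x ^+ 5 / 120 - sin x) D _ _ _ x0).
- exact: sin_le5.
- by rewrite cos0; lra.
Qed.

Lemma sin_ge7 x : 0 <= x ->
  0 <= sin x - (x - x ^+ 3 / 6 + x ^+ 5 / 120 - x ^+ 7 / 5040).
Proof.
move=> x0.
have D (y : R) : is_derive y 1 (fun x =>
  sin x - (x - x ^+ 3 / 6 + x ^+ 5 / 120 - x ^+ 7 / 5040))
  ((fun x => cos x - (1 - x ^+ 2 / 2 + x ^+ 4 / 24 - x ^+ 6 / 720)) y).
  by solve_derive.
refine (@nonneg_of_derive _ (fun x =>
  sin x - (x - x ^+ 3 / 6 + x ^+ 5 / 120 - x ^+ 7 / 5040)) (fun x =>
  cos x - (1 - x ^+ 2 / 2 + x ^+ 4 / 24 - x ^+ 6 / 720)) D _ _ _ x0).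
- exact: cos_ge6.
- by rewrite sin0; lra.
Qed.

Lemma sqrt3_sq : Num.sqrt 3 ^+ 2 = 3 :> R.
Proof. by rewrite sqr_sqrtr. Qed.

(** Convergents of the continued fraction, already used by Archimedes to
    estimate [pi]. *)
Lemma sqrt3_bounds : 265 / 153 < Num.sqrt (3 : R) < 1351 / 780.
Proof.
have := sqrt3_sq; have := sqrtr_ge0 (3 : R).
by move: (Num.sqrt _) => q q0 q2; apply/andP; split; nra.
Qed.

(** By the formula for the triple angle, [sin (pi / 6)] is a root of [4 * s ^+
    3 - 3 * s + 1 = (s + 1) * (2 * s - 1) ^+ 2]. *)
Lemma sin_pi6 : sin (pi / 6) = 1 / 2 :> R.
Proof.
have /= := @sin_pihalf R; have := @pi_gt0 R => pi0.
have -> : pi / 2 = pi / 6 *+ 2 + pi / 6 :> R by field.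
rewrite sinD sin_mulr2n cos_mulr2n.
have s0 : 0 < sin (pi / 6 : R) by rewrite sin_gt0_pihalf//; lra.
have := cos2Dsin2 (pi / 6 : R).
move: (sin _) (cos _) s0 => s c s0 h1 h2.
have h3 : (s + 1) * (2 * s - 1) ^+ 2 = 0.
  have -> : (s + 1) * (2 * s - 1) ^+ 2 = 1 - (3 * s - 4 * s ^+ 3) by ring.
  have h4 : c ^+ 2 = 1 - s ^+ 2 by lra.
  have h5 : 4 * c ^+ 2 * s - s = 1 by rewrite -[RHS]h2; ring.
  have -> : 1 - (3 * s - 4 * s ^+ 3) = 4 * c ^+ 2 * s - s - (3 * s - 4 * s ^+ 3) by
    rewrite h5.
  by rewrite h4; ring.
move/eqP: h3; rewrite mulf_eq0 sqrf_eq0 => /orP[] /eqP; lra.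
Qed.

Lemma cos_pi6 : cos (pi / 6) = Num.sqrt 3 / 2 :> R.
Proof.
have pi0 := @pi_gt0 R.
have c0 : 0 < cos (pi / 6 : R) by rewrite cos_gt0_pihalf//; lra.
have := cos2Dsin2 (pi / 6 : R); rewrite sin_pi6 => h.
have := sqrt3_sq; have := sqrtr_ge0 (3 : R) => q0 q2.
move: c0 h; move: (cos _) => c c0 h.
have : (c - Num.sqrt 3 / 2) * (c + Num.sqrt 3 / 2) = 0.
  have -> : (c - Num.sqrt 3 / 2) * (c + Num.sqrt 3 / 2) = c ^+ 2 - (Num.sqrt 3) ^+ 2 /
    4 by field.
  by rewrite q2; lra.
by move/eqP; rewrite mulf_eq0 => /orP[] /eqP; lra.
Qed.

(** Both bounds come from comparing [sin (pi / 6) = 1 / 2] with Taylor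
    polynomials. The lower one is 3.1408; the margin in [cap_concave_le] asks
    for this precision. The upper one says that a hexagon circumscribed about
    the unit disk has a larger area than the disk. *)
Lemma pi_bounds : 1963 / 625 <= (pi : R) <= 2 * Num.sqrt 3.
Proof.
have pi0 := @pi_gt0 R; have sp := sin_pi6.
have mono x y : 0 <= x -> x < y -> y <= pi / 2 -> sin x < sin y.
  by move=> x0 xy y2; rewrite ltr_sin// in_itv/=; lra.
apply/andP; split.
- rewrite leNgt; apply/negP => h.
  (* 1963 / 3750 is the sixth part of 1963 / 625. *)
  have := @sin_le5 (1963 / 3750) ltac:(lra).
  have := @mono (pi / 6) (1963 / 3750) ltac:(lra) ltac:(lra).
  rewrite sp; have := @pi_ge2 R; move=> p2 h1.
  have {}h1 := h1 ltac:(lra).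
  by move=> h2; lra.
- rewrite leNgt; apply/negP => h.
  have /andP[q1 q2] := sqrt3_bounds.
  (* 577 / 1000 is slightly below [sqrt 3 / 3], yet its sine exceeds 1 / 2. *)
  have := @sin_ge3 (577 / 1000) ltac:(lra).
  have := @mono (577 / 1000) (pi / 6) ltac:(lra) ltac:(lra) ltac:(lra).
  by rewrite sp; lra.
Qed.

(** A dark angle has a cosine above [sqrt 3 - 1] ([dark_pos]), so it is less
    than 3 / 4. *)
Lemma cos_34 : cos (3 / 4) <= Num.sqrt 3 - 1 :> R.
Proof.
have := @cos_le4 (3 / 4) ltac:(lra); have /andP[] := sqrt3_bounds; lra.
Qed.

(** On the right is the area of the lit triangle in a sector of half-angle [a]
    and radius [2 / sqrt 3], on the left the share [kappa] of the area of the
    sector. The difference is concave and vanishes at both [0] and [pi / 6]. *)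
Lemma sin_concave_le (a : R) : 0 <= a <= pi / 6 ->
  2 * Num.sqrt 3 / pi * a <= 4 / 3 * (sin a * cos a).
Proof.
move=> aa; rewrite -subr_ge0; move: a aa.
have pi0 := @pi_gt0 R.
set k := _ / pi.
pose f (a : R) := 4 / 3 * (sin a * cos a) - k * a.
pose df (a : R) := 4 / 3 * (cos a ^+ 2 - sin a ^+ 2) - k.
pose ddf (a : R) := - (16 / 3 * (sin a * cos a)).
have D1 (y : R) : is_derive y 1 f (df y) by rewrite /f /df; solve_derive.
have D2 (y : R) : is_derive y 1 df (ddf y) by rewrite /df /ddf; solve_derive.
apply: (concave_ge0 D1 D2); rewrite /f /ddf.
- move=> x /andP[x0 x6]; rewrite oppr_le0 !mulr_ge0//.
    by rewrite sin_ge0_pi//; lra.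
  by rewrite cos_ge0_pihalf//; lra.
- by rewrite sin0; lra.
- rewrite sin_pi6 cos_pi6 /k.
  rewrite subr_ge0 le_eqVlt; apply/orP; left; apply/eqP.
  by move: (lt0r_neq0 pi0); move: (pi : R) => P P0; field.
Qed.

(** For half-angles above [pi / 6] the triangle is too small, and the area of
    a parabolic segment is added to it. The difference is again concave; it
    vanishes at [pi / 6] and is positive, though less than 1 / 1000, at 3 / 4. *)
Lemma cap_concave_le (a : R) : pi / 6 <= a <= 3 / 4 ->
  2 * Num.sqrt 3 / pi * a <=
  8 / 9 * Num.sqrt 3 * sin a - 4 / 9 * (sin a * cos a).
Proof.
move=> aa; rewrite -subr_ge0; move: a aa.
have pi0 := @pi_gt0 R.
have /andP[pl pu] := pi_bounds.
have /andP[ql qu] := sqrt3_bounds.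
set q := Num.sqrt 3.
set k := _ / pi.
pose f (a : R) := 8 / 9 * q * sin a - 4 / 9 * (sin a * cos a) - k * a.
pose df (a : R) := 8 / 9 * q * cos a - 4 / 9 * (cos a ^+ 2 - sin a ^+ 2) - k.
pose ddf (a : R) := 16 / 9 * sin a * (cos a - q / 2).
have D1 (y : R) : is_derive y 1 f (df y) by rewrite /f /df; solve_derive.
have D2 (y : R) : is_derive y 1 df (ddf y) by rewrite /df /ddf; solve_derive.
apply: (concave_ge0 D1 D2); rewrite /f /ddf.
- move=> x /andP[x0 x6]; rewrite mulr_ge0_le0// ?mulr_ge0//.
    by rewrite sin_ge0_pi//; lra.
  rewrite subr_le0 -cos_pi6.
  move: x0; rewrite le_eqVlt => /predU1P[->//|x0].
  by apply/ltW; rewrite ltr_cos// in_itv/=; lra.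
- rewrite sin_pi6 cos_pi6 /k -/q.
  rewrite subr_ge0 le_eqVlt; apply/orP; left; apply/eqP.
  by move: (lt0r_neq0 pi0); move: (pi : R) => P P0; field.
(* The required share at 3 / 4 is at most 91 / 110, which is less than the
   product of the lower bounds 92 / 135 of the sine and 607 / 500 of its
   cofactor. *)
- have h1 := @sin_ge7 (3 / 4) ltac:(lra).
  have h2 := @cos_le4 (3 / 4) ltac:(lra).
  have hk : k * (3 / 4) <= 91 / 110.
    rewrite /k mulrAC ler_pdivrMr//.
    rewrite (@le_trans _ _ (2 * (1351 / 780) * (3 / 4)))//; last by lra.
    by rewrite /q; lra.
  have h3 : 607 / 500 <= 8 / 9 * q - 4 / 9 * cos (3 / 4) by rewrite /q; lra.
  have h4 : 92 / 135 <= sin (3 / 4 : R) by lra.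
  have : 0 <= (sin (3 / 4 : R) - 92 / 135) * (8 / 9 * q - 4 / 9 * cos (3 / 4) - 607 /
    500).
    by apply: mulr_ge0; rewrite subr_ge0.
  move: h3 h4; move: (sin _) (cos _) (k * _) hk {h1 h2 pl pu ql qu} =>
    s c K hK h3 h4 h5.
  by lra.
Qed.

End trig_bounds.

(** * Areas and volumes by slicing *)

Section sections.
Local Open Scope ereal_scope.
Context d1 d2 (T1 : measurableType d1) (T2 : measurableType d2) (R : realType).
Variable m1 : {sigma_finite_measure set T1 -> \bar R}.
Variable m2 : {sigma_finite_measure set T2 -> \bar R}.
Implicit Types (A : set (T1 * T2)) (D : set T2) (f : T2 -> \bar R).

Lemma ysectionEset A y : ysection A y = [set x | A (x, y)].
Proof. by apply/seteqP; split => x; rewrite /ysection/= inE. Qed.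

(** Tonelli's theorem with one-sided information: slices need to be bounded
    only over [D]. *)
Lemma le_integral_product A D f : measurable A -> measurable D ->
  measurable_fun D f -> (forall y, D y -> 0 <= f y) ->
  (forall y, D y -> f y <= m1 [set x | A (x, y)]) ->
  \int[m2]_(y in D) f y <= (m1 \x m2) A.
Proof.
move=> mA mD mf f0 fA; rewrite product_measure12E//.
have mg : measurable_fun setT (m1 \o ysection A) by exact: measurable_fun_ysection.
apply: (@le_trans _ _ (\int[m2]_(y in D) (m1 \o ysection A) y)).
  apply: ge0_le_integral => //.
  - exact: measurable_funS mg.
  - by move=> y Dy /=; rewrite ysectionEset; exact: fA.
by apply: ge0_subset_integral.
Qed.

Lemma product_le_integral A D f : measurable A -> measurable D ->
  measurable_fun D f ->
  (forall x y, A (x, y) -> D y) ->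
  (forall y, D y -> m1 [set x | A (x, y)] <= f y) ->
  (m1 \x m2) A <= \int[m2]_(y in D) f y.
Proof.
move=> mA mD mf AD Af; rewrite product_measure12E//.
have mg : measurable_fun setT (m1 \o ysection A) by exact: measurable_fun_ysection.
rewrite [leLHS](_ : _ = \int[m2]_(y in D) (m1 \o ysection A) y); last first.
  rewrite [RHS]integral_mkcond; apply: eq_integral => y _ /=.
  rewrite patchE; case: ifPn => // yD; rewrite ysectionEset.
  rewrite (_ : [set x | A (x, y)] = set0) ?measure0//.
  apply/seteqP; split => x //= Axy; move/negP: yD; apply; rewrite inE.
  exact: AD Axy.
have fpos y : D y -> 0 <= f y by move=> /Af; exact: le_trans.
apply: ge0_le_integral => //.
- exact: measurable_funS mg.
- by move=> y Dy /=; rewrite ysectionEset; exact: Af.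
Qed.

End sections.

Section real_integrals.
Context (R : realType).
Local Notation mu := (@lebesgue_measure R).

Lemma integral_FTC (f F : R -> R) (a b : R) : a <= b ->
  continuous f -> continuous F ->
  (forall x : R, a < x < b -> is_derive x 1 F (f x)) ->
  (\int[mu]_(x in `[a, b]) (f x)%:E = (F b - F a)%R%:E)%E.
Proof.
rewrite le_eqVlt => /predU1P[<-|ab] cf cF dF.
  by rewrite set_itv1 integral_set1 subrr.
have der (x : R) : x \in `]a, b[ -> is_derive x 1 F (f x).
  by rewrite in_itv/=; exact: dF.
rewrite (@continuous_FTC2 _ f F)//.
- by apply: continuous_subspaceT.
- split.
  + by move=> x /der [].
  + exact/cvg_at_right_filter/cF.
  + exact/cvg_at_left_filter/cF.
- by move=> x /der; rewrite derive1E => -[_ ->].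
Qed.

Lemma continuous_chord (r : R) : continuous (fun x : R =>
  2 * Num.sqrt (r ^+ 2 - x ^+ 2)).
Proof.
move=> x; apply: (@continuousM R R (fun=> 2) (fun x => Num.sqrt (r ^+ 2 - x ^+ 2))).
  exact: cst_continuous.
apply: continuous_comp; last exact: sqrt_continuous.
by apply: continuousB; [exact: cst_continuous|exact: exprn_continuous].
Qed.

(** Area of the part of a disk between two parallel lines, by the substitution
    [x = r * sin a]. *)
Lemma integral_chord (r a b : R) : 0 < r -> - (pi / 2) <= a -> a <= b ->
  b <= pi / 2 ->
  (\int[mu]_(x in `[(r * sin a)%R, (r * sin b)%R])
     (2 * Num.sqrt (r ^+ 2 - x ^+ 2))%R%:E =
  (r ^+ 2 * (b - a + sin b * cos b - sin a * cos a))%R%:E)%E.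
Proof.
move=> r0 ha ab hb.
have dF (x : R) : is_derive x 1 (fun x => r * sin x) (r * cos x).
  by solve_derive.
have dF' : derive1 (fun x => r * sin x) = (fun x => r * cos x).
  by apply/funext => x; rewrite derive1E; case: (dF x).
have cF' : continuous (fun x : R => r * cos x).
  by move=> x; apply: continuousM; [exact: cst_continuous|exact: continuous_cos].
have cF : continuous (fun x : R => r * sin x).
  by move=> x; apply: continuousM; [exact: cst_continuous|exact: continuous_sin].
rewrite (@integration_by_substitution_increasing _ (fun x => r * sin x)
  (fun x => 2 * Num.sqrt (r ^+ 2 - x ^+ 2)))//; first last.
- by apply: continuous_subspaceT; exact: continuous_chord.
- split.
  + by move=> x _; case: (dF x).
  + exact/cvg_at_right_filter/cF.
  + exact/cvg_at_left_filter/cF.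
- by rewrite dF'; apply/cvg_ex; exists (r * cos b); exact/cvg_at_left_filter/cF'.
- by rewrite dF'; apply/cvg_ex; exists (r * cos a); exact/cvg_at_right_filter/cF'.
- by rewrite dF' => x _; exact: cF'.
- move=> x y; rewrite !in_itv/= => /andP[ax xb] /andP[ay yb] xy.
  by rewrite ltr_pM2l// ltr_sin// in_itv/=; lra.
rewrite dF'.
transitivity (\int[mu]_(x in `[a, b]) (2 * r ^+ 2 * cos x ^+ 2)%R%:E)%E.
  apply: eq_integral => x; rewrite inE/= in_itv/= => /andP[ax xb]; congr EFin.
  transitivity (2 * Num.sqrt (r ^+ 2 - (r * sin x) ^+ 2) * (r * cos x)) => //.
  have -> : r ^+ 2 - (r * sin x) ^+ 2 = (r * cos x) ^+ 2.
    by rewrite !exprMn cos2sin2; ring.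
  rewrite sqrtr_sqr ger0_norm; first by ring.
  rewrite mulr_ge0//; first exact: ltW.
  by rewrite cos_ge0_pihalf//; lra.
have cf : continuous (fun x : R => 2 * r ^+ 2 * cos x ^+ 2).
  move=> x; apply: (@continuousM _ _ (fun=> 2 * r ^+ 2) (fun x => cos x ^+ 2)).
    exact: cst_continuous.
  apply: (@continuous_comp _ _ _ (@cos R) (fun y => y ^+ 2)).
    exact: continuous_cos.
  exact: exprn_continuous.
have cG : continuous (fun x : R => r ^+ 2 * (x + sin x * cos x)).
  move=> x; apply: (@continuousM _ _ (fun=> r ^+ 2) (fun x => x + sin x * cos x)).
    exact: cst_continuous.
  apply: (@continuousD _ _ _ id (fun x => sin x * cos x)); first exact: cvg_id.
  by apply: (@continuousM _ _ (@sin R) (@cos R));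
    [exact: continuous_sin|exact: continuous_cos].
have dG (x : R) : a < x < b ->
    is_derive x 1 (fun x => r ^+ 2 * (x + sin x * cos x)) (2 * r ^+ 2 * cos x ^+ 2).
  move=> _.
  have -> : 2 * r ^+ 2 * cos x ^+ 2 = r ^+ 2 * (1 + (cos x * cos x - sin x * sin x)).
    by rewrite -!expr2 sin2cos2; ring.
  by solve_derive.
by rewrite (integral_FTC ab cf cG dG); congr EFin; ring.
Qed.

End real_integrals.

Section areas.
Context (R : realType).
Implicit Types (a b w y t : R) (A : set (mR R * mR R)).
Local Notation leb := (@lebesgue_measure R).

Lemma measurable_EFinT d (T : measurableType d) (D : set T) (f : T -> R) :
  measurable_fun D f -> measurable_fun D (EFin \o f).
Proof. by move=> mf; exact/measurable_EFinP. Qed.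

Lemma continuous_measurable (f : R -> R) (D : set (mR R)) :
  continuous f -> measurable_fun D (f : mR R -> mR R).
Proof.
by move=> cf; apply: (measurable_funS measurableT) => //;
  exact: continuous_measurable_fun.
Qed.

Lemma lebesgue_oo a b : a <= b -> (leb [set x | (a < x < b)%R] = (b - a)%R%:E)%E.
Proof.
move=> ab; rewrite [X in leb X](_ : _ = `]a, b[%classic); last first.
  by apply/seteqP; split => x /=; rewrite in_itv.
rewrite lebesgue_measure_itv/= lte_fin.
by case: ltgtP ab => // -> _; rewrite subrr.
Qed.

Lemma lebesgue_cc a b : a <= b -> (leb [set x | (a <= x <= b)%R] = (b - a)%R%:E)%E.
Proof.
move=> ab; rewrite [X in leb X](_ : _ = `[a, b]%classic); last first.
  by apply/seteqP; split => x /=; rewrite in_itv.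
rewrite lebesgue_measure_itv/= lte_fin.
by case: ltgtP ab => // -> _; rewrite subrr.
Qed.

Lemma lebesgue_sqr_lt w : 0 <= w ->
  (leb [set x | (x ^+ 2 < w)%R] = (2 * Num.sqrt w)%R%:E)%E.
Proof.
move=> w0; rewrite [X in leb X](_ : _ = [set x | - Num.sqrt w < x < Num.sqrt w]).
  by rewrite lebesgue_oo; [congr EFin; ring|have := sqrtr_ge0 w; lra].
have sw := sqr_sqrtr w0; have := sqrtr_ge0 w.
move: (Num.sqrt w) sw => s <- s0.
apply/seteqP; split => x /=; first by move=> h; nra.
by move=> /andP[h1 h2]; nra.
Qed.

Lemma lebesgue_sqr_le w : 0 <= w ->
  (leb [set x | (x ^+ 2 <= w)%R] = (2 * Num.sqrt w)%R%:E)%E.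
Proof.
move=> w0; rewrite [X in leb X](_ : _ = [set x | - Num.sqrt w <= x <= Num.sqrt w]).
  by rewrite lebesgue_cc; [congr EFin; ring|have := sqrtr_ge0 w; lra].
have sw := sqr_sqrtr w0; have := sqrtr_ge0 w.
move: (Num.sqrt w) sw => s <- s0.
apply/seteqP; split => x /=; first by move=> h; nra.
by move=> /andP[h1 h2]; nra.
Qed.

Lemma disk_integral (r : R) : 0 < r ->
  (\int[leb]_(x in `[(- r)%R, r]) (2 * Num.sqrt (r ^+ 2 - x ^+ 2))%R%:E =
   (pi * r ^+ 2)%R%:E)%E.
Proof.
move=> r0; have p0 := @pi_gt0 R.
have := @integral_chord R r (- (pi / 2)) (pi / 2) r0 ltac:(lra) ltac:(lra) ltac:(lra).
rewrite sinN cosN sin_pihalf cos_pihalf mulrN mulr1 => ->.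
by congr EFin; field.
Qed.

Lemma measurable_disk_lt w : measurable [set z : mR R * mR R | z.1 ^+ 2 + z.2 ^+ 2 < w].
Proof. by apply: measurable_lt_set; solve_measurable. Qed.

Lemma measurable_disk_le w : measurable [set z : mR R * mR R | z.1 ^+ 2 + z.2 ^+ 2 <=
  w].
Proof. by apply: measurable_le_set; solve_measurable. Qed.

(** The lower bound is for the open disk and the upper bound [disk_area_le]
    for the closed one, so that boundaries never have to be shown negligible. *)
Lemma disk_area_ge w : 0 <= w ->
  ((pi * w)%R%:E <= area [set z | (z.1 ^+ 2 + z.2 ^+ 2 < w)%R])%E.
Proof.
rewrite le_eqVlt => /predU1P[<-|w0]; first by rewrite mulr0.
have sw := sqr_sqrtr (ltW w0); have s0 : 0 < Num.sqrt w by rewrite sqrtr_gt0.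
rewrite -{1}sw -disk_integral//.
apply: le_integral_product.
- exact: measurable_disk_lt.
- exact: measurable_itv.
- by apply: measurable_EFinT; apply: continuous_measurable; exact: continuous_chord.
- by move=> y _; rewrite lee_fin mulr_ge0// sqrtr_ge0.
- move=> y /=; rewrite in_itv/= => /andP[h1 h2].
  rewrite -lebesgue_sqr_lt; last by rewrite subr_ge0; clear sw; nra.
  by rewrite sw le_eqVlt; apply/orP; left; apply/eqP; congr (leb _); apply/seteqP;
    split => x /=; rewrite ltrBrDr.
Qed.

Lemma disk_area_le w : 0 <= w ->
  (area [set z | (z.1 ^+ 2 + z.2 ^+ 2 <= w)%R] <= (pi * w)%R%:E)%E.
Proof.
rewrite le_eqVlt => /predU1P[<-|w0].
  rewrite mulr0 [leLHS](_ : _ = area ([set 0] `*` [set 0])).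
    by rewrite /area product_measure1E//= lebesgue_measure_set1 mule0.
  congr (area _); apply/seteqP; split => -[x y] /=.
    move=> h; have := sqr_ge0 x; have := sqr_ge0 y => h1 h2.
    by split; apply/eqP; rewrite -sqrf_eq0; apply/eqP; lra.
  by move=> [-> ->]; rewrite expr0n/= addr0.
have sw := sqr_sqrtr (ltW w0); have s0 : 0 < Num.sqrt w by rewrite sqrtr_gt0.
rewrite -{2}sw -disk_integral//.
apply: product_le_integral.
- exact: measurable_disk_le.
- exact: measurable_itv.
- by apply: measurable_EFinT; apply: continuous_measurable; exact: continuous_chord.
- by move=> x y /= h; rewrite in_itv/=; have := sqr_ge0 x; nra.
- move=> y /=; rewrite in_itv/= => /andP[h1 h2].
  rewrite -lebesgue_sqr_le; last by rewrite subr_ge0; clear sw; nra.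
  by rewrite sw le_eqVlt; apply/orP; left; apply/eqP; congr (leb _); apply/seteqP;
    split => x /=; rewrite lerBrDr.
Qed.

Lemma measurable_and d (T : measurableType d) (P Q : set T) :
  measurable P -> measurable Q -> measurable [set x | P x /\ Q x].
Proof. exact: measurableI. Qed.

Lemma measurable_andb d (T : measurableType d) (P Q : T -> bool) :
  measurable [set x | P x] -> measurable [set x | Q x] ->
  measurable [set x | P x && Q x].
Proof.
move=> mP mQ; rewrite [X in measurable X](_ : _ = [set x | P x] `&` [set x | Q x]).
  exact: measurableI.
by apply/seteqP; split => x /= /andP.
Qed.

Lemma derivable_continuous (f df : R -> R) :
  (forall x : R, is_derive x 1 f (df x)) -> continuous f.
Proof. by move=> H x; exact: is_derive_continuous (H x). Qed.

Lemma slab_integral (rad a b : R) : a <= b ->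
  (\int[leb]_(x in `[a, b]) (pi * (rad ^+ 2 - x ^+ 2))%R%:E =
   (pi * (rad ^+ 2 * (b - a) - (b ^+ 3 - a ^+ 3) / 3))%R%:E)%E.
Proof.
move=> ab.
have D1 (x : R) : is_derive x 1 (fun x => pi * (rad ^+ 2 * x - x ^+ 3 / 3))
  (pi * (rad ^+ 2 - x ^+ 2)).
  by move: (pi : R) => P; solve_derive.
have D2 (x : R) : is_derive x 1 (fun x => pi * (rad ^+ 2 - x ^+ 2)) (- pi * 2 * x).
  by move: (pi : R) => P; solve_derive.
rewrite (integral_FTC ab (derivable_continuous D2) (derivable_continuous D1)
  (fun x _ => D1 x)).
by congr EFin; move: (pi : R) => P; field.
Qed.

Lemma continuous_slab (rad : R) : continuous (fun x : R => pi * (rad ^+ 2 - x ^+ 2)).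
Proof.
have D2 (x : R) : is_derive x 1 (fun x => pi * (rad ^+ 2 - x ^+ 2)) (- pi * 2 * x).
  by move: (pi : R) => P; solve_derive.
exact: derivable_continuous D2.
Qed.

Lemma ball_slab_le (rad a b : R) : 0 <= rad -> - rad <= a -> a <= b -> b <= rad ->
  (vol [set z | (a <= z.2 <= b)%R /\ (z.1.1 ^+ 2 + z.1.2 ^+ 2 + z.2 ^+ 2 <= rad ^+ 2)%R]
   <= (pi * (rad ^+ 2 * (b - a) - (b ^+ 3 - a ^+ 3) / 3))%R%:E)%E.
Proof.
move=> r0 ra ab br; rewrite -slab_integral//.
apply: (@product_le_integral _ _ _ _ _ (@area R)).
- apply: measurable_and.
    by apply: measurable_andb; apply: measurable_le_set; solve_measurable.
  by apply: measurable_le_set; solve_measurable.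
- exact: measurable_itv.
- by apply: measurable_EFinT; apply: continuous_measurable; exact: continuous_slab.
- by move=> x y /= [h _]; rewrite in_itv.
- move=> y /=; rewrite in_itv/= => /andP[h1 h2].
  apply: (le_trans _ (disk_area_le _)); last by rewrite subr_ge0; nra.
  apply: le_measure; rewrite ?inE.
  + apply: measurable_and; first by apply: measurable_andb; apply: measurable_le_set;
      solve_measurable.
    by apply: measurable_le_set; solve_measurable.
  + exact: measurable_disk_le.
  + by move=> z /= [_]; lra.
Qed.

Lemma ball_slab_ge (rad a b : R) : 0 <= rad -> - rad <= a -> a <= b -> b <= rad ->
  ((pi * (rad ^+ 2 * (b - a) - (b ^+ 3 - a ^+ 3) / 3))%R%:E <=
   vol [set z | (a <= z.2 <= b)%R /\
     (z.1.1 ^+ 2 + z.1.2 ^+ 2 + z.2 ^+ 2 < rad ^+ 2)%R])%E.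
Proof.
move=> r0 ra ab br; rewrite -slab_integral//.
have p0 := @pi_gt0 R.
apply: (@le_integral_product _ _ _ _ _ (@area R)).
- apply: measurable_and.
    by apply: measurable_andb; apply: measurable_le_set; solve_measurable.
  by apply: measurable_lt_set; solve_measurable.
- exact: measurable_itv.
- by apply: measurable_EFinT; apply: continuous_measurable; exact: continuous_slab.
- by move=> y /=; rewrite in_itv/= => h; rewrite lee_fin mulr_ge0//; [exact: ltW|nra].
- move=> y /=; rewrite in_itv/= => /andP[h1 h2].
  apply: (le_trans (disk_area_ge _)); first by rewrite subr_ge0; nra.
  apply: le_measure; rewrite ?inE.
  + exact: measurable_disk_lt.
  + apply: measurable_and; first by apply: measurable_andb; apply: measurable_le_set;
      solve_measurable.
    by apply: measurable_lt_set; solve_measurable.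
  + by move=> z /= h; split; lra.
Qed.

Lemma cylinder_vol_le (t : R) : 0 <= t ->
  (vol [set z | (0 <= z.2 <= t)%R /\ (z.1.1 ^+ 2 + z.1.2 ^+ 2 <= 1)%R] <=
    (pi * t)%R%:E)%E.
Proof.
move=> t0; have p0 := @pi_gt0 R.
have lt : (leb `[0%R, t]%classic = t%:E)%E.
  rewrite lebesgue_measure_itv/= lte_fin.
  by case: ltgtP t0 => // [_ _|<- _]; rewrite -?EFinB ?subr0.
have -> : ((pi * t)%R%:E = \int[leb]_(x in `[0%R, t]) (cst (pi : R)%:E x))%E.
  by rewrite integral_cst// EFinM; congr (_ * _)%E; rewrite -lt.
apply: (@product_le_integral _ _ _ _ _ (@area R)).
- apply: measurable_and.
    by apply: measurable_andb; apply: measurable_le_set; solve_measurable.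
  by apply: measurable_le_set; solve_measurable.
- exact: measurable_itv.
- exact: measurable_cst.
- by move=> x y /= [h _]; rewrite in_itv.
- move=> y /=; rewrite in_itv/= => h.
  apply: (@le_trans _ _ (pi * 1)%R%:E); last by rewrite mulr1.
  apply: le_trans (disk_area_le ler01).
  apply: le_measure; rewrite ?inE.
  + apply: measurable_and; first by apply: measurable_andb; apply: measurable_le_set;
      solve_measurable.
    by apply: measurable_le_set; solve_measurable.
  + exact: measurable_disk_le.
  + by move=> z /= [_].
Qed.

End areas.

(** * The gap between a line and the origin *)

Section gap.
Context (R : realType).
Implicit Types (d x y : R) (e u z w p q : R * R).

Definition dot2 (x y : R * R) : R := x.1 * y.1 + x.2 * y.2.

(** Let a line in space have distance [d] from the origin of the plane, let
    [u] be its unit direction and [e] the unit vector from the origin to the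
    foot of the perpendicular, both projected to the plane. Then [gap d e u z]
    is the squared distance from [z] to the line minus the squared distance
    from [z] to the origin ([line_gap]). *)
Definition gap d e u z : R := d ^+ 2 - 2 * d * dot2 e z - dot2 u z ^+ 2.

(** The property of projections to a plane of two orthonormal vectors of space
    on which the estimates rely. *)
Definition bessel e u := forall z, dot2 e z ^+ 2 + dot2 u z ^+ 2 <= dot2 z z.

Lemma dot2_ge0 z : 0 <= dot2 z z.
Proof. by rewrite /dot2 -!expr2 addr_ge0 ?sqr_ge0. Qed.

(** [gap] is concave, and its value at the origin is [d ^+ 2]. *)
Lemma gap_comb d e u p q (l m : R) : 0 <= l -> 0 <= m -> l + m <= 1 ->
  0 <= gap d e u p -> 0 <= gap d e u q ->
  (1 - (l + m)) * d ^+ 2 <= gap d e u (l *: p + m *: q).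
Proof.
move=> l0 m0 lm; rewrite /gap.
have -> : dot2 e (l *: p + m *: q) = l * dot2 e p + m * dot2 e q.
  by rewrite /dot2 /= /GRing.scale /=; ring.
have -> : dot2 u (l *: p + m *: q) = l * dot2 u p + m * dot2 u q.
  by rewrite /dot2 /= /GRing.scale /=; ring.
move: (dot2 e p) (dot2 e q) (dot2 u p) (dot2 u q) => a b s t h1 h2.
have k1 : 0 <= l * (d ^+ 2 - 2 * d * a - s ^+ 2) by rewrite mulr_ge0.
have k2 : 0 <= m * (d ^+ 2 - 2 * d * b - t ^+ 2) by rewrite mulr_ge0.
have k3 : 0 <= l * m * (s - t) ^+ 2 by exact: (mulr_ge0 (mulr_ge0 l0 m0) (sqr_ge0 _)).
have k4 : 0 <= (1 - (l + m)) * (l * s ^+ 2 + m * t ^+ 2).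
  apply: mulr_ge0; first lra.
  exact: (addr_ge0 (mulr_ge0 l0 (sqr_ge0 _)) (mulr_ge0 m0 (sqr_ge0 _))).
rewrite !expr2 in k1 k2 k3 k4 *; lra.
Qed.

Lemma gap_scale d e u z (l : R) : 0 <= l -> l <= 1 -> 0 <= gap d e u z ->
  (1 - l) * d ^+ 2 <= gap d e u (l *: z).
Proof.
move=> l0 l1 hz.
have := @gap_comb d e u z 0 l 0 l0 (lexx 0) ltac:(lra) hz.
rewrite scaler0 !addr0; apply.
by rewrite /gap /dot2 /= !mulr0 !addr0 expr0n/= mulr0 !subr0 sqr_ge0.
Qed.

(** The points of the open unit disk are closer to the origin than to a line
    at distance 2 or more. *)
Lemma gap_unit d e u z : 2 <= d -> bessel e u -> dot2 z z < 1 -> 0 < gap d e u z.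
Proof.
move=> d2 /(_ z); rewrite /gap.
have := dot2_ge0 z; move: (dot2 e z) (dot2 u z) (dot2 z z) => a b n n0 h n1.
have : a < 1.
  by rewrite ltNge; apply/negP => h2; have := sqr_ge0 b; nra.
have := sqr_ge0 b.
nra.
Qed.

Lemma gap_unit_le d e u z : 2 <= d -> bessel e u -> dot2 z z <= 1 -> 0 <= gap d e u z.
Proof.
move=> d2 /(_ z); rewrite /gap.
have := dot2_ge0 z; move: (dot2 e z) (dot2 u z) (dot2 z z) => a b n n0 h n1.
have : a <= 1.
  by rewrite leNgt; apply/negP => h2; have := sqr_ge0 b; nra.
have := sqr_ge0 b.
nra.
Qed.

(** The mirror images of [(Y, X)] in each of the axes are not dark, so by
    concavity [gap] does not increase from [(Y, X)] away from the axes, in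
    either coordinate. The sign of [Y] is left open to serve both ends of an
    arc. *)
Lemma gap_corner d e u (X Y x y : R) : gap d e u (Y, X) = 0 ->
  0 <= gap d e u (- Y, X) -> 0 <= gap d e u (Y, - X) -> 0 < X -> Y != 0 ->
  0 <= (x - Y) * Y -> X <= y -> gap d e u (x, y) <= 0.
Proof.
move=> h0 h1 h2 X0 Y0 xY Xy.
pose U := u.1 * Y + u.2 * X.
pose G1 := - (2 * d * e.1) - 2 * U * u.1.
pose G2 := - (2 * d * e.2) - 2 * U * u.2.
have E (v w : R) : gap d e u (v, w) = gap d e u (Y, X) + G1 * (v - Y) + G2 * (w - X) -
  (u.1 * (v - Y) + u.2 * (w - X)) ^+ 2.
  by rewrite /G1 /G2 /U /gap /dot2 /=; ring.
have g1 : G1 * Y <= 0.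
  move: h1; rewrite E h0; have := sqr_ge0 (u.1 * (- Y - Y) + u.2 * (X - X)).
  by move: (_ ^+ 2) => Q; lra.
have g2 : G2 <= 0.
  move: h2; rewrite E h0; have := sqr_ge0 (u.1 * (Y - Y) + u.2 * (- X - X)).
  move: (_ ^+ 2) => Q Q0 h.
  have : G2 * X <= 0 by lra.
  by rewrite pmulr_lle0.
rewrite E h0 add0r.
have k1 : G1 * (x - Y) <= 0.
  have Y2 : 0 < Y ^+ 2 by rewrite exprn_even_gt0.
  rewrite -(pmulr_lle0 _ Y2).
  have -> : G1 * (x - Y) * Y ^+ 2 = (G1 * Y) * ((x - Y) * Y) by ring.
  by rewrite mulr_le0_ge0.
have k2 : G2 * (y - X) <= 0 by rewrite mulr_le0_ge0// subr_ge0.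
have := sqr_ge0 (u.1 * (x - Y) + u.2 * (y - X)); lra.
Qed.

(** The reason why a dark arc has no holes. Concavity alone controls the
    chord, while a point of the circle is [l *: z1 + m *: z3] with [l + m]
    between 1 and 2. The excess [l + m - 1] enters with the favourable factor
    [d ^+ 2 >= 4]; being on the circle relates it to [l * m] times the squared
    length of the chord, and by [bessel] this dominates the loss due to
    concavity. *)
Lemma arc_convex d e u z1 z3 (l m : R) : 2 <= d -> bessel e u ->
  0 < l -> 0 < m -> l + m <= 2 ->
  dot2 z1 z1 = 4 / 3 -> dot2 z3 z3 = 4 / 3 ->
  dot2 (l *: z1 + m *: z3) (l *: z1 + m *: z3) = 4 / 3 ->
  gap d e u z1 <= 0 -> gap d e u z3 <= 0 ->
  gap d e u z1 + gap d e u z3 < 0 -> gap d e u (l *: z1 + m *: z3) < 0.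
Proof.
move=> d2 B l0 m0 lm n1 n3.
have -> : dot2 (l *: z1 + m *: z3) (l *: z1 + m *: z3) =
  l ^+ 2 * dot2 z1 z1 + m ^+ 2 * dot2 z3 z3 + 2 * (l * m) * dot2 z1 z3.
  by rewrite /dot2 /= /GRing.scale /=; ring.
have := B (z1 - z3).
have -> : dot2 (z1 - z3) (z1 - z3) = dot2 z1 z1 + dot2 z3 z3 - 2 * dot2 z1 z3.
  by rewrite /dot2 /=; ring.
have -> : dot2 u (z1 - z3) = dot2 u z1 - dot2 u z3 by rewrite /dot2 /=; ring.
rewrite n1 n3 /gap.
have -> : dot2 e (l *: z1 + m *: z3) = l * dot2 e z1 + m * dot2 e z3.
  by rewrite /dot2 /= /GRing.scale /=; ring.
have -> : dot2 u (l *: z1 + m *: z3) = l * dot2 u z1 + m * dot2 u z3.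
  by rewrite /dot2 /= /GRing.scale /=; ring.
have := sqr_ge0 (dot2 e (z1 - z3)).
move: (dot2 e _ ^+ 2) (dot2 e z1) (dot2 e z3) (dot2 u z1) (dot2 u z3) (dot2 z1 z3).
move=> E a b s t c E0 h1 h2 g1 g3 g13.
have lm0 : 0 < l * m by rewrite mulr_gt0.
(* [8 / 3 - 2 * c] is the squared distance from [z1] to [z3]; this expresses
   that [l *: z1 + m *: z3] is on the circle. *)
have k1 : (l + m) ^+ 2 - 1 = l * m * (3 / 4) * (8 / 3 - 2 * c) by lra.
have st : (s - t) ^+ 2 <= 8 / 3 - 2 * c by lra.
have k2 : l * m * (3 / 4) * (s - t) ^+ 2 <= (l + m) ^+ 2 - 1.
  by rewrite k1 ler_pM2l//; nra.
have k3 : 1 <= l + m.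
  have : 0 <= (l + m) ^+ 2 - 1.
    apply: le_trans k2; apply: mulr_ge0; last exact: sqr_ge0.
    by apply: mulr_ge0; [exact: ltW|lra].
  by nra.
have g : l * (d ^+ 2 - 2 * d * a - s ^+ 2) + m * (d ^+ 2 - 2 * d * b - t ^+ 2) < 0.
  have [ga|ga] := ltP (d ^+ 2 - 2 * d * a - s ^+ 2) 0.
    by rewrite ltr_wnDr ?nmulr_llt0// pmulr_rle0.
  by rewrite ltr_wnDl ?pmulr_rle0// pmulr_rlt0//; lra.
have k4 : l * m * (s - t) ^+ 2 <= (l + m - 1) * d ^+ 2.
  have k5 : l * m * (s - t) ^+ 2 <= (4 / 3) * ((l + m - 1) * (l + m + 1)) by lra.
  apply: (le_trans k5).
  have -> : 4 / 3 * ((l + m - 1) * (l + m + 1)) = (l + m - 1) * (4 / 3 * (l + m + 1))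
    by ring.
  by apply: ler_wpM2l; [lra|nra].
have k6 : 0 <= (l + m - 1) * (l * s ^+ 2 + m * t ^+ 2).
  apply: mulr_ge0; first by rewrite subr_ge0.
  exact: (addr_ge0 (mulr_ge0 (ltW l0) (sqr_ge0 _)) (mulr_ge0 (ltW m0) (sqr_ge0 _))).
rewrite !expr2 in g k4 k6 *; lra.
Qed.

End gap.

(** * Areas of sectors, triangles and parabolic segments *)

Section sector_areas.
Context (R : realType).
Implicit Types (r alpha x y T : R).
Local Notation leb := (@lebesgue_measure R).

(** The sector of half-angle [alpha] about the second coordinate axis, for
    acute [alpha]. Linear inequalities serve better here than angles of
    points. *)
Definition cone (alpha : R) (z : R * R) : bool :=
  (z.1 * cos alpha < z.2 * sin alpha) && (- z.1 * cos alpha < z.2 * sin alpha).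

Lemma measurable_cone alpha : measurable [set z : mR R * mR R | cone alpha z].
Proof. by apply: measurable_andb; apply: measurable_lt_set; solve_measurable. Qed.

Lemma linear_integral (T x0 : R) : 0 <= x0 ->
  (\int[leb]_(y in `[0%R, x0]) (2 * T * y)%R%:E = (T * x0 ^+ 2)%R%:E)%E.
Proof.
move=> x00.
have D1 (x : R) : is_derive x 1 (fun x => T * x ^+ 2) (2 * T * x) by solve_derive.
have D2 (x : R) : is_derive x 1 (fun x => 2 * T * x) (2 * T) by solve_derive.
rewrite (integral_FTC x00 (derivable_continuous D2) (derivable_continuous D1)
  (fun x _ => D1 x)).
by congr EFin; ring.
Qed.

Lemma continuous_linear (T : R) : continuous (fun y : R => 2 * T * y).
Proof.
have D2 (x : R) : is_derive x 1 (fun x => 2 * T * x) (2 * T) by solve_derive.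
exact: derivable_continuous D2.
Qed.

Lemma le_of_sqr (y r : R) : 0 < r -> y ^+ 2 <= r ^+ 2 -> y <= r.
Proof. by move=> r0 h; rewrite leNgt; apply/negP => hy; nra. Qed.

Lemma disk_snd_le (x y r : R) : 0 < r -> x ^+ 2 + y ^+ 2 < r ^+ 2 -> y <= r.
Proof.
by move=> r0 h; apply: le_of_sqr => //; have := sqr_ge0 x; lra.
Qed.

Lemma linear_ge0 (T y : R) : 0 < T -> 0 <= y -> 0 <= 2 * T * y.
Proof. by move=> T0 y0; rewrite mulr_ge0 ?mulr_ge0// ltW. Qed.

Lemma sqr_le_of (a y r : R) : 0 <= a -> a <= y -> y <= r -> y ^+ 2 <= r ^+ 2.
Proof. by move=> a0 ay yr; nra. Qed.

Lemma acute_trig (alpha : R) : 0 < alpha -> alpha < pi / 2 ->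
  [/\ 0 < cos alpha, 0 < sin alpha, 0 < (sin alpha / cos alpha) &
    (sin alpha / cos alpha) * cos alpha = sin alpha].
Proof.
move=> a0 a2.
have c0 : 0 < cos alpha.
  by rewrite cos_gt0_pihalf// a2 andbT (lt_trans _ a0)// oppr_lt0 divr_gt0 ?pi_gt0.
have s0 : 0 < sin alpha by rewrite sin_gt0_pihalf// a0.
by split => //; [rewrite divr_gt0|rewrite divfK// gt_eqF].
Qed.

Lemma coneE (alpha : R) z : 0 < alpha -> alpha < pi / 2 ->
  cone alpha z = (- (z.2 * (sin alpha / cos alpha)) < z.1 < z.2 *
    (sin alpha / cos alpha)).
Proof.
move=> a0 a2; have [c0 s0 T0 Tcs] := acute_trig a0 a2.
have E : z.2 * sin alpha = z.2 * (sin alpha / cos alpha) * cos alpha by rewrite -mulrA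
  Tcs.
by rewrite /cone E !(ltr_pM2r c0) andbC ltrNl.
Qed.

Lemma cone_section (alpha : R) y : 0 < alpha -> alpha < pi / 2 -> 0 <= y ->
  (leb [set x | cone alpha (x, y)] = (2 * (sin alpha / cos alpha) * y)%:E)%E.
Proof.
move=> a0 a2; have [c0 s0 T0 Tcs] := acute_trig a0 a2.
move=> y0; rewrite [X in leb X](_ : _ = [set x | - (y * (sin alpha / cos alpha)) < x <
  y * (sin alpha / cos alpha)]); last first.
  by apply/seteqP; split => x /=; rewrite coneE.
have := mulr_ge0 y0 (ltW T0).
rewrite (_ : 2 * (sin alpha / cos alpha) * y = 2 * (y * (sin alpha / cos alpha)));
  last by ring.
move: (y * (sin alpha / cos alpha)) => q q0; rewrite lebesgue_oo; last by lra.
by congr EFin; ring.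
Qed.

Lemma triangle_area (r alpha : R) : 0 < alpha -> alpha < pi / 2 ->
  (sin alpha / cos alpha) * (r * cos alpha) ^+ 2 = r ^+ 2 * (sin alpha * cos alpha).
Proof.
move=> a0 a2; have [c0 s0 T0 Tcs] := acute_trig a0 a2.
by transitivity (r ^+ 2 * ((sin alpha / cos alpha) * cos alpha * cos alpha));
  [ring|rewrite Tcs].
Qed.

(** The chord at height [r * cos alpha] splits the sector into a triangle and
    a circular segment. *)
Lemma sector_area_le (r alpha : R) : 0 < r -> 0 < alpha -> alpha < pi / 2 ->
  (area [set z | cone alpha z /\ (z.1 ^+ 2 + z.2 ^+ 2 < r ^+ 2)%R] <=
    (r ^+ 2 * alpha)%R%:E)%E.
Proof.
move=> r0; move=> a0 a2; have [c0 s0 T0 Tcs] := acute_trig a0 a2.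
pose A1 : set (mR R * mR R) := [set z | cone alpha z && (z.2 <= r * cos alpha)].
pose A2 : set (mR R * mR R) :=
  [set z | (r * cos alpha <= z.2) && (z.1 ^+ 2 + z.2 ^+ 2 < r ^+ 2)].
have mA1 : measurable A1.
  apply: measurable_andb; first exact: measurable_cone.
  by apply: measurable_le_set; solve_measurable.
have mA2 : measurable A2.
  apply: measurable_andb; first by apply: measurable_le_set; solve_measurable.
  by apply: measurable_lt_set; solve_measurable.
have h1 : (area A1 <= (r ^+ 2 * (sin alpha * cos alpha))%R%:E)%E.
  rewrite -(triangle_area r a0 a2) -linear_integral; last by rewrite mulr_ge0 ?ltW.
  apply: product_le_integral => //.
  - by apply: measurable_EFinT; apply: continuous_measurable; exact: continuous_linear.
  - move=> x y /= /andP[+ h]; rewrite coneE//= in_itv/= h andbT => /andP[h2 h3].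
    have : 0 < y * (sin alpha / cos alpha) by lra.
    by rewrite pmulr_lgt0// => /ltW.
  - move=> y /=; rewrite in_itv/= => /andP[y0 yx].
    rewrite -(cone_section a0 a2)//; apply: le_measure; rewrite ?inE//.
    + have := measurable_ysection y mA1.
      by rewrite ysectionEset.
    + have := measurable_ysection y (measurable_cone alpha).
      by rewrite ysectionEset.
    + by move=> x /= /andP[].
have h2 : (area A2 <= (r ^+ 2 * (alpha - sin alpha * cos alpha))%R%:E)%E.
  have -> : r ^+ 2 * (alpha - sin alpha * cos alpha) = r ^+ 2 *
    (pi / 2 - (pi / 2 - alpha) + sin (pi / 2) * cos (pi / 2) - sin (pi / 2 - alpha) *
    cos (pi / 2 - alpha)).
    by rewrite sinB cosB sin_pihalf cos_pihalf; ring.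
  have p0 := @pi_gt0 R.
  rewrite -integral_chord//; [|lra..].
  rewrite sinB sin_pihalf cos_pihalf mul1r mul0r subr0 mulr1.
  apply: product_le_integral => //.
  - by apply: measurable_EFinT; apply: continuous_measurable; exact: continuous_chord.
  - move=> x y /= /andP[h k]; rewrite in_itv/= h/=.
    exact: disk_snd_le k.
  - move=> y /=; rewrite in_itv/= => /andP[h k].
    rewrite -lebesgue_sqr_le; last first.
      by rewrite subr_ge0; apply: (sqr_le_of _ h k); rewrite mulr_ge0// ltW.
    apply: le_measure; rewrite ?inE//.
    + have := measurable_ysection y mA2.
      by rewrite ysectionEset.
    + by apply: (@measurable_le_set _ (mR R)); solve_measurable.
    + by move=> x /= /andP[_ hx]; rewrite lerBrDr ltW.
have -> : r ^+ 2 * alpha = r ^+ 2 * (sin alpha * cos alpha) + r ^+ 2 *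
  (alpha - sin alpha * cos alpha) by ring.
rewrite EFinD; apply: (@le_trans _ _ (area (A1 `|` A2))).
  apply: le_measure; rewrite ?inE.
  - apply: measurable_and; first exact: measurable_cone.
    by apply: measurable_lt_set; solve_measurable.
  - exact: measurableU.
  - move=> z [k1 k2]; have [h|h] := leP z.2 (r * cos alpha).
      by left; rewrite /A1 /= k1.
    by right; rewrite /A2 /= (ltW h).
by apply: (le_trans (measureU2 _ _ _)) => //; exact: leeD.
Qed.

(** Only the part of [A] below the chord is counted, so that the bound of
    [area_ge_cap] for the part above can be added. *)
Lemma area_ge_triangle (r alpha : R) (A : set (mR R * mR R)) :
  0 < r -> 0 < alpha -> alpha < pi / 2 ->
  measurable A ->
  (forall z, 0 < z.2 -> z.2 < r * cos alpha -> cone alpha z -> A z) ->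
  ((r ^+ 2 * (sin alpha * cos alpha))%R%:E <= area
    (A `&` [set z | z.2 < r * cos alpha]%R))%E.
Proof.
move=> r0; move=> a0 a2; have [c0 s0 T0 Tcs] := acute_trig a0 a2.
move=> mA H; rewrite -(triangle_area r a0 a2) -linear_integral;
  last by rewrite mulr_ge0 ?ltW.
rewrite -(integral_itv_bndo_bndc (f := fun x =>
  (2 * (sin alpha / cos alpha) * x)%:E)); last first.
  by apply: measurable_EFinT; apply: continuous_measurable; exact: continuous_linear.
apply: le_integral_product.
- apply: measurableI => //.
  by apply: measurable_lt_set; solve_measurable.
- exact: measurable_itv.
- by apply: measurable_EFinT; apply: continuous_measurable; exact: continuous_linear.
- by move=> y /=; rewrite in_itv/= => /andP[y0 _]; rewrite lee_fin; exact: linear_ge0.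
- move=> y /=; rewrite in_itv/= => /andP[y0 yx].
  rewrite -(cone_section a0 a2)//; apply: le_measure; rewrite ?inE//.
  + have := measurable_ysection y (measurable_cone alpha).
    by rewrite ysectionEset.
  + have mA' : measurable (A `&` [set z | z.2 < r * cos alpha]).
      by apply: measurableI => //; apply: measurable_lt_set; solve_measurable.
    by have := measurable_ysection y mA'; rewrite ysectionEset.
  + move=> x /= hx; split => //; apply: H => //=.
    by move: hx; rewrite coneE//= => h; rewrite -(pmulr_lgt0 _ T0); lra.
Qed.

(** Quadrature of the parabola: two thirds of the base [2 * y0] times the
    height. *)
Lemma cap_integral (x0 y0 : R) : x0 < 1 -> 0 < y0 ->
  (\int[leb]_(y in `[x0, 1%R]) (2 * y0 * Num.sqrt ((1 - y) / (1 - x0)))%R%:E =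
   (4 / 3 * y0 * (1 - x0))%R%:E)%E.
Proof.
move=> x01 y00.
have k0 : 0 < 1 - x0 by rewrite subr_gt0.
pose s (y : R) := (1 - y) / (1 - x0).
have Ds (y : R) : is_derive y 1 s (- (1 - x0)^-1) by rewrite /s; solve_derive.
have cs := derivable_continuous Ds.
have cq : continuous (fun y => Num.sqrt (s y)).
  by move=> y; apply: continuous_comp; [exact: cs|exact: sqrt_continuous].
have cf : continuous (fun y => 2 * y0 * Num.sqrt (s y)).
  move=> y; apply: (@continuousM R R (fun=> 2 * y0) (fun y => Num.sqrt (s y))).
    exact: cst_continuous.
  exact: cq.
have cF : continuous (fun y => - (4 / 3) * y0 * (1 - x0) * (s y * Num.sqrt (s y))).
  move=> y; apply: (@continuousM R R (fun=> - (4 / 3) * y0 * (1 - x0)) (fun y =>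
    s y * Num.sqrt (s y))).
    exact: cst_continuous.
  by apply: (@continuousM R R s (fun y => Num.sqrt (s y))); [exact: cs|exact: cq].
have dF (y : R) : x0 < y < 1 ->
  is_derive y 1 (fun y => - (4 / 3) * y0 * (1 - x0) * (s y * Num.sqrt (s y)))
  (2 * y0 * Num.sqrt (s y)).
  move=> /andP[h1 h2].
  have sy : 0 < s y by rewrite divr_gt0// subr_gt0.
  have Dq : is_derive y 1 (fun y => Num.sqrt (s y))
    ((2 * Num.sqrt (s y))^-1 * - (1 - x0)^-1).
    exact: (@is_derive1_comp _ Num.sqrt s y _ _ (is_derive1_sqrt sy) (Ds y)).
  have Dm := derM (derC (- (4 / 3) * y0 * (1 - x0)) y) (derM (Ds y) Dq).
  apply: (der_eq Dm).
  have q0 : 0 < Num.sqrt (s y) by rewrite sqrtr_gt0.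
  have q2 : s y = Num.sqrt (s y) ^+ 2 by rewrite sqr_sqrtr// ltW.
  rewrite [X in X * (_ * - _)]q2; move: (Num.sqrt (s y)) q0 => q q0.
  move: (1 - x0) k0 => k k0; field.
  by rewrite !gt_eqF.
rewrite (integral_FTC (ltW x01) cf cF dF); congr EFin.
by rewrite /s subrr !mul0r mulr0 divff ?gt_eqF// sqrtr1; ring.
Qed.

Lemma continuous_cap (x0 y0 : R) : continuous (fun y : R =>
  2 * y0 * Num.sqrt ((1 - y) / (1 - x0))).
Proof.
have Ds (y : R) : is_derive y 1 (fun y => (1 - y) / (1 - x0)) (- (1 - x0)^-1) by
  solve_derive.
have cs := derivable_continuous Ds.
move=> y; apply: (@continuousM R R (fun=> 2 * y0) (fun y =>
  Num.sqrt ((1 - y) / (1 - x0)))).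
  exact: cst_continuous.
by apply: continuous_comp; [exact: cs|exact: sqrt_continuous].
Qed.

(** Compares [A] with a parabolic segment that has a base of half-width [y0]
    at height [x0] and its vertex at height 1. The sections of [A] need not be
    centred, only long enough. *)
Lemma area_ge_cap (x0 y0 : R) (A : set (mR R * mR R)) : measurable A ->
  x0 < 1 -> 0 < y0 ->
  (forall y, x0 < y -> y < 1 -> exists m w : R,
     y0 * Num.sqrt ((1 - y) / (1 - x0)) <= w /\
     forall x, m - w < x < m + w -> A (x, y)) ->
  ((4 / 3 * y0 * (1 - x0))%R%:E <= area (A `&` [set z | x0 < z.2]%R))%E.
Proof.
move=> mA x01 y00 H; rewrite -cap_integral//.
rewrite -(integral_itv_bndo_bndc (f := fun y =>
  (2 * y0 * Num.sqrt ((1 - y) / (1 - x0)))%:E)); last first.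
  by apply: measurable_EFinT; apply: continuous_measurable; exact: continuous_cap.
rewrite -(integral_itv_obnd_cbnd (f := fun y =>
  (2 * y0 * Num.sqrt ((1 - y) / (1 - x0)))%:E)); last first.
  by apply: measurable_EFinT; apply: continuous_measurable; exact: continuous_cap.
have mA' : measurable (A `&` [set z | x0 < z.2]).
  by apply: measurableI => //; apply: measurable_lt_set; solve_measurable.
apply: le_integral_product => //.
- by apply: measurable_EFinT; apply: continuous_measurable; exact: continuous_cap.
- by move=> y _; rewrite lee_fin !mulr_ge0// ?ltW// sqrtr_ge0.
- move=> y /=; rewrite in_itv/= => /andP[xy y1].
  have [m [w [hw hA]]] := H y xy y1.
  have w0 : 0 <= w by apply: le_trans hw; rewrite mulr_ge0 ?sqrtr_ge0// ltW.
  apply: (@le_trans _ _ ((m + w) - (m - w))%:E); first by rewrite lee_fin; lra.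
  rewrite -lebesgue_oo; last by lra.
  apply: le_measure; rewrite ?inE//.
  + by apply: measurable_andb; apply: (@measurable_lt_set _ (mR R)); solve_measurable.
  + by have := measurable_ysection y mA'; rewrite ysectionEset.
  + by move=> x /= hx; split => //; exact: hA.
Qed.

End sector_areas.

(** * Dark sectors in symmetric position *)

Section symmetric_sector.
Context (R : realType).
Implicit Types (d alpha : R) (e u z : R * R).

(** Circumradius of the regular hexagon circumscribed about the unit disk. *)
Definition hex_radius : R := 2 / Num.sqrt 3.
Local Notation rho := hex_radius.

Lemma hex_radius_gt0 : 0 < hex_radius.
Proof. by rewrite divr_gt0// sqrtr_gt0. Qed.

Lemma hex_radius_sq : hex_radius ^+ 2 = 4 / 3.
Proof. by rewrite expr_div_n sqr_sqrtr//; field. Qed.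

Lemma measurable_gap d e u : measurable_fun [set: mR R * mR R] (gap d e u).
Proof. by rewrite /gap /dot2; solve_measurable. Qed.

Lemma measurable_dot2 : measurable_fun [set: mR R * mR R] (fun z => dot2 z z).
Proof. by rewrite /dot2; solve_measurable. Qed.

Definition lit_sector d e u alpha : set (mR R * mR R) :=
  [set z | cone alpha z /\ (dot2 z z < 4 / 3) && (0 < gap d e u z)].

Lemma measurable_lit_sector d e u alpha : measurable (lit_sector d e u alpha).
Proof.
apply: measurable_and; first exact: measurable_cone.
apply: measurable_andb; apply: measurable_lt_set.
- exact: measurable_dot2.
- exact: measurable_cst.
- exact: measurable_cst.
- exact: measurable_gap.
Qed.

(** Coordinates with respect to the two extreme radii of the sector. *)
Lemma cone_comb alpha z : 0 < alpha -> alpha < pi / 2 -> cone alpha z ->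
  exists l m, [/\ 0 < l, 0 < m &
    z = ((l - m) * (rho * sin alpha), (l + m) * (rho * cos alpha))].
Proof.
move=> a0 a2; have [c0 s0 _ _] := acute_trig a0 a2.
have r0 := hex_radius_gt0.
case: z => x y /andP[/= h1 h2].
move: (cos alpha) (sin alpha) rho c0 s0 r0 h1 h2 => c s r c0 s0 r0 h1 h2.
have k0 : 0 < 2 * r * s * c by rewrite !mulr_gt0.
exists ((y * s + x * c) / (2 * r * s * c)), ((y * s - x * c) / (2 * r * s * c)).
split; [by rewrite divr_gt0//; lra|by rewrite divr_gt0//; lra|].
have := lt0r_neq0 c0; have := lt0r_neq0 s0; have := lt0r_neq0 r0 => n1 n2 n3.
by congr pair; field; rewrite n1 n2 n3.
Qed.

Section caps.
Variables (d : R) (e u : R * R) (alpha : R).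
Let X := rho * cos alpha.
Let Y := rho * sin alpha.

(** The gap is zero at both ends of the arc and positive at the centre, so
    concavity gives its sign in the triangle. *)
Lemma triangle_lit z : 2 <= d -> 0 < alpha -> alpha < pi / 2 ->
  gap d e u (Y, X) = 0 -> gap d e u (- Y, X) = 0 ->
  0 < z.2 -> z.2 < X -> cone alpha z -> lit_sector d e u alpha z.
Proof.
move=> d2 a0 a2 gp gq z0 zX cz; split => //.
have [c0 s0 _ _] := acute_trig a0 a2.
have r0 := hex_radius_gt0.
have X0 : 0 < X by rewrite mulr_gt0.
have Y0 : 0 < Y by rewrite mulr_gt0.
have [l [m [l0 m0 zE]]] := cone_comb a0 a2 cz.
have lm : l + m < 1.
  by move: zX; rewrite zE /= -/X gtr_pMl.
have XY : X ^+ 2 + Y ^+ 2 = 4 / 3.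
  transitivity (rho ^+ 2 * (cos alpha ^+ 2 + sin alpha ^+ 2)); first by rewrite /X /Y;
    ring.
  by rewrite cos2Dsin2 mulr1 hex_radius_sq.
have zc : z = l *: (Y, X) + m *: (- Y, X).
  rewrite zE -/X -/Y; transitivity (l * Y + m * - Y, l * X + m * X) => //.
  by congr pair; ring.
apply/andP; split.
  rewrite zE /dot2 /= -/X -/Y -XY.
  have k1 : 0 < (1 - (l + m) ^+ 2) * X ^+ 2.
    by rewrite mulr_gt0 ?exprn_gt0// subr_gt0 exprn_ilt1//; lra.
  have k2 : 0 < (1 - (l - m) ^+ 2) * Y ^+ 2.
    by rewrite mulr_gt0 ?exprn_gt0// subr_gt0; nra.
  by rewrite !expr2 in k1 k2 *; lra.
rewrite zc; apply: lt_le_trans (gap_comb (ltW l0) (ltW m0) (ltW lm) _ _).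
- by rewrite mulr_gt0 ?subr_gt0// exprn_gt0//; lra.
- by rewrite gp.
- by rewrite gq.
Qed.

(** Above the chord, [gap_corner] at the two ends of the arc keeps a lit point
    between the vertical lines through them, hence in the sector. It is also
    in the disk: by concavity along its ray, a lit point beyond the circle
    would make a point of the dark arc lit. *)
Lemma cap_lit x y : 2 <= d -> 0 < alpha -> alpha < pi / 2 ->
  gap d e u (Y, X) = 0 -> gap d e u (- Y, X) = 0 ->
  0 <= gap d e u (Y, - X) -> 0 <= gap d e u (- Y, - X) ->
  (forall z, dot2 z z = 4 / 3 -> cone alpha z -> gap d e u z < 0) ->
  X < y -> 0 < gap d e u (x, y) -> lit_sector d e u alpha (x, y).
Proof.
move=> d2 a0 a2 gp gq gp' gq' dark Xy gxy.
have [c0 s0 _ _] := acute_trig a0 a2.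
have r0 := hex_radius_gt0.
have X0 : 0 < X by rewrite mulr_gt0.
have Y0 : 0 < Y by rewrite mulr_gt0.
have xY : x < Y.
  rewrite ltNge; apply/negP => Yx; have : gap d e u (x, y) <= 0.
    apply: (gap_corner gp) => //; first by rewrite gq.
    + exact: lt0r_neq0.
    + by rewrite mulr_ge0 ?subr_ge0// ltW.
    + exact: ltW.
  by rewrite leNgt gxy.
have xY' : - Y < x.
  rewrite ltNge; apply/negP => Yx; have : gap d e u (x, y) <= 0.
    apply: (gap_corner gq) => //; first by rewrite opprK gp.
    + by rewrite oppr_eq0; exact: lt0r_neq0.
    + by rewrite mulrN -mulNr mulr_ge0//; [lra|exact: ltW].
    + exact: ltW.
  by rewrite leNgt gxy.
have XYs : X * sin alpha = Y * cos alpha by rewrite /X /Y; ring.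
have ys : X * sin alpha < y * sin alpha by rewrite ltr_pM2r.
have cz : cone alpha (x, y).
  apply/andP; split => /=.
    by apply: lt_trans ys; rewrite XYs ltr_pM2r.
  by apply: lt_trans ys; rewrite XYs ltr_pM2r//; lra.
split => //; rewrite gxy andbT ltNge; apply/negP => far.
(* The ray through a lit point beyond the circle meets the dark arc. *)
pose l := rho / Num.sqrt (dot2 (x, y) (x, y)).
have n0 : 0 < dot2 (x, y) (x, y) by lra.
have q0 : 0 < Num.sqrt (dot2 (x, y) (x, y)) by rewrite sqrtr_gt0.
have l0 : 0 < l by rewrite divr_gt0.
have l2 : l ^+ 2 * dot2 (x, y) (x, y) = 4 / 3.
  by rewrite expr_div_n hex_radius_sq sqr_sqrtr ?divfK ?gt_eqF// ltW.
clearbody l.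
have l1 : l <= 1.
  by rewrite leNgt; apply/negP => h; have : 1 < l ^+ 2; nra.
have := dark (l *: (x, y)).
have := gap_scale (ltW l0) l1 (ltW gxy).
have -> : dot2 (l *: (x, y)) (l *: (x, y)) = 4 / 3.
  by rewrite -l2 /dot2 /= /GRing.scale /=; ring.
move=> h1 h2; have {}h2 : gap d e u (l *: (x, y)) < 0.
  apply: h2 => //; rewrite -[l *: (x, y)]/(l * x, l * y).
  move/andP: cz => /= [h3 h4]; apply/andP; split => /=.
    by rewrite -!mulrA ltr_pM2l.
  by rewrite -mulrN -!mulrA ltr_pM2l.
have : 0 <= (1 - l) * d ^+ 2 by rewrite mulr_ge0 ?subr_ge0// sqr_ge0.
by move=> h3; have := le_lt_trans (le_trans h3 h1) h2; rewrite ltxx.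
Qed.

(** For fixed [y] the lit points form the interval between the roots of a
    quadratic polynomial in [x] whose discriminant, up to a factor 4, is [b y
    ^+ 2 + a * c y]. This is affine in [y], nonnegative at 1, and at least [(a
    * y0) ^+ 2] at [x0], where [- y0] and [y0] belong to the closed interval.
    So at [y] it is at least [(a * y0) ^+ 2] times [(1 - y) / (1 - x0)]. *)
Lemma chord_width x0 y0 (y : R) (c : R -> R) (b : R -> R) (a : R) : 0 < a -> x0 < 1 ->
  0 < y0 ->
  (forall y, b y ^+ 2 + a * c y = b 0 ^+ 2 + a * c 0 + y *
    (b 1 ^+ 2 + a * c 1 - (b 0 ^+ 2 + a * c 0))) ->
  0 <= c 1 -> 0 <= - a * y0 ^+ 2 - 2 * b x0 * y0 + c x0 ->
  0 <= - a * y0 ^+ 2 + 2 * b x0 * y0 + c x0 ->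
  x0 < y -> y < 1 -> exists m w : R,
  y0 * Num.sqrt ((1 - y) / (1 - x0)) <= w /\
  forall x, m - w < x < m + w -> 0 < - a * x ^+ 2 - 2 * b y * x + c y.
Proof.
move=> a0 x1 y00 lin c1 hp hq xy y1.
pose D := b y ^+ 2 + a * c y.
pose s := (1 - y) / (1 - x0).
have k0 : 0 < 1 - x0 by rewrite subr_gt0.
have s0 : 0 < s by rewrite divr_gt0// subr_gt0.
have sE : s * (1 - x0) = 1 - y by rewrite divfK// gt_eqF.
have Dx : a ^+ 2 * y0 ^+ 2 <= b x0 ^+ 2 + a * c x0.
  have : a * y0 ^+ 2 <= c x0 by lra.
  by move=> h; have := sqr_ge0 (b x0); nra.
have D1 : 0 <= b 1 ^+ 2 + a * c 1.
  by rewrite addr_ge0 ?sqr_ge0// mulr_ge0// ltW.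
have Ds : s * (a ^+ 2 * y0 ^+ 2) <= D.
  apply: (@le_trans _ _ (s * (b x0 ^+ 2 + a * c x0))); first by rewrite ler_pM2l.
  rewrite /D lin [leRHS]lin.
  move: (b 0 ^+ 2 + a * c 0) (b 1 ^+ 2 + a * c 1) D1 => D0 D1 D1p.
  have sx : 0 <= 1 - s.
    rewrite subr_ge0 /s ler_pdivrMr// mul1r; lra.
  have : 0 <= (1 - s) * D1 by rewrite mulr_ge0.
  have -> : s * (D0 + x0 * (D1 - D0)) = D0 * (s * (1 - x0)) + s * x0 * D1 by ring.
  have -> : s * x0 * D1 = s * D1 - (s * (1 - x0)) * D1 by ring.
  by rewrite sE; lra.
have D0 : 0 <= D.
  apply: le_trans Ds; apply: mulr_ge0 (ltW s0) _.
  by apply: mulr_ge0; exact: sqr_ge0.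
exists (- b y / a), (Num.sqrt D / a); split.
  rewrite ler_pdivlMr// -/s.
  rewrite -(ger0_norm (_ : 0 <= y0 * Num.sqrt s * a));
    last by rewrite !mulr_ge0 ?sqrtr_ge0// ltW.
  rewrite -sqrtr_sqr ler_sqrt//; apply: le_trans Ds; rewrite !exprMn sqr_sqrtr;
    last exact: ltW.
  by rewrite le_eqVlt; apply/orP; left; apply/eqP; ring.
move=> x /andP[h1 h2].
have q0 := sqrtr_ge0 D; have q2 := sqr_sqrtr D0.
have k1 : - Num.sqrt D < a * x + b y.
  by move: h1; rewrite -mulrBl ltr_pdivrMr//; lra.
have k2 : a * x + b y < Num.sqrt D.
  by move: h2; rewrite -mulrDl ltr_pdivlMr//; lra.
have k3 : (a * x + b y) ^+ 2 < D by rewrite -q2; nra.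
rewrite -(pmulr_rgt0 _ a0).
have -> : a * (- a * x ^+ 2 - 2 * b y * x + c y) = (b y ^+ 2 + a * c y) -
  (a * x + b y) ^+ 2 by ring.
by rewrite subr_gt0.
Qed.

(** Up to [pi / 6] the triangle suffices. Beyond it the chord is at a height
    less than 1, and [chord_width] adds a parabolic segment. *)
Lemma sector_gap_sym : 2 <= d -> bessel e u -> 0 < alpha -> alpha <= 3 / 4 ->
  gap d e u (Y, X) = 0 -> gap d e u (- Y, X) = 0 ->
  0 <= gap d e u (Y, - X) -> 0 <= gap d e u (- Y, - X) ->
  (forall z, dot2 z z = 4 / 3 -> cone alpha z -> gap d e u z < 0) ->
  ((2 * Num.sqrt 3 / pi * alpha)%:E <= area (lit_sector d e u alpha))%E.
Proof.
move=> d2 B a0 a34 gp gq gp' gq' dark.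
have p0 := @pi_gt0 R; have [pl pu] := andP (@pi_bounds R).
have a2 : alpha < pi / 2 by lra.
have [c0 s0 _ _] := acute_trig a0 a2.
have r0 := hex_radius_gt0.
have X0 : 0 < X by rewrite mulr_gt0.
have Y0 : 0 < Y by rewrite mulr_gt0.
have mA := measurable_lit_sector d e u alpha.
have tri := @area_ge_triangle R rho alpha (lit_sector d e u alpha) r0 a0 a2 mA
  (fun z => @triangle_lit z d2 a0 a2 gp gq).
rewrite hex_radius_sq in tri.
have mT : measurable [set z : mR R * mR R | z.2 < X].
  by apply: measurable_lt_set; solve_measurable.
have mC : measurable [set z : mR R * mR R | X < z.2].
  by apply: measurable_lt_set; solve_measurable.
have [a6|a6] := leP alpha (pi / 6).
  apply: (@le_trans _ _ (4 / 3 * (sin alpha * cos alpha))%:E).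
    by rewrite lee_fin; apply: sin_concave_le; rewrite a6 ltW.
  apply: (le_trans tri); apply: le_measure; rewrite ?inE//.
  by apply: measurableI => //; exact: mT.
have qb := @sqrt3_bounds R; have q3 := @sqrt3_sq R.
have q0 : 0 < Num.sqrt 3 :> R by rewrite sqrtr_gt0.
have X1 : X < 1.
  have h : cos alpha < Num.sqrt 3 / 2.
    by rewrite -cos_pi6 ltr_cos// in_itv/=; clear -pl pu a0 a34 a6 a2; lra.
  rewrite /X /hex_radius mulrAC ltr_pdivrMr// mul1r; lra.
have u0 : 0 < u.1 ^+ 2.
  (* Otherwise [gap] is affine on the chord, hence zero at the midpoint of the
     chord, which is in the unit disk. *)
  rewrite exprn_even_gt0//=; apply/eqP => u10.
  have h : 0 < gap d e u (0, X).
    by apply: gap_unit => //; rewrite /dot2 /= mul0r add0r; nra.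
  move: gp gq h; rewrite /gap /dot2 /= u10; lra.
(* [gap] as a quadratic polynomial in the first coordinate. *)
pose b (y : R) := d * e.1 + u.1 * u.2 * y.
pose c (y : R) := d ^+ 2 - 2 * d * e.2 * y - u.2 ^+ 2 * y ^+ 2.
have gE x y : gap d e u (x, y) = - (u.1 ^+ 2) * x ^+ 2 - 2 * b y * x + c y.
  by rewrite /gap /b /c /dot2 /=; ring.
have lin y : b y ^+ 2 + u.1 ^+ 2 * c y = b 0 ^+ 2 + u.1 ^+ 2 * c 0 + y *
  (b 1 ^+ 2 + u.1 ^+ 2 * c 1 - (b 0 ^+ 2 + u.1 ^+ 2 * c 0)).
  by rewrite /b /c; ring.
have c1 : 0 <= c 1.
  have -> : c 1 = gap d e u (0, 1) by rewrite gE expr0n/= !mulr0 subr0 add0r.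
  by apply: gap_unit_le => //; rewrite /dot2 /= mul0r add0r mulr1.
have hp : 0 <= - (u.1 ^+ 2) * Y ^+ 2 - 2 * b X * Y + c X by rewrite -gE gp.
have hq : 0 <= - (u.1 ^+ 2) * Y ^+ 2 + 2 * b X * Y + c X.
  by have := gE (- Y) X; rewrite gq sqrrN mulrN opprK => <-.
have cap := @area_ge_cap R X Y (lit_sector d e u alpha) mA X1 Y0.
have {}cap := cap (fun y Xy y1 => let: ex_intro m (ex_intro w (conj h1 h2)) :=
  chord_width u0 X1 Y0 lin c1 hp hq Xy y1 in
   ex_intro _ m (ex_intro _ w (conj h1 (fun x hx =>
     @cap_lit x y d2 a0 a2 gp gq gp' gq' dark Xy (eq_ind_r (fun g => 0 < g) (h2 x hx)
     (gE x y)))))).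
apply: (@le_trans _ _ (4 / 3 * (sin alpha * cos alpha) + 4 / 3 * Y * (1 - X))%:E).
  rewrite lee_fin; apply: le_trans (cap_concave_le _) _; first by rewrite (ltW a6).
  have -> : 4 / 3 * Y * (1 - X) = 4 / 3 * Y - 4 / 3 * (rho ^+ 2) *
    (sin alpha * cos alpha).
    by rewrite /Y /X; ring.
  rewrite hex_radius_sq.
  have -> : 4 / 3 * Y = 8 / 9 * Num.sqrt 3 * sin alpha.
    rewrite /Y /hex_radius; have ->
      : 8 / 9 = 8 / 3 / (Num.sqrt 3 ^+ 2) :> R by rewrite q3; field.
    by field; rewrite gt_eqF.
  lra.
rewrite EFinD; apply: le_trans (leeD tri cap) _.
pose L := lit_sector d e u alpha.
have mLT := measurableI L _ mA mT; have mLC := measurableI L _ mA mC.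
have disj : (L `&` [set z | z.2 < X]) `&` (L `&` [set z | X < z.2]) = set0.
  by apply/seteqP; split => z //= [[_ h1] [_ h2]]; have := lt_trans h1 h2; rewrite ltxx.
rewrite -[leLHS](measureU (@area R) mLT mLC disj).
apply: le_measure; rewrite ?inE//; first exact: measurableU.
by move=> z [] [].
Qed.

End caps.
End symmetric_sector.

(** * Dark arcs *)

Section shadows.
Context (R : realType).
Implicit Types (d alpha theta : R) (e u z w : R * R).
Local Notation rho := (hex_radius R).

(** Angles are measured from the second coordinate axis, the axis of the
    sectors [cone]. *)
Definition circ (theta : R) : R * R := (rho * sin theta, rho * cos theta).

Lemma dot2_circ theta : dot2 (circ theta) (circ theta) = 4 / 3.
Proof.
rewrite /dot2 /=; transitivity (rho ^+ 2 * (cos theta ^+ 2 + sin theta ^+ 2));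
  first by ring.
by rewrite cos2Dsin2 hex_radius_sq mulr1.
Qed.

Lemma rot2_circ theta theta0 :
  rot2 (cos theta0) (- sin theta0) (circ theta) = circ (theta + theta0).
Proof. by rewrite /rot2 /circ /= sinD cosD; congr pair; ring. Qed.

Lemma circ_param z : dot2 z z = 4 / 3 -> 0 < z.2 ->
  exists2 theta, - (pi / 2) < theta < pi / 2 & z = circ theta.
Proof.
case: z => x y; rewrite /dot2 /= => n y0.
rewrite /circ; have := @hex_radius_gt0 R; have := @hex_radius_sq R; move: rho =>
  r r2 r0.
have x1 : -1 < x / r < 1.
  rewrite ltr_pdivlMr// ltr_pdivrMr// mulN1r mul1r.
  by apply/andP; split; nra.
have x1' : -1 <= x / r <= 1 by lra.
exists (asin (x / r)).
  by rewrite asin_gtNpi2 ?asin_ltpi2//; lra.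
rewrite asinK; last by rewrite in_itv.
rewrite cos_asin//; congr pair; first by rewrite mulrC divfK// gt_eqF.
have -> : 1 - (x / r) ^+ 2 = (y / r) ^+ 2.
  by rewrite !expr_div_n r2; lra.
rewrite sqrtr_sqr ger0_norm; last by rewrite divr_ge0// ltW.
by rewrite mulrC divfK// gt_eqF.
Qed.

Lemma cone_circ alpha theta :
  cone alpha (circ theta) = (0 < sin (alpha - theta)) && (0 < sin (alpha + theta)).
Proof.
rewrite /cone /=; congr (_ && _); rewrite -subr_gt0.
- rewrite (_ : _ - _ = rho * sin (alpha - theta)); last by rewrite sinB; ring.
  exact: (pmulr_rgt0 _ (@hex_radius_gt0 R)).
- rewrite (_ : _ - _ = rho * sin (alpha + theta)); last by rewrite sinD; ring.
  exact: (pmulr_rgt0 _ (@hex_radius_gt0 R)).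
Qed.

(** With [bessel], darkness means that [d - eps * z.2] is less than [rho] in
    absolute value. As [eps <= 1], this gives [z.2 > 2 - rho = rho * (sqrt 3 -
    1)], and [cos_34] applies. *)
Lemma dark_pos d u (eps : R) z : 2 <= d -> bessel (0, eps) u -> 0 <= eps ->
  dot2 z z = 4 / 3 -> gap d (0, eps) u z < 0 -> rho * cos (3 / 4) < z.2.
Proof.
move=> d2 B eps0 nz g.
have r0 := @hex_radius_gt0 R; have r2 := @hex_radius_sq R.
have c34 := @cos_34 R.
have := B z; rewrite nz -r2.
have := B (0, 1).
move: g; rewrite /gap; move: (dot2 u z) => b.
rewrite /dot2 /= !(mul0r, mulr0, add0r, mulr1) => g eps1 h.
have eps1' : eps <= 1 by have := sqr_ge0 (u.2); nra.
have rs : rho * Num.sqrt 3 = 2.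
  by rewrite /hex_radius divfK// gt_eqF// sqrtr_gt0.
(* [g] and [h] together say [(d - eps * z.2) ^+ 2 < rho ^+ 2]. *)
have : d - eps * z.2 < rho.
  rewrite ltNge; apply/negP => k.
  by have : rho ^+ 2 <= (d - eps * z.2) ^+ 2; nra.
move=> k.
have ca : 2 - rho < eps * z.2 by lra.
have r1 : rho < 2 by nra.
have ct : 0 < z.2.
  rewrite ltNge; apply/negP => kk; have : eps * z.2 <= 0 by rewrite mulr_ge0_le0.
  by lra.
have h1 : eps * z.2 <= z.2 by rewrite ger_pMl.
apply: (@le_lt_trans _ _ (rho * (Num.sqrt 3 - 1))); first by rewrite ler_pM2l.
by rewrite mulrBr rs mulr1; lra.
Qed.

Lemma cos34_gt0 : 0 < cos (3 / 4) :> R.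
Proof. by have [pl pu] := andP (@pi_bounds R); rewrite cos_gt0_pihalf//; lra. Qed.

Lemma abs_lt_34 theta : - pi <= theta <= pi -> cos (3 / 4) < cos theta ->
  - (3 / 4) < theta < 3 / 4.
Proof.
have [pl pu] := andP (@pi_bounds R).
move=> tp c; rewrite -ltr_norml ltNge; apply/negP => h.
have tn : `|theta| <= pi by rewrite ler_norml; lra.
move: c; rewrite -(cos_norm theta).
move: h; rewrite le_eqVlt => /predU1P[<-|h]; first by rewrite ltxx.
have : cos `|theta| < cos (3 / 4).
  by rewrite ltr_cos// in_itv/= ?tn ?normr_ge0//; lra.
by move=> h1 h2; have := lt_trans h1 h2; rewrite ltxx.
Qed.

(** By the addition formulas, the coefficients of the point at angle [theta]
    with respect to the other two are [sin B / sin (A + B)] and [sin A / sin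
    (A + B)]. This makes [arc_convex] a statement about angles. *)
Lemma circ_convex d e u (A B theta : R) : 2 <= d -> bessel e u ->
  0 < A -> 0 < B -> A + B <= 3 / 2 ->
  gap d e u (circ (theta - A)) <= 0 -> gap d e u (circ (theta + B)) <= 0 ->
  gap d e u (circ (theta - A)) + gap d e u (circ (theta + B)) < 0 ->
  gap d e u (circ theta) < 0.
Proof.
move=> d2 Bs A0 B0 AB.
have [pl pu] := andP (@pi_bounds R).
have sAB : 0 < sin (A + B) by rewrite sin_gt0_pihalf//; lra.
have sA : 0 < sin A by rewrite sin_gt0_pihalf//; lra.
have sB : 0 < sin B by rewrite sin_gt0_pihalf//; lra.
have sA' : sin A < sin (A + B) by rewrite ltr_sin ?in_itv/=; lra.
have sB' : sin B < sin (A + B) by rewrite ltr_sin ?in_itv/=; lra.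
have E : circ theta = (sin B / sin (A + B)) *: circ (theta - A) +
  (sin A / sin (A + B)) *: circ (theta + B).
  transitivity (sin B / sin (A + B) * (circ (theta - A)).1 + sin A / sin (A + B) *
    (circ (theta + B)).1,
    sin B / sin (A + B) * (circ (theta - A)).2 + sin A / sin (A + B) *
      (circ (theta + B)).2); last by [].
  have n0 : sin A * cos B + cos A * sin B != 0 by rewrite -sinD gt_eqF.
  by rewrite /circ /= !sinD !cosD !sinN !cosN; congr pair; field.
move=> g1 g2 g12; rewrite E; apply: arc_convex => //.
- by rewrite divr_gt0.
- by rewrite divr_gt0.
- by rewrite -mulrDl ler_pdivrMr//; lra.
- exact: dot2_circ.
- exact: dot2_circ.
- by rewrite -E dot2_circ.
Qed.

Lemma continuous_gap_circ d e u : continuous (fun theta => gap d e u (circ theta)).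
Proof.
have [df D] : exists df : R -> R, forall x : R, is_derive x 1 (fun theta =>
  gap d e u (circ theta)) (df x).
  eexists => x; rewrite /gap /dot2 /circ /=; repeat derive_step.
exact: derivable_continuous D.
Qed.

(** The angles 3 / 4 and - 3 / 4 are not dark, so the gap has a zero on each
    side of the angle of [w]. By [circ_convex] the angles between these zeros
    are dark, and a dark angle beyond one of them would make the zero itself
    dark. *)
Lemma dark_arc_axis d u (eps : R) w : 2 <= d -> bessel (0, eps) u -> 0 <= eps ->
  dot2 w w = 4 / 3 -> gap d (0, eps) u w < 0 ->
  exists theta0 alpha, [/\ 0 < alpha,
    - (3 / 4) <= theta0 - alpha /\ theta0 + alpha <= 3 / 4,
    gap d (0, eps) u (circ (theta0 + alpha)) = 0,
    gap d (0, eps) u (circ (theta0 - alpha)) = 0 &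
    forall theta, - (pi / 2) <= theta <= pi / 2 ->
      (gap d (0, eps) u (circ theta) < 0) = (theta0 - alpha < theta < theta0 + alpha)].
Proof.
move=> d2 B eps0 nw gw.
have [pl pu] := andP (@pi_bounds R).
set h := fun theta => gap d (0, eps) u (circ theta).
have r0 := @hex_radius_gt0 R.
have hc : continuous h := @continuous_gap_circ d (0, eps) u.
have dark_cos theta : h theta < 0 -> cos (3 / 4) < cos theta.
  move=> ht; have := dark_pos d2 B eps0 (dot2_circ theta) ht.
  by rewrite /= ltr_pM2l.
have dark_itv theta : - (pi / 2) <= theta <= pi / 2 -> h theta < 0 ->
  - (3 / 4) < theta < 3 / 4.
  by move=> tp /dark_cos; apply: abs_lt_34; lra.
have w2 : 0 < w.2.
  by apply: lt_trans (dark_pos d2 B eps0 nw gw); rewrite mulr_gt0// cos34_gt0.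
have [t tp wE] := circ_param nw w2.
have ht : h t < 0 by rewrite /h -wE.
have /andP[t1 t2] : - (3 / 4) < t < 3 / 4 by apply: dark_itv => //; lra.
have h34 : 0 <= h (3 / 4) by rewrite leNgt; apply/negP => /dark_cos; rewrite ltxx.
have h34' : 0 <= h (- (3 / 4)).
  by rewrite leNgt; apply/negP => /dark_cos; rewrite cosN ltxx.
have [b] := @IVT R h t (3 / 4) 0 (ltW t2) (continuous_subspaceT hc)
   ltac:(by rewrite ge_min le_max (ltW ht) h34 orbT).
rewrite in_itv/= => /andP[tb b34] hb.
have [a] := @IVT R h (- (3 / 4)) t 0 (ltW t1) (continuous_subspaceT hc)
   ltac:(by rewrite ge_min le_max (ltW ht) h34' orbT).
rewrite in_itv/= => /andP[a34 at_] ha.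
have {}tb : t < b by rewrite lt_neqAle tb andbT; apply/eqP => E; move: ht;
  rewrite E hb ltxx.
have {}at_ : a < t by rewrite lt_neqAle at_ andbT; apply/eqP => E; move: ht;
  rewrite -E ha ltxx.
exists ((a + b) / 2), ((b - a) / 2).
have Eb : (a + b) / 2 + (b - a) / 2 = b by lra.
have Ea : (a + b) / 2 - (b - a) / 2 = a by lra.
rewrite Eb Ea; split => //; first lra.
have addN (x y : R) : x < 0 -> y < 0 -> x + y < 0.
  by move=> x0 y0; rewrite -[0]addr0 ltrD.
have conv (x y z : R) : - (3 / 4) <= x -> x < y -> y < z -> z <= 3 / 4 -> h x <= 0 ->
  h z <= 0 -> h x + h z < 0 -> h y < 0.
  move=> x1 xy yz z1; rewrite /h.
  have Ex : x = y - (y - x) by rewrite subKr.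
  have Ez : z = y + (z - y) by rewrite addrC subrK.
  rewrite {1}Ex {1}Ez {2}Ex {2}Ez; apply: circ_convex => //; rewrite ?subr_gt0//.
  by rewrite addrC subrKA; lra.
move=> theta tp'; rewrite -/(h theta); apply/idP/idP.
- move=> hth; have /andP[q1 q2] := dark_itv _ tp' hth.
  apply/andP; split; rewrite ltNge; apply/negP => k.
  + have ne : theta != a by apply/eqP => E; move: hth; rewrite E ha ltxx.
    have ta : theta < a by rewrite lt_neqAle ne.
    have : h a < 0.
      by apply: (conv theta a t (ltW q1) ta at_ (ltW t2) (ltW hth) (ltW ht));
        exact: addN.
    by rewrite ha ltxx.
  + have ne : b != theta by apply/eqP => E; move: hth; rewrite -E hb ltxx.
    have bt : b < theta by rewrite lt_neqAle ne.
    have : h b < 0.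
      by apply: (conv t b theta (ltW t1) tb bt (ltW q2) (ltW ht) (ltW hth));
        exact: addN.
    by rewrite hb ltxx.
- move=> /andP[k1 k2]; have [tt|tt|->//] := ltgtP theta t.
  + apply: (conv a theta t a34 k1 tt (ltW t2) _ (ltW ht)); first by rewrite ha.
    by rewrite ha add0r.
  + apply: (conv t theta b (ltW t1) tt k2 b34 (ltW ht)); first by rewrite hb.
    by rewrite hb addr0.
Qed.

End shadows.

(** * The lit fraction of a shadow *)

Section shadow_area.
Context (R : realType).
Implicit Types (d alpha theta c s : R) (e u z w : R * R).
Local Notation rho := (hex_radius R).

(** A positive multiple of the gap at the point where the ray through [z]
    meets the circle of radius [rho] ([ray_gapE]), written without division. *)
Definition ray_gap d e u z : R :=
  d ^+ 2 * dot2 z z - 2 * d * rho * Num.sqrt (dot2 z z) * dot2 e z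
  - rho ^+ 2 * dot2 u z ^+ 2.

(** The sector over the dark arc of a line. *)
Definition shadow d e u : set (mR R * mR R) :=
  [set z | (dot2 z z < 4 / 3) && (ray_gap d e u z < 0)].

Lemma measurable_sqrt disp (T : measurableType disp) (f : T -> R) :
  measurable_fun setT f -> measurable_fun setT (fun x => Num.sqrt (f x)).
Proof.
move=> mf; apply: (@measurableT_comp _ _ _ _ _ _ (@Num.sqrt R)) => //.
by apply: continuous_measurable_fun; exact: sqrt_continuous.
Qed.

Lemma measurable_ray_gap d e u : measurable_fun [set: mR R * mR R] (ray_gap d e u).
Proof.
have m1 : measurable_fun [set: mR R * mR R] (fun z => Num.sqrt (dot2 z z)).
  by apply: measurable_sqrt; exact: measurable_dot2.
have m2 := @measurable_dot2 R.
have m3 (v : R * R) : measurable_fun [set: mR R * mR R] (fun z => dot2 v z).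
  by rewrite /dot2; solve_measurable.
have m4 := m3 e; have m5 := m3 u.
by rewrite /ray_gap; solve_measurable.
Qed.

Lemma measurable_shadow d e u : measurable (shadow d e u).
Proof.
apply: measurable_andb; apply: measurable_lt_set.
- exact: measurable_dot2.
- exact: measurable_cst.
- exact: measurable_ray_gap.
- exact: measurable_cst.
Qed.

Lemma dot2Zl z (l : R) : dot2 (l *: z) (l *: z) = l ^+ 2 * dot2 z z.
Proof. by rewrite /dot2 /= /GRing.scale /=; ring. Qed.

Lemma dot2Zr w z (l : R) : dot2 w (l *: z) = l * dot2 w z.
Proof. by rewrite /dot2 /= /GRing.scale /=; ring. Qed.

Lemma ray_gapE d e u z : 0 < dot2 z z -> exists2 l, 0 < l &
  dot2 (l *: z) (l *: z) = 4 / 3 /\ ray_gap d e u z * l ^+ 2 = rho ^+ 2 * gap d e u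
    (l *: z).
Proof.
move=> n0; have q0 : 0 < Num.sqrt (dot2 z z) by rewrite sqrtr_gt0.
have q2 := sqr_sqrtr (ltW n0).
have r0 := @hex_radius_gt0 R.
exists (rho / Num.sqrt (dot2 z z)); first by rewrite divr_gt0.
rewrite dot2Zl expr_div_n q2 /gap !dot2Zr divfK ?gt_eqF//; split;
  first exact: hex_radius_sq.
rewrite /ray_gap -{1 3}q2.
move: (Num.sqrt _) q0 => q q0; move: (rho) r0 => r r0; field.
by rewrite gt_eqF.
Qed.

Lemma dot2_eq0 z : ~~ (0 < dot2 z z) -> z = (0, 0).
Proof.
rewrite -leNgt; case: z => x y; rewrite /dot2 /= -!expr2 => h.
have := sqr_ge0 x; have := sqr_ge0 y => h1 h2.
by congr pair; apply/eqP; rewrite -sqrf_eq0; apply/eqP; lra.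
Qed.

Lemma ray_gap0 d e u : ray_gap d e u (0, 0) = 0.
Proof. by rewrite /ray_gap /dot2 /=; ring. Qed.

Lemma ray_gap_lt d e u z : ray_gap d e u z < 0 -> exists2 l, 0 < l &
  dot2 (l *: z) (l *: z) = 4 / 3 /\ gap d e u (l *: z) < 0.
Proof.
move=> h; have [n0|/dot2_eq0 z0] := boolP (0 < dot2 z z); last first.
  by move: h; rewrite z0 ray_gap0 ltxx.
have [l l0 [h1 h2]] := ray_gapE d e u n0; exists l => //; split => //.
have r2 : 0 < rho ^+ 2 by rewrite exprn_gt0// hex_radius_gt0.
by rewrite -(pmulr_rlt0 _ r2) -h2 pmulr_llt0// exprn_gt0.
Qed.

(** Concavity on the radius through [z], from the centre to a point of the
    circle that is not dark. *)
Lemma gap_out d e u z : 0 < d -> dot2 z z < 4 / 3 -> 0 <= ray_gap d e u z ->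
  0 < gap d e u z.
Proof.
move=> d0 nz h; have [n0|/dot2_eq0 z0] := boolP (0 < dot2 z z); last first.
  by rewrite z0 /gap /dot2 /= !mulr0 addr0 expr0n/= mulr0 !subr0 exprn_gt0.
have [l l0 [h1 h2]] := ray_gapE d e u n0.
have r2 : 0 < rho ^+ 2 by rewrite exprn_gt0// hex_radius_gt0.
have g0 : 0 <= gap d e u (l *: z).
  by rewrite -(pmulr_rge0 _ r2) -h2 mulr_ge0// ltW// exprn_gt0.
have l1 : 1 < l.
  rewrite ltNge; apply/negP => k; move: h1; rewrite dot2Zl => h1.
  have l2 : l ^+ 2 <= 1 by rewrite exprn_ile1// ltW.
  have : l ^+ 2 * dot2 z z <= dot2 z z by rewrite ger_pMl.
  by rewrite h1; lra.
have l1' : l^-1 < 1 by rewrite invf_lt1.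
have li0 : 0 < l^-1 by rewrite invr_gt0.
have := gap_scale (ltW li0) (ltW l1') g0.
rewrite scalerA mulVf ?gt_eqF// scale1r; apply: lt_le_trans.
by rewrite mulr_gt0 ?subr_gt0// exprn_gt0.
Qed.

Lemma rot2_dot c s z w : c ^+ 2 + s ^+ 2 = 1 ->
  dot2 (rot2 c s z) (rot2 c s w) = dot2 z w.
Proof.
move=> cs; rewrite /dot2 /rot2 /=.
by transitivity ((c ^+ 2 + s ^+ 2) * (z.1 * w.1 + z.2 * w.2)); [ring|rewrite cs mul1r].
Qed.

Lemma rot2_adj c s z w : dot2 z (rot2 c s w) = dot2 (rot2 c (- s) z) w.
Proof. by rewrite /dot2 /rot2 /=; ring. Qed.

Lemma rot2K c s z : c ^+ 2 + s ^+ 2 = 1 -> rot2 c (- s) (rot2 c s z) = z.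
Proof.
move=> cs; case: z => x y; rewrite /rot2 /=.
transitivity ((c ^+ 2 + s ^+ 2) * x, (c ^+ 2 + s ^+ 2) * y); first by congr pair; ring.
by rewrite cs !mul1r.
Qed.

Lemma rot2_gap d e u c s z : gap d e u (rot2 c s z) = gap d (rot2 c (- s) e)
  (rot2 c (- s) u) z.
Proof. by rewrite /gap !rot2_adj. Qed.

Lemma rot2_bessel e u c s : c ^+ 2 + s ^+ 2 = 1 -> bessel e u ->
  bessel (rot2 c (- s) e) (rot2 c (- s) u).
Proof. by move=> cs B z; rewrite -!rot2_adj -(rot2_dot z z cs); exact: B. Qed.

(** The quotient of [sqrt 12] and the area [4 / 3 * pi] of the disk of radius
    [rho]. *)
Definition kappa : R := 3 * Num.sqrt 3 / (2 * pi).

Definition sector_bound d e u :=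
  (kappa%:E * area (shadow d e u) <=
   area (shadow d e u `&` [set z | (0 < gap d e u z)%R]))%E.

Lemma measurable_lit d e u : measurable [set z : mR R * mR R | 0 < gap d e u z].
Proof. by apply: measurable_lt_set; [exact: measurable_cst|exact: measurable_gap]. Qed.

Lemma sector_bound_rot d e u c s : c ^+ 2 + s ^+ 2 = 1 ->
  sector_bound d (rot2 c (- s) e) (rot2 c (- s) u) -> sector_bound d e u.
Proof.
move=> cs; rewrite /sector_bound; have [_ P] := preserves_rot2 cs.
have -> : area (shadow d (rot2 c (- s) e) (rot2 c (- s) u)) = area (shadow d e u).
  rewrite -(P _ (measurable_shadow d e u)); congr (area _).
  by apply/seteqP; split => z; rewrite /shadow /preimage /= /ray_gap !rot2_dot//
    !rot2_adj.
move=> /le_trans; apply; rewrite -[leRHS]P; last first.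
  by apply: measurableI; [exact: measurable_shadow|exact: measurable_lit].
rewrite le_eqVlt; apply/orP; left; apply/eqP; congr (area _).
apply/seteqP; split => z; rewrite /shadow /preimage /= /ray_gap !rot2_dot// !rot2_adj
  rot2_gap//.
Qed.

Lemma coneZ alpha z (l : R) : 0 < l -> cone alpha (l *: z) = cone alpha z.
Proof.
move=> l0; rewrite -[l *: z]/(l * z.1, l * z.2) /cone /=.
by rewrite -!mulrA !(ltr_pM2l l0) -mulrN -mulrA !(ltr_pM2l l0).
Qed.

Lemma sector_bound_sym d e u alpha : 2 <= d -> bessel e u -> 0 < alpha ->
  alpha <= 3 / 4 ->
  gap d e u (circ alpha) = 0 -> gap d e u (circ (- alpha)) = 0 ->
  (forall z, dot2 z z = 4 / 3 -> (gap d e u z < 0) = cone alpha z) ->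
  sector_bound d e u.
Proof.
move=> d2 B a0 a34 gp gq dark.
have [pl pu] := andP (@pi_bounds R).
have p0 := @pi_gt0 R.
have a2 : alpha < pi / 2 by lra.
have [c0 s0 _ _] := acute_trig a0 a2.
have r0 := @hex_radius_gt0 R.
have SE : shadow d e u = [set z | cone alpha z /\ z.1 ^+ 2 + z.2 ^+ 2 < rho ^+ 2].
  apply/seteqP; split => z; rewrite /shadow /= hex_radius_sq /dot2 -!expr2 -/(dot2 z z).
    move=> /andP[nz /ray_gap_lt[l l0 [h1 h2]]]; split => //.
    by rewrite -(coneZ _ _ l0) -dark.
  move=> [cz nz]; rewrite nz/=.
  have n0 : 0 < dot2 z z.
    apply/negPn/negP => /dot2_eq0 z0; move: cz; rewrite z0 /cone /=.
    by rewrite !mul0r ltxx.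
  have [l l0 [h1 h2]] := ray_gapE d e u n0.
  have : gap d e u (l *: z) < 0 by rewrite dark// coneZ.
  have r2 : 0 < rho ^+ 2 by rewrite exprn_gt0// hex_radius_gt0.
  by rewrite -(pmulr_rlt0 _ r2) -h2 pmulr_llt0// exprn_gt0.
have neg (x : R) : x ^+ 2 = (rho * sin alpha) ^+ 2 ->
  0 <= gap d e u (x, - (rho * cos alpha)).
  move=> x2; rewrite leNgt dark.
    apply/negP => /andP[/= h1 h2].
    have : 0 < rho * cos alpha * sin alpha by rewrite !mulr_gt0.
    by lra.
  rewrite /dot2 /= mulrNN -!expr2 x2.
  by transitivity (dot2 (circ alpha) (circ alpha));
    [rewrite /dot2 /=; ring|exact: dot2_circ].
have L : shadow d e u `&` [set z | 0 < gap d e u z] = lit_sector d e u alpha.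
  rewrite SE; apply/seteqP; split => z;
    rewrite /lit_sector /= hex_radius_sq /dot2 -!expr2.
    by move=> [[-> ->] ->].
  by move=> [-> /andP[-> ->]].
have lb : ((2 * Num.sqrt 3 / pi * alpha)%:E <= area (lit_sector d e u alpha))%E.
  apply: sector_gap_sym => //.
  - by move: gq; rewrite /circ sinN cosN mulrN.
  - exact: neg.
  - by apply: neg; rewrite sqrrN.
  - by move=> z nz cz; rewrite dark.
rewrite /sector_bound L; apply: le_trans lb.
have ub := sector_area_le r0 a0 a2.
rewrite SE; apply: (le_trans (lee_wpmul2l _ ub)).
  by rewrite lee_fin /kappa divr_ge0 ?mulr_ge0 ?sqrtr_ge0// ltW.
rewrite -EFinM lee_fin hex_radius_sq /kappa le_eqVlt; apply/orP; left; apply/eqP.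
by move: (pi : R) (Num.sqrt 3) p0 => p q p0; field; rewrite gt_eqF.
Qed.

(** Without a dark point the shadow is empty. Otherwise a rotation makes the
    arc given by [dark_arc_axis] symmetric. *)
Lemma sector_bound_axis d u (eps : R) : 2 <= d -> bessel (0, eps) u -> 0 <= eps ->
  sector_bound d (0, eps) u.
Proof.
move=> d2 B eps0.
have [[w [nw gw]]|nodark] := pselect (exists w, dot2 w w = 4 / 3 /\
  gap d (0, eps) u w < 0); last first.
  have -> : sector_bound d (0, eps) u = (kappa%:E * area (set0 : set (mR R * mR R)) <=
    area (set0 : set (mR R * mR R)))%E.
    rewrite /sector_bound (_ : shadow d (0, eps) u = set0) ?set0I//.
    apply/seteqP; split => z //; rewrite /shadow /= =>
      /andP[_ /ray_gap_lt[l _ [h1 h2]]].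
    by apply: nodark; exists (l *: z).
  by rewrite measure0 mule0.
(* The rotation by [th], the middle of the arc, makes the arc symmetric. *)
have [th [al [a0 [b1 b2] gb ga darkE]]] := dark_arc_axis d2 B eps0 nw gw.
have [pl pu] := andP (@pi_bounds R).
have p0 := @pi_gt0 R.
have cs : cos th ^+ 2 + (- sin th) ^+ 2 = 1 by rewrite sqrrN cos2Dsin2.
have c34 := @cos34_gt0 R.
have r0 := @hex_radius_gt0 R.
apply: (sector_bound_rot cs).
apply: (@sector_bound_sym _ _ _ al) => //.
- exact: rot2_bessel.
- lra.
- by rewrite -rot2_gap rot2_circ addrC.
- by rewrite -rot2_gap rot2_circ addrC.
move=> z nz; rewrite -rot2_gap; apply/idP/idP.
- move=> gz; have nz' : dot2 (rot2 (cos th) (- sin th) z) (rot2 (cos th) (- sin th) z)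
    = 4 / 3.
    by rewrite rot2_dot.
  have z2 : 0 < (rot2 (cos th) (- sin th) z).2.
    by apply: lt_trans (dark_pos d2 B eps0 nz' gz); rewrite mulr_gt0.
  have [phi pp E] := circ_param nz' z2.
  have -> : z = circ (phi - th).
    by rewrite -(rot2K z cs) E -[X in rot2 X]cosN -(sinN th) rot2_circ.
  move: gz; rewrite E darkE; last by lra.
  move=> /andP[k1 k2]; rewrite cone_circ; apply/andP; split; apply: sin_gt0_pi; lra.
- move=> cz.
  have z2 : 0 < z.2.
    have sa : 0 < sin al by apply: sin_gt0_pihalf; lra.
    by move: cz => /andP[h1 h2]; rewrite -(pmulr_lgt0 _ sa); lra.
  have [psi pp E] := circ_param nz z2.
  move: cz; rewrite E cone_circ => /andP[h1 h2].
  have sneg (x : R) : - pi <= x -> 0 < sin x -> 0 < x.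
    move=> xp sx; rewrite ltNge; apply/negP => x0.
    have : 0 <= sin (- x) by apply: sin_ge0_pi; lra.
    by rewrite sinN; lra.
  have {}h1 : 0 < al - psi by apply: sneg h1; lra.
  have {}h2 : 0 < al + psi by apply: sneg h2; lra.
  by rewrite rot2_circ darkE; lra.
Qed.

(** A rotation puts the foot of the line on the second coordinate axis, the
    case of [sector_bound_axis]. *)
Lemma sector_gap d e u : 2 <= d -> bessel e u -> sector_bound d e u.
Proof.
move=> d2 B; pose n := Num.sqrt (dot2 e e).
have n0 : 0 <= n by exact: sqrtr_ge0.
have n2 : n ^+ 2 = dot2 e e by rewrite sqr_sqrtr// dot2_ge0.
have [c [s [cs E]]] : exists c s, c ^+ 2 + s ^+ 2 = 1 /\ rot2 c (- s) e = (0, n).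
  have [/dot2_eq0 e0|ne] := boolP (~~ (0 < dot2 e e)).
    exists 1, 0; split; first by ring.
    have -> : n = 0 by rewrite /n e0 /dot2 /= !mul0r addr0 sqrtr0.
    by rewrite e0 /rot2 /=; congr pair; ring.
  have np : 0 < n by rewrite sqrtr_gt0; move/negPn: ne.
  have nn := lt0r_neq0 np.
  exists (e.2 / n), (- (e.1 / n)); split.
    transitivity (dot2 e e / n ^+ 2); last by rewrite -n2 divff// sqrf_eq0.
    by rewrite /dot2 sqrrN !expr_div_n -mulrDl addrC !expr2.
  rewrite /rot2 /=; congr pair; first by ring.
  transitivity (dot2 e e / n); first by rewrite /dot2; ring.
  by rewrite -n2 expr2 mulfK.
apply: (sector_bound_rot cs); rewrite E; apply: sector_bound_axis => //.
by rewrite -E; exact: rot2_bessel.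
Qed.

End shadow_area.

(** * Area of a lit slice *)

(** The part of [D] outside all [S i] lies in [L] entirely, which is a share
    of at least [c] because [c <= 1]. *)
Lemma cover_ratio disp (T : measurableType disp) (R : realType)
    (mu : {measure set T -> \bar R}) (c : R) (I : eqType) (s : seq I)
    (S : I -> set T) (L D : set T) :
  0 <= c -> c <= 1 -> uniq s -> measurable L -> measurable D ->
  (forall i, i \in s -> measurable (S i)) ->
  (forall i, i \in s -> S i `<=` D) ->
  (forall i j, i \in s -> j \in s -> i != j -> S i `&` S j = set0) ->
  (forall i, i \in s -> c%:E * mu (S i) <= mu (S i `&` L))%E ->
  (forall x, D x -> (forall i, i \in s -> ~ S i x) -> L x) ->
  (c%:E * mu D <= mu (D `&` L))%E.
Proof.
move=> c0 c1; elim: s D => [|i s IH] D us mL mD mS SD dis ratio out.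
  rewrite (_ : D `&` L = D); last first.
    by apply/seteqP; split => x; [case|move=> Dx; split => //; exact: out].
  by rewrite -[leRHS]mul1e; apply: lee_wpmul2r.
have is_ : i \in i :: s by rewrite mem_head.
have sub k : k \in s -> k \in i :: s by rewrite inE => ->; rewrite orbT.
have /andP[nis us'] : (i \notin s) && uniq s by [].
have mi := mS i is_.
have ne k : k \in s -> k != i by move=> ks; apply: contraNneq nis => <-.
have DE : D = S i `|` (D `\` S i) by rewrite setDUK//; exact: SD.
have -> : (mu D = mu (S i) + mu (D `\` S i))%E.
  rewrite {1}DE measureU//; first exact: measurableD.
  by rewrite setDE setICA setICr setI0.
have -> : (mu (D `&` L) = mu (S i `&` L) + mu ((D `\` S i) `&` L))%E.
  rewrite {1}DE setIUl measureU//.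
  - exact: measurableI.
  - by apply: measurableI => //; exact: measurableD.
  - by apply/seteqP; split => x //= -[[h _] [[_ nh] _]].
rewrite ge0_muleDr//; apply: leeD; first exact: ratio.
apply: IH => //.
- exact: measurableD.
- by move=> k ks; exact/mS/sub.
- move=> k ks x Skx; split; first exact: (SD k (sub k ks)).
  move=> Six; have : (S k `&` S i) x by [].
  by rewrite (dis k i (sub k ks) is_ (ne k ks)).
- by move=> k l ks ls; apply: dis; exact: sub.
- by move=> k ks; exact/ratio/sub.
- move=> x [Dx nSi] H; apply: out => // k; rewrite inE => /predU1P[->//|]; exact: H.
Qed.

Section slice.
Context (R : realType).

Lemma kappa_bounds : 0 <= kappa R <= 1.
Proof.
have [pl pu] := andP (@pi_bounds R); have [ql qu] := andP (@sqrt3_bounds R).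
have p0 := @pi_gt0 R.
rewrite /kappa divr_ge0 ?mulr_ge0 ?sqrtr_ge0 ?(ltW p0)//= ler_pdivrMr ?mulr_gt0//.
by rewrite mul1r; lra.
Qed.

Lemma sqrt12E : Num.sqrt 12 = 2 * Num.sqrt 3 :> R.
Proof.
have -> : 12 = 2 ^+ 2 * 3 :> R by ring.
by rewrite sqrtrM ?sqr_ge0// sqrtr_sqr ger0_norm.
Qed.

Definition lit_slice (I : eqType) (s : seq I) (d : I -> R) (e u : I -> R * R) :
    set (mR R * mR R) :=
  [set z | (dot2 z z < 4 / 3) && all (fun i => 0 < gap (d i) (e i) (u i) z) s].

Lemma measurable_all disp (T : measurableType disp) (I : eqType) (s : seq I)
    (P : I -> T -> bool) :
  (forall i, i \in s -> measurable [set x | P i x]) ->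
  measurable [set x | all (P^~ x) s].
Proof.
elim: s => [|i s IH] H /=.
  by rewrite (_ : [set _ | _] = setT)//; apply/seteqP; split.
apply: measurable_andb; first by apply: H; rewrite mem_head.
by apply: IH => k ks; apply: H; rewrite inE ks orbT.
Qed.

(** Shadows are disjoint because dark arcs are. So in a shadow the only line
    to be considered is its own, with a lit fraction of at least [kappa], and
    outside the shadows all points are lit; the fraction [kappa] of the whole
    disk is [sqrt 12]. *)
Lemma slice_area (I : eqType) (s : seq I) (d : I -> R) (e u : I -> R * R) :
  uniq s -> (forall i, i \in s -> 2 <= d i) ->
  (forall i, i \in s -> bessel (e i) (u i)) ->
  (forall i j z, i \in s -> j \in s -> i != j -> dot2 z z = 4 / 3 ->
    gap (d i) (e i) (u i) z < 0 -> gap (d j) (e j) (u j) z < 0 -> False) ->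
  ((Num.sqrt 12)%:E <= area (lit_slice s d e u))%E.
Proof.
move=> us d2 B dis.
pose L : set (mR R * mR R) := [set z | all (fun i => 0 < gap (d i) (e i) (u i) z) s].
pose D : set (mR R * mR R) := [set z | dot2 z z < 4 / 3].
have mL : measurable L by apply: measurable_all => i _; exact: measurable_lit.
have mD : measurable D by apply: measurable_lt_set;
  [exact: measurable_dot2|exact: measurable_cst].
have dpos i : i \in s -> 0 < d i by move=> /d2; lra.
(* A common point of two shadows gives a common point of the dark arcs. *)
have disS i j z : i \in s -> j \in s -> i != j ->
    shadow (d i) (e i) (u i) z -> shadow (d j) (e j) (u j) z -> False.
  move=> si sj ij /andP[_ h1] /andP[_ h2].
  have [n0|/dot2_eq0 z0] := boolP (0 < dot2 z z); last first.
    by move: h1; rewrite z0 ray_gap0 ltxx.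
  have r2 : 0 < (hex_radius R) ^+ 2 by rewrite exprn_gt0// hex_radius_gt0.
  have [l l0 [k1 k2]] := ray_gapE (d i) (e i) (u i) n0.
  have [l' l0' [k1' k2']] := ray_gapE (d j) (e j) (u j) n0.
  have ll : l = l'.
    move: k1 k1'; rewrite !dot2Zl => <- /(mulIf (lt0r_neq0 n0)) /eqP.
    by rewrite eqrXn2// ?ltW// => /eqP.
  apply: (dis i j (l *: z)) => //.
    by rewrite -(pmulr_rlt0 _ r2) -k2 pmulr_llt0// exprn_gt0.
  by rewrite ll -(pmulr_rlt0 _ r2) -k2' pmulr_llt0// exprn_gt0.
have -> : lit_slice s d e u = D `&` L.
  by apply/seteqP; split => z; rewrite /lit_slice /=;
    [move=> /andP|move=> [h1 h2]; apply/andP].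
have [k0 k1] := andP kappa_bounds.
have := @cover_ratio _ _ R (@area R) (kappa R) I s (fun i => shadow (d i) (e i) (u i))
  L D
  k0 k1 us mL mD.
move=> H; apply: le_trans (H _ _ _ _ _).
- have := @disk_area_ge R (4 / 3) ltac:(lra).
  rewrite (_ : [set z | _] = D); last first.
    by apply/seteqP; split => z; rewrite /D /dot2 /= !expr2.
  move=> h; apply: le_trans (lee_wpmul2l _ h); last by rewrite lee_fin.
  rewrite -EFinM lee_fin sqrt12E /kappa le_eqVlt; apply/orP; left; apply/eqP.
  have := lt0r_neq0 (@pi_gt0 R); move: (pi : R) (Num.sqrt 3) => p q p0.
  by field.
- by move=> i _; exact: measurable_shadow.
- by move=> i _ z /andP[].
- move=> i j si sj ij; apply/seteqP; split => z // [h1 h2].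
  exact: (disS i j z).
- move=> i si; have := sector_gap (d2 i si) (B i si); rewrite /sector_bound =>
    /le_trans; apply.
  apply: le_measure; rewrite ?inE.
  + by apply: measurableI; [exact: measurable_shadow|exact: measurable_lit].
  + by apply: measurableI; [exact: measurable_shadow|exact: mL].
  + move=> z [Sz gz]; split => //; apply/allP => k sk.
    have [->//|ki] := eqVneq k i.
    apply: gap_out; first exact: dpos.
      by case/andP: Sz.
    rewrite leNgt; apply/negP => rk; apply: (disS i k z) => //; first by rewrite eq_sym.
    by case/andP: Sz => nz _; apply/andP.
- move=> z Dz nS; apply/allP => k sk; apply: gap_out => //; first exact: dpos.
  rewrite leNgt; apply/negP => rk; apply: (nS k sk).
  by apply/andP.
Qed.

End slice.

(** * Distances to points and segments *)

Section vectors.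
Context (R : realType).
Implicit Types (x y z v w : R * R * R) (a b : R).

Lemma dotC x y : dot x y = dot y x.
Proof. by rewrite /dot; ring. Qed.
Lemma dotDl x y z : dot (x + y) z = dot x z + dot y z.
Proof. by rewrite /dot /=; ring. Qed.
Lemma dotNl x z : dot (- x) z = - dot x z.
Proof. by rewrite /dot /=; ring. Qed.
Lemma dotZl a x z : dot (a *: x) z = a * dot x z.
Proof. by rewrite /dot /= /GRing.scale /= /GRing.scale /=; ring. Qed.
Lemma dotDr x y z : dot z (x + y) = dot z x + dot z y.
Proof. by rewrite dotC dotDl !(dotC z). Qed.
Lemma dotNr x z : dot z (- x) = - dot z x.
Proof. by rewrite dotC dotNl (dotC z). Qed.
Lemma dotZr a x z : dot z (a *: x) = a * dot z x.
Proof. by rewrite dotC dotZl (dotC z). Qed.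

Definition dotE := (dotDl, dotDr, dotNl, dotNr, dotZl, dotZr).

Lemma dot_ge0 x : 0 <= dot x x.
Proof. by rewrite /dot -!expr2 !addr_ge0// sqr_ge0. Qed.

Lemma enorm_le x a : 0 <= a -> (enorm x <= a) = (dot x x <= a ^+ 2).
Proof.
move=> a0; rewrite /enorm -{1}(ger0_norm a0) -sqrtr_sqr ler_sqrt//.
exact: sqr_ge0.
Qed.

Lemma dot_parallelogram x y z :
  dot (x - z) (x - z) <= 2 * dot (y - x) (y - x) + 2 * dot (y - z) (y - z).
Proof.
rewrite -subr_ge0; have := dot_ge0 ((y - x) + (y - z)).
rewrite !dotE (dotC z x) (dotC z y) (dotC x y); lra.
Qed.

Lemma cauchy_schwarz x y : dot x y ^+ 2 <= dot x x * dot y y.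
Proof.
case: x y => [[x1 x2] x3] [[y1 y2] y3]; rewrite /dot /= -subr_ge0.
have -> : (x1 * x1 + x2 * x2 + x3 * x3) * (y1 * y1 + y2 * y2 + y3 * y3) -
  (x1 * y1 + x2 * y2 + x3 * y3) ^+ 2 =
  (x1 * y2 - x2 * y1) ^+ 2 + (x1 * y3 - x3 * y1) ^+ 2 + (x2 * y3 - x3 * y2) ^+ 2 by
    ring.
by rewrite !addr_ge0// sqr_ge0.
Qed.

Lemma ball_triangle x y a b : 0 <= a -> 0 <= b ->
  dot x x <= a ^+ 2 -> dot (y - x) (y - x) <= b ^+ 2 -> dot y y <= (a + b) ^+ 2.
Proof.
move=> a0 b0 hx hy; have cs := cauchy_schwarz x (y - x).
have -> : dot y y = dot x x + 2 * dot x (y - x) + dot (y - x) (y - x).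
  by rewrite !dotE (dotC y x); ring.
move: (dot x (y - x)) (dot x x) (dot (y - x) (y - x)) (dot_ge0 x) (dot_ge0 (y - x)) cs
  hx hy.
move=> m n k n0 k0 cs hx hy.
have h : m ^+ 2 <= (a * b) ^+ 2.
  by apply: (le_trans cs); rewrite exprMn; apply: ler_pM.
have m1 : m <= a * b.
  by rewrite leNgt; apply/negP => hm; have := mulr_ge0 a0 b0; nra.
by rewrite !expr2 in hx hy *; lra.
Qed.

Lemma bessel3 v w z : dot w w = 1 -> dot z z = 1 -> dot w z = 0 ->
  dot v w ^+ 2 + dot v z ^+ 2 <= dot v v.
Proof.
move=> w1 z1 wz; rewrite -subr_ge0.
have := dot_ge0 (v - dot v w *: w - dot v z *: z).
rewrite !dotE (dotC z w) (dotC w v) (dotC z v) w1 z1 wz.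
by rewrite !expr2; lra.
Qed.

(** The sum of the squared mutual distances of three points is at most three
    times the sum of their squared distances to [w]; here 12 would be less
    than 12. *)
Lemma three_points x y z w : dot (w - x) (w - x) <= 4 / 3 ->
  dot (w - y) (w - y) < 4 / 3 -> dot (w - z) (w - z) < 4 / 3 ->
  4 <= dot (x - y) (x - y) -> 4 <= dot (x - z) (x - z) ->
  4 <= dot (y - z) (y - z) -> False.
Proof.
have := dot_ge0 ((w - x) + (w - y) + (w - z)).
rewrite !dotE (dotC y x) (dotC z x) (dotC z y) (dotC x w) (dotC y w) (dotC z w).
lra.
Qed.

Lemma closer_than_far x y z : dot (y - x) (y - x) < 1 -> 4 <= dot (x - z) (x - z) ->
  dot (y - x) (y - x) < dot (y - z) (y - z).
Proof. by move=> h1 h2; have := dot_parallelogram x y z; lra. Qed.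

End vectors.

Section axis_distance.
Context (R : realType).
Implicit Types (p u x y : R * R * R) (t s tau : R).

Definition clamp t s : R := Num.max 0 (Num.min s t).

(** Squared distance from [y] to the segment from [p] to [p + t *: u], for a
    unit vector [u]: the nearest point has the clamped coordinate of the
    projection of [y]. *)
Definition axis_dist2 t p u y : R :=
  let v := y - p - clamp t (dot (y - p) u) *: u in dot v v.

Lemma clamp_itv t s : 0 <= t -> 0 <= clamp t s <= t.
Proof.
move=> t0; rewrite /clamp le_max lexx/= ge_max t0/=.
by rewrite ge_min lexx orbT.
Qed.

Lemma dist_line p u y tau : dot u u = 1 ->
  dot (y - (p + tau *: u)) (y - (p + tau *: u)) =
  dot (y - p) (y - p) - dot (y - p) u ^+ 2 + (tau - dot (y - p) u) ^+ 2.
Proof.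
move=> u1; rewrite !dotE (dotC u p) (dotC u y) (dotC p y) u1.
by ring.
Qed.

Lemma axis_dist2E t p u y : axis_dist2 t p u y =
  dot (y - (p + clamp t (dot (y - p) u) *: u)) (y - (p + clamp t (dot (y - p) u) *: u)).
Proof. by rewrite /axis_dist2 opprD addrA. Qed.

Lemma axis_dist2_le t p u y tau : dot u u = 1 -> 0 <= tau <= t ->
  axis_dist2 t p u y <= dot (y - (p + tau *: u)) (y - (p + tau *: u)).
Proof.
move=> u1 /andP[tau0 taut]; rewrite axis_dist2E !dist_line//.
rewrite lerD2l; move: (dot (y - p) u) => s; rewrite /clamp.
have sq a b : 0 <= (a - b) * (a + b) -> b ^+ 2 <= a ^+ 2 :> R.
  by rewrite -subr_ge0 -[in X in _ -> X]subr_ge0 subr_sqr subr0.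
case: (leP s t) => h; case: (leP 0 _) => h'; apply: sq.
- by rewrite subrr subr0 addr0 -expr2 sqr_ge0.
- by apply: mulr_ge0; lra.
- by apply: mulr_le0; lra.
- by have := lt_le_trans h' (le_trans tau0 taut); rewrite ltxx.
Qed.

Lemma line_dist2_le t p u y : dot u u = 1 ->
  dot (y - p) (y - p) - dot (y - p) u ^+ 2 <= axis_dist2 t p u y.
Proof. by move=> u1; rewrite axis_dist2E dist_line// lerDl sqr_ge0. Qed.

Lemma measurable_dot (f g : mR R * mR R * mR R -> mR R * mR R * mR R) :
  measurable_fun setT f -> measurable_fun setT g ->
  measurable_fun setT (fun z => dot (f z) (g z)).
Proof. by move=> mf mg; rewrite /dot; solve_measurable. Qed.

Lemma measurable_axis_dist2 t p u :
  measurable_fun [set: mR R * mR R * mR R] (axis_dist2 t p u).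
Proof.
have m : measurable_fun [set: mR R * mR R * mR R] (fun y => clamp t (dot (y - p) u)).
  by rewrite /clamp /dot /=; solve_measurable.
rewrite /axis_dist2 /dot /= /GRing.scale /= /GRing.scale /=.
by solve_measurable.
Qed.

End axis_distance.

(** * Slices of cells *)

Section qualified_slices.
Context (R : realType).
Implicit Types (p u x y c : R * R * R) (t tau sigma : R) (w : R * R).

Definition frame u (M : R * R * R -> R * R * R) :=
  [/\ preserves (@vol R) M,
      (forall (a : R) x y, M (x + a *: y) = M x + a *: M y),
      (forall x y, dot (M x) (M y) = dot x y) &
      M (0, 0, 1) = u].

Definition base1 : R * R * R := (1, 0, 0).
Definition base2 : R * R * R := (0, 1, 0).

Lemma frame_plane u M w : frame u M -> M (w, 0) = w.1 *: M base1 + w.2 *: M base2.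
Proof.
case: w => a b [_ lin _ _]; have M0 : M 0 = 0.
  have := lin 1 0 0; rewrite !scale1r addr0 => h.
  by apply: (@addrI _ (M 0)); rewrite addr0 -h.
have -> : (a, b, 0) = (0 + a *: base1) + b *: base2 :> R * R * R.
  transitivity (0 + a * 1 + b * 0, 0 + a * 0 + b * 1, 0 + a * 0 + b * 0); last by [].
  by congr (_, _, _); ring.
by rewrite !lin M0 add0r.
Qed.

Lemma frame_plane_dot u M w : frame u M -> dot (M (w, 0)) (M (w, 0)) = dot2 w w.
Proof. by move=> [_ _ iso _]; rewrite iso /dot /dot2 /=; ring. Qed.

Section line_params.
Variables (M : R * R * R -> R * R * R) (x p u : R * R * R).
(** Vector from [x] to the foot of the perpendicular on the line through [p]
    with direction [u]. *)
Definition foot := p + dot (x - p) u *: u - x.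
Definition line_dist : R := Num.sqrt (dot foot foot).
(** Coordinates, in the plane of the slice, of the unit vector towards the
    foot. *)
Definition foot_dir2 : R * R :=
  (dot (M base1) foot / line_dist, dot (M base2) foot / line_dist).
Definition line_dir2 : R * R := (dot (M base1) u, dot (M base2) u).
End line_params.

Lemma foot_orth x p u : dot u u = 1 -> dot (foot x p u) u = 0.
Proof. by move=> u1; rewrite /foot !dotE u1; ring. Qed.

Lemma dot_foot x p u : dot u u = 1 ->
  dot (foot x p u) (foot x p u) = dot (x - p) (x - p) - dot (x - p) u ^+ 2.
Proof.
move=> u1; rewrite /foot !dotE u1 (dotC u p) (dotC u x) (dotC p x); ring.
Qed.

(** The left-hand side is the squared distance from [y] to the line; it is
    expanded around the foot, which is orthogonal to the direction of the
    line. *)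
Lemma line_gap u0 M x p u w : frame u0 M -> dot u u = 1 -> 0 < line_dist x p u ->
  let y := x + M (w, 0) in
  dot (y - p) (y - p) - dot (y - p) u ^+ 2 =
  dot2 w w + gap (line_dist x p u) (foot_dir2 M x p u) (line_dir2 M u) w.
Proof.
move=> fM u1 d0 y.
have vc : dot (M (w, 0)) (foot x p u) = line_dist x p u * dot2 (foot_dir2 M x p u) w.
  rewrite (frame_plane w fM) dotDl !dotZl /dot2 /foot_dir2 /=.
  by move: (line_dist x p u) d0 => d d0; field; rewrite gt_eqF.
have vu : dot (M (w, 0)) u = dot2 (line_dir2 M u) w.
  by rewrite (frame_plane w fM) dotDl !dotZl /dot2 /line_dir2 /=; ring.
have d2 : line_dist x p u ^+ 2 = dot (foot x p u) (foot x p u) by rewrite sqr_sqrtr//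
  dot_ge0.
rewrite /gap -mulrA -vc -vu -(frame_plane_dot w fM) d2.
have -> : y - p = M (w, 0) - foot x p u + dot (x - p) u *: u.
  by rewrite /y /foot; move: (_ *: _) => V; rewrite !opprD opprK; ring.
have cu := foot_orth x p u1; have uc : dot u (foot x p u) = 0 by rewrite dotC.
move: (foot x p u) (M (w, 0)) (dot (x - p) u) cu uc {d2 vc vu y d0} => c v tau cu uc.
rewrite !dotE u1 cu uc (dotC u v) (dotC c v); ring.
Qed.

(** The unit vector towards the foot and the direction of the line are
    orthonormal. *)
Lemma line_bessel u0 M x p u : frame u0 M -> dot u u = 1 -> 0 < line_dist x p u ->
  bessel (foot_dir2 M x p u) (line_dir2 M u).
Proof.
move=> fM u1 d0 w; rewrite -(frame_plane_dot w fM).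
have n0 := lt0r_neq0 d0.
have d2 : line_dist x p u ^+ 2 = dot (foot x p u) (foot x p u) by rewrite sqr_sqrtr//
  dot_ge0.
have -> : dot2 (foot_dir2 M x p u) w = dot (M (w, 0)) ((line_dist x p u)^-1 *: foot x
  p u).
  rewrite dotZr (frame_plane w fM) dotDl !dotZl /dot2 /foot_dir2 /=.
  by move: (line_dist x p u) n0 => d n0; field.
have -> : dot2 (line_dir2 M u) w = dot (M (w, 0)) u.
  by rewrite (frame_plane w fM) dotDl !dotZl /dot2 /line_dir2 /=; ring.
apply: bessel3 => //.
- by rewrite dotZl dotZr -d2; field.
- by rewrite dotZl foot_orth// mulr0.
Qed.

(** The ball of radius [4 / sqrt 3] about [x] cuts an interval centred at the
    foot out of the line. It contains a point of the segment and neither of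
    the ends, so it is in the interior of the segment. *)
Lemma near_foot t p u x : dot u u = 1 ->
  16 / 3 <= dot (x - p) (x - p) ->
  16 / 3 <= dot (x - (p + t *: u)) (x - (p + t *: u)) ->
  (exists2 tau, 0 <= tau <= t & dot (x - (p + tau *: u)) (x - (p + tau *: u)) < 16 /
    3) ->
  0 < dot (x - p) u < t /\
  (forall tau, dot (x - (p + tau *: u)) (x - (p + tau *: u)) < 16 / 3 -> 0 < tau < t).
Proof.
move=> u1 h0 ht [tau /andP[tau0 taut] htau].
move: h0 ht htau; rewrite !dist_line//.
have K0 : 0 <= dot (x - p) (x - p) - dot (x - p) u ^+ 2.
  by rewrite -dot_foot// dot_ge0.
have E tau1 := @dist_line R p u x tau1 u1.
move: (dot (x - p) (x - p)) (dot (x - p) u) E K0 => n s E K0 h0 ht htau.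
have s0 : 0 < s by rewrite ltNge; apply/negP => k; nra.
have st : s < t by rewrite ltNge; apply/negP => k; nra.
split; first by rewrite s0.
move=> tau'; rewrite E// => h.
have h1 : (tau' - s) ^+ 2 < s ^+ 2 by lra.
have h2 : (tau' - s) ^+ 2 < (t - s) ^+ 2 by lra.
by apply/andP; split; rewrite ltNge; apply/negP => k; nra.
Qed.

Section slices.
Variables (I : eqType) (s : seq I) (t : R) (p u : I -> R * R * R).

Definition axis_point (i : I) (tau : R) : R * R * R := p i + tau *: u i.

Definition unit_axes := forall i, i \in s -> dot (u i) (u i) = 1.

Definition separated := forall i j, i \in s -> j \in s -> i != j ->
  forall sigma tau, 0 <= sigma <= t -> 0 <= tau <= t ->
  4 <= dot (axis_point i sigma - axis_point j tau) (axis_point i sigma - axis_point j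
    tau).

(** The distance [4 / sqrt 3] is twice the radius of the slices: a point of an
    axis that is close to some point of the slice cannot be an end. *)
Definition qualified x : bool :=
  all (fun k => (16 / 3 <= dot (x - p k) (x - p k)) &&
                (16 / 3 <= dot (x - axis_point k t) (x - axis_point k t))) s.

Definition cell_slice (i : I) (M : R * R * R -> R * R * R) x : set (mR R * mR R) :=
  [set w | (dot2 w w < 4 / 3) &&
     all (fun j => (j != i) ==>
       (dot2 w w < axis_dist2 t (p j) (u j) (x + M (w, 0)))) s].

Lemma measurable_cell_slice i M x : measurable_fun [set: mR R * mR R * mR R] M ->
  measurable (cell_slice i M x).
Proof.
move=> mM; apply: measurable_andb.
  by apply: measurable_lt_set; [exact: measurable_dot2|exact: measurable_cst].
apply: measurable_all => j _; case: (j != i) => /=; last first.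
  by rewrite (_ : [set _ | _] = setT)//; apply/seteqP; split.
apply: measurable_lt_set; first exact: measurable_dot2.
apply: (@measurableT_comp _ _ _ _ _ _ (axis_dist2 t (p j) (u j))).
  exact: measurable_axis_dist2.
have m1 : measurable_fun [set: mR R * mR R] (fun w : mR R * mR R => M (w, 0)).
  by apply: (measurableT_comp mM); solve_measurable.
apply: (@measurableT_comp _ _ _ _ _ _ (fun z : mR R * mR R * mR R =>
  x + z : mR R * mR R * mR R) setT _ _ m1).
by have [] := preserves_translation3 x.
Qed.

Lemma axis_dist2_attained i y : 0 <= t ->
  exists2 tau, 0 <= tau <= t & axis_dist2 t (p i) (u i) y = dot (y - axis_point i tau)
    (y - axis_point i tau).
Proof.
move=> t0; exists (clamp t (dot (y - p i) (u i))); first exact: clamp_itv.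
exact: axis_dist2E.
Qed.

(** The unit disk about a point of an axis is closer to this axis than to the
    others, which are at distance at least 2. *)
Lemma cell_slice_ge_pi i M sigma : 0 <= t -> unit_axes -> separated -> i \in s ->
  frame (u i) M -> 0 <= sigma <= t ->
  ((pi : R)%:E <= area (cell_slice i M (axis_point i sigma)))%E.
Proof.
move=> t0 u1 sep si fM st; have := @disk_area_ge R 1 ler01.
rewrite mulr1 => h; apply: (le_trans h); apply: le_measure; rewrite ?inE.
- exact: measurable_disk_lt.
- by apply: measurable_cell_slice; case: fM => -[].
- move=> w /=; rewrite !expr2 -/(dot2 w w) => w1; apply/andP; split; first by lra.
  apply/allP => j sj; apply/implyP => ji.
  have [tau tt ->] := axis_dist2_attained j (axis_point i sigma + M (w, 0)) t0.
  have e : axis_point i sigma + M (w, 0) - axis_point i sigma = M (w, 0) by rewrite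
    addrAC subrr add0r.
  rewrite -(frame_plane_dot w fM) -{1 2}e; apply: closer_than_far.
    by rewrite e (frame_plane_dot w fM).
  by apply: sep => //; rewrite eq_sym.
Qed.

(** An axis that comes closer than the axis [i] to some point of the disk
    behaves like a full line, whose foot is on the axis and so at distance at
    least 2 from [x] ([near_foot]). A common point of two dark arcs would be
    close to two other axes and at distance [2 / sqrt 3] from [x], against
    [three_points]. So [slice_area] applies. *)
Lemma cell_slice_ge i M sigma : 0 <= t -> uniq s -> unit_axes -> separated -> i \in s ->
  frame (u i) M -> 0 <= sigma <= t -> qualified (axis_point i sigma) ->
  ((Num.sqrt 12)%:E <= area (cell_slice i M (axis_point i sigma)))%E.
Proof.
move=> t0 us u1 sep si fM st qual.
set x := axis_point i sigma.
pose y w := x + M (w, 0).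
have yx w : dot (y w - x) (y w - x) = dot2 w w.
  have -> : y w - x = M (w, 0) by rewrite /y addrAC subrr add0r.
  exact: frame_plane_dot fM.
(* Only the axes in [J] come as close as the axis [i] to some point of the disk. *)
pose near_ j := exists2 w, dot2 w w < 4 / 3 & axis_dist2 t (p j) (u j) (y w) <= dot2 w
  w.
pose J := [seq j <- s | (j != i) && `[< near_ j >]].
have Js j : j \in J -> j \in s by rewrite mem_filter => /andP[].
have Ji j : j \in J -> j != i by rewrite mem_filter => /andP[/andP[]].
have footP j : j \in J -> 0 < dot (x - p j) (u j) < t /\
    (forall tau, dot (x - axis_point j tau) (x - axis_point j tau) < 16 / 3 ->
      0 < tau < t).
  move=> jJ; have js := Js j jJ; have /allP/(_ j js)/andP[q0 qt] := qual.
  move: jJ; rewrite mem_filter => /andP[/andP[_ /asboolP[w w1 hw]] _].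
  apply: near_foot => //; first exact: u1.
  have [tau tt E] := axis_dist2_attained j (y w) t0.
  exists tau => //; have := dot_parallelogram x (y w) (axis_point j tau).
  by rewrite yx -E; rewrite /axis_point in E *; lra.
have dist_ge2 j : j \in J -> 2 <= line_dist x (p j) (u j).
  move=> jJ; have [/andP[f0 ft] _] := footP j jJ.
  have := sep i j si (Js j jJ); rewrite eq_sym =>
    /(_ (Ji j jJ) sigma (dot (x - p j) (u j)) st).
  have ft' : 0 <= dot (x - p j) (u j) <= t by rewrite (ltW f0) (ltW ft).
  move=> /(_ ft') h.
  have {}h : 4 <= dot (foot x (p j) (u j)) (foot x (p j) (u j)).
    apply: (le_trans h); rewrite -/x /foot /axis_point.
    by rewrite -[X in _ <= dot X X]opprB dotNl dotNr opprK.
  rewrite -(@ler_pXn2r _ 2)// ?nnegrE ?sqrtr_ge0// sqr_sqrtr ?dot_ge0//.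
  by apply: le_trans h; lra.
have dist_gt0 j : j \in J -> 0 < line_dist x (p j) (u j) by move=> /dist_ge2; lra.
pose d j := line_dist x (p j) (u j).
pose e j := foot_dir2 M x (p j) (u j).
pose v j := line_dir2 M (u j).
have lit : lit_slice J d e v `<=` cell_slice i M x.
  move=> w /andP[w1 /allP al]; apply/andP; split => //.
  apply/allP => j sj; apply/implyP => ji.
  have [jJ|] := boolP (j \in J).
    have := al j jJ; have := line_gap w fM (u1 j sj) (dist_gt0 j jJ) => /= E h.
    by apply: lt_le_trans (line_dist2_le t (p j) (y w) (u1 j sj)); rewrite E ltrDl.
  rewrite mem_filter sj ji/= andbT => /asboolPn nn.
  by rewrite ltNge; apply/negP => k; apply: nn; exists w.
apply: (@le_trans _ _ (area (lit_slice J d e v))); last first.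
  apply: le_measure => //; rewrite inE.
    apply: measurable_andb; first by apply: measurable_lt_set;
      [exact: measurable_dot2|exact: measurable_cst].
    by apply: measurable_all => j _; exact: measurable_lit.
  by apply: measurable_cell_slice; case: fM => -[].
apply: slice_area.
- exact: filter_uniq.
- exact: dist_ge2.
- by move=> j jJ; apply: (line_bessel fM); [exact/u1/Js|exact: dist_gt0].
- move=> j k w jJ kJ jk w1 gj gk.
  (* A dark point of the circle is closer than [rho] to the axis itself, not
     only to the line that extends it. *)
  have feet l : l \in J -> gap (d l) (e l) (v l) w < 0 ->
    let a := axis_point l (dot (y w - p l) (u l)) in
    dot (y w - a) (y w - a) < 4 / 3 /\ 0 <= dot (y w - p l) (u l) <= t.
    move=> lJ gl a; have ul := u1 l (Js l lJ).
    have h : dot (y w - a) (y w - a) < 4 / 3.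
      rewrite /a /axis_point dist_line// subrr expr0n/= addr0.
      by have := line_gap w fM ul (dist_gt0 l lJ) => /= ->; rewrite w1; lra.
    split => //; have [_ /(_ (dot (y w - p l) (u l)))] := footP l lJ.
    rewrite -/a; have := dot_parallelogram x (y w) a; rewrite yx w1 => h1 h2.
    by have /andP[/ltW -> /ltW ->] := h2 ltac:(lra).
  have [j1 j2] := feet j jJ gj; have [k1 k2] := feet k kJ gk.
  apply: (@three_points _ x _ _ (y w) _ j1 k1).
  + by rewrite yx w1.
  + by apply: sep => //; [exact: Js|rewrite eq_sym; exact: Ji].
  + by apply: sep => //; [exact: Js|rewrite eq_sym; exact: Ji].
  + by apply: sep => //; exact: Js.
Qed.

End slices.
End qualified_slices.

(** * Cells and their volumes *)

Section cells.
Context (R : realType).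
Variables (I : eqType) (s : seq I) (t : R) (p u : I -> R * R * R).
Local Notation axis := (axis_point p u).
Local Notation leb := (@lebesgue_measure R).

(** Squared distance from [y] to the line that extends the axis [i]. *)
Definition perp2 (i : I) (y : R * R * R) : R :=
  dot (y - p i) (y - p i) - dot (y - p i) (u i) ^+ 2.

Definition mid_cell (i : I) : set (mR R * mR R * mR R) :=
  [set y | (0 < dot (y - p i) (u i) < t) && ((perp2 i y < 4 / 3) &&
     all (fun j => (j != i) ==> (perp2 i y < axis_dist2 t (p j) (u j) y)) s)].

Definition low_cap (i : I) : set (mR R * mR R * mR R) :=
  [set y | (dot (y - p i) (u i) <= 0) && (dot (y - p i) (y - p i) < 1)].

Definition high_cap (i : I) : set (mR R * mR R * mR R) :=
  [set y | (0 <= dot (y - axis i t) (u i)) && (dot (y - axis i t) (y - axis i t) < 1)].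

(** The half balls have radius 1, hence are closer to the axis [i] than to the
    others without imposing it. *)
Definition cell (i : I) := mid_cell i `|` low_cap i `|` high_cap i.

Definition unqualified (i : I) : set (mR R) :=
  [set sigma | (0 < sigma < t) && ~~ qualified s t p u (axis i sigma)].

Definition qualified_part (i : I) : set (mR R) :=
  [set sigma | (0 < sigma < t) && qualified s t p u (axis i sigma)].

Lemma measurable_translate (a : R * R * R) :
  measurable_fun [set: mR R * mR R * mR R] (fun y => y - a : mR R * mR R * mR R).
Proof.
have [] := preserves_translation3 (- a).
by under [X in measurable_fun _ X -> _]eq_fun do rewrite addrC.
Qed.

Lemma measurable_dot_cst (b : R * R * R) (f : mR R * mR R * mR R ->
  mR R * mR R * mR R) :
  measurable_fun setT f -> measurable_fun setT (fun y => dot (f y) b).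
Proof. by move=> mf; apply: measurable_dot => //; exact: measurable_cst. Qed.

Lemma measurable_perp2 i : measurable_fun [set: mR R * mR R * mR R] (perp2 i).
Proof.
have m := measurable_translate (p i).
have m1 := measurable_dot m m.
have m2 := measurable_dot_cst (u i) m.
by rewrite /perp2; solve_measurable.
Qed.

Lemma measurable_mid_cell i : measurable (mid_cell i).
Proof.
have m2 := measurable_dot_cst (u i) (measurable_translate (p i)).
apply: measurable_andb.
  by apply: measurable_andb; apply: measurable_lt_set => //; exact: measurable_cst.
apply: measurable_andb.
  by apply: measurable_lt_set; [exact: measurable_perp2|exact: measurable_cst].
apply: measurable_all => j _; case: (j != i) => /=; last first.
  by rewrite (_ : [set _ | _] = setT)//; apply/seteqP; split.
by apply: measurable_lt_set; [exact: measurable_perp2|exact: measurable_axis_dist2].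
Qed.

Lemma measurable_low_cap i : measurable (low_cap i).
Proof.
have m := measurable_translate (p i).
apply: measurable_andb.
  by apply: measurable_le_set; [exact: measurable_dot_cst|exact: measurable_cst].
by apply: measurable_lt_set; [exact: measurable_dot|exact: measurable_cst].
Qed.

Lemma measurable_high_cap i : measurable (high_cap i).
Proof.
have m := measurable_translate (axis i t).
apply: measurable_andb.
  by apply: measurable_le_set; [exact: measurable_cst|exact: measurable_dot_cst].
by apply: measurable_lt_set; [exact: measurable_dot|exact: measurable_cst].
Qed.

Lemma measurable_cell i : measurable (cell i).
Proof.
apply: measurableU; first apply: measurableU.
- exact: measurable_mid_cell.
- exact: measurable_low_cap.
- exact: measurable_high_cap.
Qed.

Lemma frame_preserves (v a : R * R * R) M : frame v M ->
  preserves (@vol R) (fun z => a + M z).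
Proof.
move=> [pM _ _ _]; rewrite -[X in preserves _ X]/((fun z => a + z) \o M).
by apply: preserves_comp => //; exact: preserves_translation3.
Qed.

Lemma frame_axis (v : R * R * R) M z : frame v M -> dot (M z) v = z.2.
Proof. by move=> [_ _ iso <-]; rewrite iso /dot /=; ring. Qed.

Lemma frame_split (v : R * R * R) M (w : R * R) (sigma : R) : frame v M ->
  M (w, sigma) = sigma *: v + M (w, 0).
Proof.
move=> [_ lin _ <-]; rewrite addrC -lin; congr M; case: w => a b.
transitivity (a + sigma * 0, b + sigma * 0, 0 + sigma * 1); last by [].
by congr (_, _, _); ring.
Qed.

Lemma lower_half_ball_vol :
  ((2 / 3 * pi : R)%:E <= vol [set z : R * R * R | (-1 <= z.2 <= 0)%R /\
     (z.1.1 ^+ 2 + z.1.2 ^+ 2 + z.2 ^+ 2 < 1 ^+ 2)%R])%E.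
Proof.
apply: le_trans (ball_slab_ge _ _ _ _); rewrite ?ler01// ?oppr_le0//.
by rewrite lee_fin; move: (pi : R) => P; lra.
Qed.

Lemma upper_half_ball_vol :
  ((2 / 3 * pi : R)%:E <= vol [set z : R * R * R | (0 <= z.2 <= 1)%R /\
     (z.1.1 ^+ 2 + z.1.2 ^+ 2 + z.2 ^+ 2 < 1 ^+ 2)%R])%E.
Proof.
apply: le_trans (ball_slab_ge _ _ _ _); rewrite ?ler01// ?oppr_le0//.
by rewrite lee_fin; move: (pi : R) => P; lra.
Qed.

Lemma dot_sum3 (z : R * R * R) : dot z z = z.1.1 ^+ 2 + z.1.2 ^+ 2 + z.2 ^+ 2.
Proof. by rewrite /dot -!expr2. Qed.

Lemma measurable_slab (a b w : R) : measurable
  [set z : mR R * mR R * mR R | (a <= z.2 <= b)%R /\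
     (z.1.1 ^+ 2 + z.1.2 ^+ 2 + z.2 ^+ 2 < w)%R].
Proof.
apply: measurable_and.
  by apply: measurable_andb; apply: measurable_le_set; solve_measurable.
by apply: measurable_lt_set; solve_measurable.
Qed.

Lemma low_cap_vol i : dot (u i) (u i) = 1 -> ((2 / 3 * pi : R)%:E <= vol (low_cap i))%E.
Proof.
move=> u1; have [M fM] := exists_frame u1.
have [mP P] := frame_preserves (p i) fM.
rewrite -(P _ (measurable_low_cap i)).
apply: (le_trans lower_half_ball_vol); apply: le_measure; rewrite ?inE.
- exact: measurable_slab.
- exact: measurable_preimage_fun mP (measurable_low_cap i).
- move=> z /= [/andP[z1 z0]]; rewrite expr1n -dot_sum3 => zz.
  have [_ _ iso _] := fM.
  rewrite /low_cap /preimage /= addrAC subrr add0r (frame_axis _ fM) iso.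
  by rewrite z0 zz.
Qed.

Lemma high_cap_vol i : dot (u i) (u i) = 1 ->
  ((2 / 3 * pi : R)%:E <= vol (high_cap i))%E.
Proof.
move=> u1; have [M fM] := exists_frame u1.
have [mP P] := frame_preserves (axis i t) fM.
rewrite -(P _ (measurable_high_cap i)).
apply: (le_trans upper_half_ball_vol); apply: le_measure; rewrite ?inE.
- exact: measurable_slab.
- exact: measurable_preimage_fun mP (measurable_high_cap i).
- move=> z /= [/andP[z1 z0]]; rewrite expr1n -dot_sum3 => zz.
  have [_ _ iso _] := fM.
  rewrite /high_cap /preimage /= addrAC subrr add0r (frame_axis _ fM) iso.
  by rewrite z1 zz.
Qed.

Lemma measurable_axis_dot i (b : R * R * R) :
  measurable_fun [set: mR R] (fun sigma : mR R =>
    dot (axis i sigma - b) (axis i sigma - b)).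
Proof.
rewrite /dot /axis_point /= /GRing.scale /= /GRing.scale /=.
by solve_measurable.
Qed.

Lemma measurable_open_itv : measurable [set sigma : mR R | 0 < sigma < t].
Proof.
by apply: measurable_andb; apply: (@measurable_lt_set _ (mR R)); solve_measurable.
Qed.

Lemma measurable_qualified i : measurable [set sigma : mR R | qualified s t p u
  (axis i sigma)].
Proof.
apply: measurable_all => k _; apply: measurable_andb.
  apply: (@measurable_le_set _ (mR R)); first exact: measurable_cst.
  exact: measurable_axis_dot.
apply: (@measurable_le_set _ (mR R)); first exact: measurable_cst.
exact: measurable_axis_dot.
Qed.

Lemma measurable_qualified_part i : measurable (qualified_part i).
Proof. by apply: measurable_andb;
  [exact: measurable_open_itv|exact: measurable_qualified]. Qed.

Lemma measurable_unqualified i : measurable (unqualified i).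
Proof.
apply: measurable_andb; first exact: measurable_open_itv.
rewrite (_ : [set _ | _] = ~` [set sigma : mR R | qualified s t p u (axis i sigma)]).
  by apply: measurableC; exact: measurable_qualified.
by apply/seteqP; split => x /= /negP.
Qed.

Lemma mid_cell_section i M sigma (w : R * R) : dot (u i) (u i) = 1 -> frame (u i) M ->
  0 < sigma < t -> cell_slice s t p u i M (axis i sigma) w ->
    mid_cell i (p i + M (w, sigma)).
Proof.
move=> u1 fM st /andP[w1 al].
have E : p i + M (w, sigma) = axis i sigma + M (w, 0).
  by rewrite (frame_split _ _ fM) addrA.
have e0 : p i + M (w, sigma) - p i = M (w, sigma) by rewrite addrAC subrr add0r.
have h : perp2 i (p i + M (w, sigma)) = dot2 w w.
  rewrite /perp2 e0 (frame_axis _ fM) /=.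
  by case: fM => _ _ -> _; rewrite /dot /dot2 /=; ring.
rewrite /mid_cell /= h w1 e0 (frame_axis _ fM) /= st/=.
apply: sub_all al => j; rewrite E.
by [].
Qed.

(** Integration of the areas of slices along the axis, which is first made
    vertical. *)
Lemma mid_cell_vol i : 0 <= t -> uniq s -> unit_axes s u -> separated s t p u ->
  i \in s ->
  ((Num.sqrt 12)%:E * leb (qualified_part i) + (pi : R)%:E * leb (unqualified i)
    <= vol (mid_cell i))%E.
Proof.
move=> t0 us u1 sep si; have ui := u1 i si.
have [M fM] := exists_frame ui.
have [mP P] := frame_preserves (p i) fM.
rewrite -(P _ (measurable_mid_cell i)).
set A := _ @^-1` _.
have mA : measurable A by exact: measurable_preimage_fun mP (measurable_mid_cell i).
have mM : measurable_fun [set: mR R * mR R * mR R] M by case: fM => -[].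
have mpre (D : set (mR R)) : measurable D ->
  measurable [set z : mR R * mR R * mR R | D z.2].
  by move=> mD; rewrite -[X in measurable X]setTI; exact: measurable_snd.
have part (D : set (mR R)) (c : R) : 0 <= c -> measurable D ->
  (D `<=` [set sigma | 0 < sigma < t]) ->
    (forall sigma, D sigma -> (c%:E <= area
      (cell_slice s t p u i M (axis i sigma)))%E) ->
    (c%:E * leb D <= vol (A `&` [set z | D z.2]))%E.
  move=> c0 mD Dt H; rewrite -integral_cst//.
  apply: (@le_integral_product _ _ _ _ _ (@area R)) => //.
  - by apply: measurableI => //; exact: mpre.
  - move=> sigma Ds /=; apply: (le_trans (H _ Ds)); apply: le_measure; rewrite ?inE.
    + exact: measurable_cell_slice.
    + have := measurable_ysection sigma (measurableI _ _ mA (mpre D mD)).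
      by rewrite ysectionEset.
    + move=> w hw; split => //; rewrite /A /preimage /=.
      by apply: mid_cell_section => //; exact: Dt.
have hQ := @part (qualified_part i) (Num.sqrt 12) (sqrtr_ge0 _)
  (measurable_qualified_part i).
have hN := @part (unqualified i) pi (@pi_ge0 R) (measurable_unqualified i).
apply: (@le_trans _ _ (vol (A `&` [set z | qualified_part i z.2]) + vol
  (A `&` [set z | unqualified i z.2]))%E).
  apply: leeD.
  - apply: hQ; first by move=> sigma /andP[].
    move=> sigma /andP[/andP[h1 h2] q]; apply: cell_slice_ge => //.
    by rewrite !ltW.
  - apply: hN; first by move=> sigma /andP[].
    move=> sigma /andP[/andP[h1 h2] q]; apply: cell_slice_ge_pi => //.
    by rewrite !ltW.
have mAQ : measurable (A `&` [set z | qualified_part i z.2]).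
  by apply: measurableI => //; apply: mpre; exact: measurable_qualified_part.
have mAN : measurable (A `&` [set z | unqualified i z.2]).
  by apply: measurableI => //; apply: mpre; exact: measurable_unqualified.
have disj : (A `&` [set z | qualified_part i z.2]) `&`
  (A `&` [set z | unqualified i z.2]) = set0.
  by apply/seteqP; split => z //= [[_ /andP[_ q]] [_ /andP[_ /negP nq]]].
have U := measureU (@area R \x leb)%E mAQ mAN disj.
rewrite -[leLHS]U; apply: le_measure; rewrite ?inE//; first exact: measurableU.
by move=> z [] [].
Qed.

Lemma cell_vol i : 0 < t -> uniq s -> unit_axes s u -> separated s t p u -> i \in s ->
  ((Num.sqrt 12)%:E * leb (qualified_part i) + (pi : R)%:E * leb (unqualified i) +
    (4 / 3 * pi)%:E
    <= vol (cell i))%E.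
Proof.
move=> t0 us u1 sep si; have ui := u1 i si.
have h1 := mid_cell_vol (ltW t0) us u1 sep si.
have h2 := low_cap_vol ui; have h3 := high_cap_vol ui.
have m1 := measurable_mid_cell i; have m2 := measurable_low_cap i; have m3 :=
  measurable_high_cap i.
have shift y : dot (y - axis i t) (u i) = dot (y - p i) (u i) - t.
  by rewrite /axis_point opprD addrA [LHS]dotDl dotNl dotZl ui mulr1.
rewrite [leRHS](measureU (@area R \x leb)%E) //; last 2 first.
- exact: measurableU.
- apply/seteqP; split => y //= [[/andP[/andP[a1 a2] _]|/andP[a2 _]] /andP[]];
    rewrite shift; lra.
rewrite [X in (_ <= X + _)%E](measureU (@area R \x leb)%E) //; last first.
  by apply/seteqP; split => y //= [/andP[/andP[a1 a2] _] /andP[a3 _]]; lra.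
rewrite (_ : (4 / 3 * pi)%:E = (2 / 3 * pi)%:E + (2 / 3 * pi)%:E)%E; last first.
  by rewrite -EFinD; congr EFin; move: (pi : R) => P; lra.
by rewrite addeA; exact: (leeD (leeD h1 h2) h3).
Qed.

End cells.

(** * Disjointness and position of cells *)

Lemma disjoint_sum_le disp (T : measurableType disp) (R : realType)
    (mu : {measure set T -> \bar R}) (I : eqType) (s : seq I)
    (V : I -> set T) (B : set T) :
  uniq s -> measurable B -> (forall i, i \in s -> measurable (V i)) ->
  (forall i, i \in s -> V i `<=` B) ->
  (forall i j, i \in s -> j \in s -> i != j -> V i `&` V j = set0) ->
  (\sum_(i <- s) mu (V i) <= mu B)%E.
Proof.
elim: s B => [|i s IH] B us mB mV VB dis; first by rewrite big_nil.
have is_ : i \in i :: s by rewrite mem_head.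
have sub k : k \in s -> k \in i :: s by rewrite inE => ->; rewrite orbT.
have /andP[nis us'] : (i \notin s) && uniq s by [].
have ne k : k \in s -> k != i by move=> ks; apply: contraNneq nis => <-.
have mi := mV i is_.
have -> : (mu B = mu (V i) + mu (B `\` V i))%E.
  have {1}-> : B = V i `|` (B `\` V i) by rewrite setDUK//; exact: VB.
  rewrite measureU//; first exact: measurableD.
  by rewrite setDE setICA setICr setI0.
rewrite big_cons; apply: leeD => //; apply: IH => //.
- exact: measurableD.
- by move=> k /sub; exact: mV.
- move=> k ks y Vy; split; first exact: (VB k (sub k ks)).
  move=> Viy; have : (V k `&` V i) y by [].
  by rewrite (dis k i (sub k ks) is_ (ne k ks)).
- by move=> k l /sub ks /sub ls; exact: dis.
Qed.

Section cell_position.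
Context (R : realType).
Variables (I : eqType) (s : seq I) (t : R) (p u : I -> R * R * R).
Local Notation axis := (axis_point p u).
Local Notation cell := (cell s t p u).

Lemma axis0 i : axis i 0 = p i.
Proof. by rewrite /axis_point scale0r addr0. Qed.

Lemma dist_axis i y : dot (u i) (u i) = 1 ->
  dot (y - axis i (dot (y - p i) (u i))) (y - axis i (dot (y - p i) (u i))) = perp2 p
    u i y.
Proof. by move=> u1; rewrite /axis_point dist_line// subrr expr0n/= addr0. Qed.

(** The one property of cells behind their disjointness and their inclusion in
    a ball. *)
Lemma cell_close i y : 0 <= t -> unit_axes s u -> separated s t p u -> i \in s ->
  cell i y -> exists2 sigma, 0 <= sigma <= t &
    dot (y - axis i sigma) (y - axis i sigma) < 4 / 3 /\
    forall k, k \in s -> k != i ->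
      dot (y - axis i sigma) (y - axis i sigma) < axis_dist2 t (p k) (u k) y.
Proof.
move=> t0 u1 sep si; have ui := u1 i si.
have near_end sigma : 0 <= sigma <= t -> dot (y - axis i sigma) (y - axis i sigma) < 1
  ->
    exists2 sigma, 0 <= sigma <= t &
    dot (y - axis i sigma) (y - axis i sigma) < 4 / 3 /\
    forall k, k \in s -> k != i ->
      dot (y - axis i sigma) (y - axis i sigma) < axis_dist2 t (p k) (u k) y.
  move=> st h; exists sigma => //; split; first by lra.
  move=> k sk ki; have [tau tt ->] := axis_dist2_attained p u k y t0.
  by apply: closer_than_far => //; apply: sep => //; rewrite eq_sym.
move=> [[/andP[/andP[h1 h2] /andP[h3 /allP h4]]|/andP[_ h]]|/andP[_ h]].
- exists (dot (y - p i) (u i)); first by rewrite !ltW.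
  rewrite dist_axis//; split => // k sk ki.
  by have /implyP := h4 k sk; apply.
- by apply: (near_end 0); [rewrite lexx|rewrite axis0].
- by apply: (near_end t) => //; rewrite t0 lexx.
Qed.

Lemma cells_disjoint i k : 0 <= t -> unit_axes s u -> separated s t p u ->
  i \in s -> k \in s -> i != k -> cell i `&` cell k = set0.
Proof.
move=> t0 u1 sep si sk ik; apply/seteqP; split => y // [ci ck].
have [a at_ [_ /(_ k sk)]] := cell_close t0 u1 sep si ci.
have [b bt [_ /(_ i si ik)]] := cell_close t0 u1 sep sk ck.
rewrite eq_sym => h1 /(_ ik) h2.
have h3 := axis_dist2_le (p i) y (u1 i si) at_.
have h4 := axis_dist2_le (p k) y (u1 k sk) bt.
have := lt_le_trans (lt_le_trans h2 h4) (le_trans (ltW h1) h3).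
by rewrite ltxx.
Qed.

Lemma axis_in_capped i sigma : 0 <= t -> dot (u i) (u i) = 1 -> 0 <= sigma <= t ->
  capped t (p i) (u i) (axis i sigma).
Proof.
move=> t0 ui st; rewrite cappedE//=; last by rewrite /enorm ui sqrtr1.
exists sigma => //; rewrite subrr /enorm.
by rewrite (_ : dot 0 0 = 0) ?sqrtr0// /dot /= !mul0r !addr0.
Qed.

Lemma cell_sub i (k : R) : 0 <= t -> unit_axes s u -> separated s t p u -> i \in s ->
  0 <= k -> capped t (p i) (u i) `<=` cball k -> cell i `<=` cball (k + hex_radius R).
Proof.
move=> t0 u1 sep si k0 Ck y ci.
have [sigma st [h _]] := cell_close t0 u1 sep si ci.
have := Ck _ (axis_in_capped t0 (u1 i si) st).
have r0 := ltW (@hex_radius_gt0 R).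
rewrite /cball /= !enorm_le ?addr_ge0// => ha.
by apply: ball_triangle ha _ => //; rewrite hex_radius_sq ltW.
Qed.

End cell_position.

(** * Length of the unqualified parts *)

Section lengths.
Context (R : realType).
Variables (I : eqType) (s : seq I) (t : R) (p u : I -> R * R * R).
Local Notation axis := (axis_point p u).
Local Notation leb := (@lebesgue_measure R).

Definition near_part (i : I) (E : R * R * R) : set (mR R) :=
  [set sigma | (0 < sigma < t) && (dot (axis i sigma - E) (axis i sigma - E) < 16 / 3)].

Lemma measurable_near_part i E : measurable (near_part i E).
Proof.
apply: measurable_andb; first exact: measurable_open_itv.
by apply: (@measurable_lt_set _ (mR R));
  [exact: measurable_axis_dot|exact: measurable_cst].
Qed.

Lemma unqualified_le i :
  (leb (unqualified s t p u i) <=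
   \sum_(k <- s) (leb (near_part i (p k)) + leb (near_part i (axis k t))))%E.
Proof.
elim: s => [|k s' IH].
  rewrite big_nil (_ : unqualified _ _ _ _ _ = set0) ?measure0//.
  by apply/seteqP; split => x //=; rewrite /unqualified /= andbF.
rewrite big_cons.
pose N := near_part i (p k) `|` near_part i (axis k t).
have mN : measurable N by apply: measurableU; exact: measurable_near_part.
have mU := measurable_unqualified s' t p u i.
apply: (@le_trans _ _ (leb (N `|` unqualified s' t p u i))).
  apply: le_measure; rewrite ?inE.
  - exact: measurable_unqualified.
  - exact: measurableU.
  - move=> x /andP[xt]; rewrite /qualified /= negb_and => /orP[|h].
      rewrite negb_and -!ltNge => /orP[h|h]; left; [left|right];
        by rewrite /near_part /= xt.
    by right; rewrite /unqualified /= xt.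
apply: (le_trans (measureU2 _ _ _)) => //; apply: leeD => //.
by apply: (le_trans (measureU2 _ _ _)) => //; exact: measurable_near_part.
Qed.

(** The part of the open unit cylinder about the axis [i] that projects to
    [near_part i E]. *)
Definition tube (i : I) (E : R * R * R) : set (mR R * mR R * mR R) :=
  [set y | near_part i E (dot (y - p i) (u i)) /\ perp2 p u i y < 1].

Lemma measurable_tube i E : measurable (tube i E).
Proof.
apply: measurable_and.
  apply: (@measurable_preimage_fun _ _ _ (mR R) (fun y : mR R * mR R * mR R =>
    dot (y - p i) (u i)) (near_part i E)).
    by apply: measurable_dot_cst; exact: measurable_translate.
  exact: measurable_near_part.
by apply: measurable_lt_set; [exact: measurable_perp2|exact: measurable_cst].
Qed.

Lemma tube_vol i E : dot (u i) (u i) = 1 ->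
  ((pi : R)%:E * leb (near_part i E) <= vol (tube i E))%E.
Proof.
move=> ui; have [M fM] := exists_frame ui.
have [mP P] := frame_preserves (p i) fM.
rewrite -(P _ (measurable_tube i E)) -integral_cst; last exact: measurable_near_part.
have mA := measurable_preimage_fun mP (measurable_tube i E).
have p0 := @pi_ge0 R.
apply: (@le_integral_product _ _ _ _ _ (@area R)) => //.
- exact: measurable_near_part.
- move=> sigma Ns /=; have := @disk_area_ge R 1 ler01; rewrite mulr1 => /le_trans;
    apply.
  apply: le_measure; rewrite ?inE.
  + exact: measurable_disk_lt.
  + by have := measurable_ysection sigma mA; rewrite ysectionEset.
  + move=> w /= w1; rewrite /preimage /tube /= /perp2 addrAC subrr add0r
      (frame_axis _ fM) /=.
    split => //; case: fM => _ _ -> _; move: w1; rewrite /dot /= !expr2; lra.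
Qed.

Lemma tube_close i E y : dot (u i) (u i) = 1 -> tube i E y ->
  exists2 sigma, 0 < sigma < t & dot (y - axis i sigma) (y - axis i sigma) < 1 /\
    dot (axis i sigma - E) (axis i sigma - E) < 16 / 3.
Proof.
move=> ui [/andP[st h1] h2]; exists (dot (y - p i) (u i)) => //.
by split => //; rewrite dist_axis.
Qed.

Definition big_radius : R := 4 / Num.sqrt 3 + 1.

Lemma ball_vol_le (E : R * R * R) (r : R) : 0 <= r ->
  measurable [set y : mR R * mR R * mR R | dot (y - E) (y - E) <= r ^+ 2] /\
  (vol [set y | (dot (y - E) (y - E) <= r ^+ 2)%R] <= (4 / 3 * pi * r ^+ 3)%:E)%E.
Proof.
move=> r0; set B := [set y : mR R * mR R * mR R | _].
have mB : measurable B.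
  apply: measurable_le_set; last exact: measurable_cst.
  by apply: measurable_dot; exact: measurable_translate.
split => //.
have [_ P] := preserves_translation3 E.
rewrite -(P _ mB).
have -> : 4 / 3 * pi * r ^+ 3 = pi * (r ^+ 2 * (r - - r) - (r ^+ 3 - (- r) ^+ 3) / 3)
  :> R.
  by move: (pi : R) => q; field.
apply: le_trans (ball_slab_le r0 (lexx _) _ (lexx _)); last by lra.
apply: le_measure; rewrite ?inE.
- by have := measurable_preimage_fun (proj1 (preserves_translation3 E)) mB.
- apply: measurable_and.
    by apply: measurable_andb; apply: measurable_le_set; solve_measurable.
  by apply: measurable_le_set; solve_measurable.
- move=> z; rewrite /B /preimage /= addrAC subrr add0r dot_sum3 => h; split => //.
  have h1 := sqr_ge0 z.1.1; have h2 := sqr_ge0 z.1.2.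
  have h3 : z.2 ^+ 2 <= r ^+ 2 by lra.
  by rewrite -ler_norml -(ger0_norm r0) -ler_sqr ?nnegrE// !real_normK ?num_real.
Qed.

(** The tubes about the parts near [E] are disjoint, since axes are at
    distance at least 2, and contained in the ball of radius [4 / sqrt 3 + 1]
    about [E]. *)
Lemma end_length E : 0 <= t -> uniq s -> unit_axes s u -> separated s t p u ->
  (\sum_(i <- s) leb (near_part i E) <= (t0 R)%:E)%E.
Proof.
move=> tge us u1 sep.
have p0 := @pi_gt0 R.
have q0 : 0 < 4 / Num.sqrt 3 :> R by rewrite divr_gt0// sqrtr_gt0.
have b0 : 0 <= big_radius by rewrite /big_radius; lra.
have [mB hB] := ball_vol_le E b0.
have q2 : (4 / Num.sqrt 3) ^+ 2 = 16 / 3 :> R by rewrite expr_div_n sqr_sqrtr//; field.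
have : (\sum_(i <- s) vol (tube i E) <= (4 / 3 * pi * big_radius ^+ 3)%:E)%E.
  apply: le_trans hB; apply: (@disjoint_sum_le _ _ R (@area R \x leb)%E) => //.
  - by move=> i _; exact: measurable_tube.
  - move=> i si y /(tube_close (u1 i si))[sigma _ [h1 h2]] /=.
    rewrite /big_radius; apply: (ball_triangle (ltW q0) ler01 (x := axis i sigma - E)).
    + by rewrite q2 ltW.
    + by rewrite opprB addrA subrK expr1n ltW.
  - move=> i j si sj ij; apply/seteqP; split => y // [yi yj].
    have [a /andP[a0 at_] [ha _]] := tube_close (u1 i si) yi.
    have [b /andP[b0' bt] [hb _]] := tube_close (u1 j sj) yj.
    have ta : 0 <= a <= t by rewrite (ltW a0) (ltW at_).
    have tb : 0 <= b <= t by rewrite (ltW b0') (ltW bt).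
    have := sep i j si sj ij a b ta tb.
    have := dot_parallelogram (axis i a) y (axis j b); lra.
move=> h.
have {}h : ((pi : R)%:E * \sum_(i <- s) leb (near_part i E) <=
  (4 / 3 * pi * big_radius ^+ 3)%:E)%E.
  apply: le_trans h; rewrite ge0_sume_distrr//.
  rewrite !big_seq; apply: lee_sum => i si; exact: tube_vol (u1 i si).
(* [t0] is the volume of the ball divided by the area of the section of a tube. *)
move: h; rewrite (_ : 4 / 3 * pi * big_radius ^+ 3 = pi * t0 R); last first.
  by rewrite /t0 /big_radius; ring.
by rewrite EFinM lee_pmul2l ?lte_fin.
Qed.

Lemma total_unqualified : 0 <= t -> uniq s -> unit_axes s u -> separated s t p u ->
  (\sum_(i <- s) leb (unqualified s t p u i) <= (2 * t0 R *+ size s)%:E)%E.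
Proof.
move=> tge us u1 sep.
apply: (@le_trans _ _ (\sum_(i <- s) \sum_(k <- s) (leb (near_part i (p k)) + leb
  (near_part i (axis k t))))%E).
  by apply: lee_sum => i _; exact: unqualified_le.
rewrite exchange_big/=.
apply: (@le_trans _ _ (\sum_(k <- s) (2 * t0 R)%:E)%E).
  apply: lee_sum => k _; rewrite big_split/= (_ : (2 * t0 R)%:E = (t0 R)%:E +
    (t0 R)%:E)%E.
    by apply: leeD; exact: end_length.
  by rewrite -EFinD; congr EFin; ring.
by rewrite sumEFin big_const_seq count_predT iter_addr_0.
Qed.

End lengths.

(** * Volumes of capped cylinders and packings *)

Section capped_volume.
Context (R : realType).
Implicit Types (p u c v x : R * R * R) (t : R).

Lemma measurable_hemisphere c v : measurable
  (hemisphere c v : set (mR R * mR R * mR R)).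
Proof.
rewrite (_ : hemisphere c v = [set x : R * R * R | (dot (x - c) (x - c) <= 1) &&
  (0 <= dot (x - c) v)]).
  have m := measurable_translate c.
  apply: measurable_andb; apply: measurable_le_set; try exact: measurable_cst.
    exact: measurable_dot.
  exact: measurable_dot_cst.
by apply/seteqP; split => x; rewrite /hemisphere /= enorm_le// expr1n;
  [move=> [-> ->]|move=> /andP[-> ->]].
Qed.

Lemma hemisphere_vol c v : dot v v = 1 -> (vol (hemisphere c v) <= (2 / 3 * pi)%:E)%E.
Proof.
move=> v1; have [M fM] := exists_frame v1.
have [mP P] := frame_preserves c fM.
rewrite -(P _ (measurable_hemisphere c v)).
have -> : 2 / 3 * pi = pi * (1 ^+ 2 * (1 - 0) - (1 ^+ 3 - 0 ^+ 3) / 3) :> R.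
  by move: (pi : R) => q; field.
apply: le_trans (ball_slab_le ler01 _ ler01 (lexx _)); last by lra.
apply: le_measure; rewrite ?inE.
- exact: measurable_preimage_fun mP (measurable_hemisphere c v).
- apply: measurable_and.
    by apply: measurable_andb; apply: measurable_le_set; solve_measurable.
  by apply: measurable_le_set; solve_measurable.
- move=> z; rewrite /preimage /hemisphere /= addrAC subrr add0r (frame_axis _ fM)
    enorm_le//.
  have [_ _ -> _] := fM; rewrite dot_sum3 => -[h z0]; split => //.
  have h1 := sqr_ge0 z.1.1; have h2 := sqr_ge0 z.1.2.
  rewrite z0/= leNgt; apply/negP => k; nra.
Qed.

Lemma measurable_cylinder t p u : measurable
  (cylinder t p u : set (mR R * mR R * mR R)).
Proof.
have m := measurable_translate p.
have m1 := measurable_dot_cst u m.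
rewrite (_ : cylinder t p u = [set x : R * R * R | (0 <= dot (x - p) u <= t) &&
   (dot (x - p - dot (x - p) u *: u) (x - p - dot (x - p) u *: u) <= 1)]).
  apply: measurable_andb.
    by apply: measurable_andb; apply: measurable_le_set => //; exact: measurable_cst.
  apply: measurable_le_set; last exact: measurable_cst.
  rewrite /dot /= /GRing.scale /= /GRing.scale /=.
  by solve_measurable.
by apply/seteqP; split => x; rewrite /cylinder /= enorm_le// expr1n;
  [move=> [-> ->]|move=> /andP[-> ->]].
Qed.

Lemma cylinder_vol t p u : 0 <= t -> dot u u = 1 ->
  (vol (cylinder t p u) <= (pi * t)%:E)%E.
Proof.
move=> t0 u1; have [M fM] := exists_frame u1.
have [mP P] := frame_preserves p fM.
rewrite -(P _ (measurable_cylinder t p u)).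
apply: le_trans (cylinder_vol_le t0).
apply: le_measure; rewrite ?inE.
- exact: measurable_preimage_fun mP (measurable_cylinder t p u).
- apply: measurable_and.
    by apply: measurable_andb; apply: measurable_le_set; solve_measurable.
  by apply: measurable_le_set; solve_measurable.
- move=> z; rewrite /preimage /cylinder /= addrAC subrr add0r enorm_le//
    dot_sub_scale// (frame_axis _ fM).
  have [_ _ -> _] := fM; rewrite dot_sum3 expr1n => -[-> h]; split => //.
  by move: h; rewrite !expr2; lra.
Qed.

Lemma capped_vol t p u : 0 <= t -> enorm u = 1 ->
  (vol (capped t p u) <= (pi * (t + 4 / 3))%:E)%E.
Proof.
move=> t0 /enorm_eq1 u1.
have v1 : dot (- u) (- u) = 1 by rewrite dotNl dotNr opprK.
have mc := measurable_cylinder t p u.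
have m1 := measurable_hemisphere p (- u).
have m2 := measurable_hemisphere (p + t *: u) u.
have -> : pi * (t + 4 / 3) = pi * t + 2 / 3 * pi + 2 / 3 * pi :> R.
  by move: (pi : R) => q; lra.
rewrite /capped !EFinD.
apply: (le_trans (@measureU2 _ _ _ (@area R \x @lebesgue_measure R)%E _ _ _ m2));
  first exact: measurableU.
apply: leeD; last exact: hemisphere_vol.
apply: (le_trans (@measureU2 _ _ _ (@area R \x @lebesgue_measure R)%E _ _ mc m1)).
by apply: leeD; [exact: cylinder_vol|exact: hemisphere_vol].
Qed.

Lemma continuous_dist2 (a : R * R * R) : continuous (fun x : R * R * R =>
  dot (x - a) (x - a)).
Proof.
have f1 : continuous (fun x : R * R * R => x.1.1).
  by move=> x; apply: continuous_comp; exact: cvg_fst.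
have f2 : continuous (fun x : R * R * R => x.1.2).
  by move=> x; apply: continuous_comp; [exact: cvg_fst|exact: cvg_snd].
have f3 : continuous (fun x : R * R * R => x.2) by move=> x; exact: cvg_snd.
have sq (f : R * R * R -> R) (b : R) : continuous f ->
  continuous (fun x => (f x - b) * (f x - b)).
  by move=> cf x; apply: cvgM; apply: cvgB => //; try exact: cf; exact: cvg_cst.
move=> x; rewrite /dot /=.
by apply: cvgD; [apply: cvgD|]; apply: sq.
Qed.

Lemma interior_capped t p u x tau : 0 <= t -> enorm u = 1 -> 0 <= tau <= t ->
  dot (x - (p + tau *: u)) (x - (p + tau *: u)) < 1 -> (capped t p u)° x.
Proof.
move=> t0 u1 tt h.
pose U : set (R * R * R) := [set y | dot (y - (p + tau *: u)) (y - (p + tau *: u)) < 1].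
have oU : open U.
  pose f (y : R * R * R) : R := dot (y - (p + tau *: u)) (y - (p + tau *: u)).
  rewrite -[U]/(f @^-1` [set r : R | r < 1]).
  apply: open_comp; last exact: open_lt.
  by move=> y _; exact: continuous_dist2.
rewrite /interior; apply: (@filterS _ _ _ U).
  rewrite cappedE// => y hy /=; exists tau => //.
  by rewrite enorm_le// expr1n ltW.
by apply: open_nbhs_nbhs; split.
Qed.

(** The midpoint of two points of different axes at distance less than 2 would
    be interior to both capped cylinders. *)
Lemma packing_separated t (I : countType) (C : I -> set (R * R * R)) (p u : I ->
  R * R * R) (s : seq I) :
  0 <= t -> packing t C -> (forall i, enorm (u i) = 1 /\ C i = capped t (p i) (u i)) ->
  separated s t p u.
Proof.
move=> t0 [_ /trivIsetP tr] pu i j _ _ ij sigma tau st tt.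
rewrite leNgt; apply/negP => h.
have [ui Ci] := pu i; have [uj Cj] := pu j.
pose a := axis_point p u i sigma; pose b := axis_point p u j tau.
pose m := 2^-1 *: (a + b).
have half (c : R * R * R) : c = 2^-1 *: (c + c).
  rewrite scalerDr -scalerDl (_ : 2^-1 + 2^-1 = 1 :> R) ?scale1r//.
  by field.
have mi : (C i)° m.
  rewrite Ci; apply: (@interior_capped _ _ _ _ sigma) => //.
  have -> : m - (p i + sigma *: u i) = - 2^-1 *: (a - b).
    rewrite [X in m - X]half /m -scalerBr scaleNr -scalerN; congr (_ *: _).
    by rewrite -[p i + _]/a opprB opprD addrACA subrr add0r.
  rewrite dotZl dotZr; move: h; rewrite -/a -/b; lra.
have mj : (C j)° m.
  rewrite Cj; apply: (@interior_capped _ _ _ _ tau) => //.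
  have -> : m - (p j + tau *: u j) = 2^-1 *: (a - b).
    rewrite [X in m - X]half /m -scalerBr; congr (_ *: _).
    by rewrite -[p j + _]/b opprD addrACA subrr addr0.
  rewrite dotZl dotZr; move: h; rewrite -/a -/b; lra.
have : ((C i)° `&` (C j)°) m by split.
by rewrite tr.
Qed.

End capped_volume.

Section finite_packing.
Context (R : realType).
Variables (I : eqType) (s : seq I) (t r : R) (p u : I -> R * R * R).
Local Notation leb := (@lebesgue_measure R).

(** Mean volume of a cell when the unqualified parts have their largest
    possible total length. *)
Definition cell_bound : R :=
  Num.sqrt 12 * (t - 2 * t0 R) + 2 * pi * t0 R + 4 / 3 * pi.

Lemma unqualified_split i : 0 < t -> exists2 nu : R, 0 <= nu &
  leb (unqualified s t p u i) = nu%:E /\ leb (qualified_part s t p u i) = (t - nu)%:E.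
Proof.
move=> tpos; have mU := measurable_unqualified s t p u i.
have mQ := measurable_qualified_part s t p u i.
have E : (leb (qualified_part s t p u i) + leb (unqualified s t p u i) = t%:E)%E.
  rewrite -measureU//; last first.
    by apply/seteqP; split => x //= [/andP[_ q] /andP[_ /negP]].
  rewrite -[t in RHS]subr0 -lebesgue_oo; last exact: ltW.
  congr (leb _); apply/seteqP; split => x /=.
    by move=> [/andP[]|/andP[]].
  move=> xt; rewrite /qualified_part /unqualified /= xt /=.
  by case: (qualified _ _ _ _ _); [left|right].
have fin (x y : \bar R) : (0 <= x)%E -> (0 <= y)%E -> (x + y = t%:E)%E ->
    exists2 nu : R, 0 <= nu & y = nu%:E /\ x = (t - nu)%:E.
  move: x y => [x| |] [y| |]//=; rewrite !lee_fin => x0 y0 [xy].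
  by exists y => //; split => //; congr EFin; lra.
exact: fin E.
Qed.

(** As [pi <= sqrt 12], the estimate of the volume of the cells is least when
    the unqualified length is largest, [2 * t0] per cylinder by
    [total_unqualified]. *)
Lemma finite_packing_vol : 0 < t -> 0 <= r - hex_radius R ->
  uniq s -> unit_axes s u -> separated s t p u ->
  (forall i, i \in s -> capped t (p i) (u i) `<=` cball (r - hex_radius R)) ->
  exists2 v : R, vol (cball r) = v%:E & cell_bound *+ size s <= v.
Proof.
move=> tpos r0 us u1 sep inside.
have p0 := @pi_gt0 R; have [pl pu] := andP (@pi_bounds R).
have rge : 0 <= r by have := @hex_radius_gt0 R; lra.
have [mB hB] := ball_vol_le (0 : R * R * R) rge.
have BE : [set y : R * R * R | dot (y - 0) (y - 0) <= r ^+ 2] = cball r.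
  by apply/seteqP; split => y; rewrite /cball /= subr0 enorm_le.
rewrite BE in mB hB.
have [v vE] : exists v : R, vol (cball r) = v%:E.
  have : (0 <= vol (cball r))%E by exact: (measure_ge0 (@area R \x leb)%E).
  move: hB; case: (vol (cball r)) => [x| |]//= _ _; by exists x.
exists v => //.
have hsum : (\sum_(i <- s) vol (cell s t p u i) <= v%:E)%E.
  rewrite -vE; apply: (@disjoint_sum_le _ _ R (@area R \x leb)%E) => //.
  - by move=> i _; exact: measurable_cell.
  - move=> i si; rewrite (_ : r = r - hex_radius R + hex_radius R);
      last by rewrite subrK.
    by apply: cell_sub => //; [exact: ltW|exact: inside].
  - by move=> i j si sj ij; apply: cells_disjoint => //; exact: ltW.
pose nu i := fine (leb (unqualified s t p u i)).
have nuE i : leb (unqualified s t p u i) = (nu i)%:E /\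
  leb (qualified_part s t p u i) = (t - nu i)%:E.
  by have [x _ [h1 h2]] := unqualified_split i tpos; rewrite /nu h1 h2.
have hcell i : i \in s -> ((Num.sqrt 12 * (t - nu i) + pi * nu i + 4 / 3 * pi)%:E <=
  vol (cell s t p u i))%E.
  move=> si; have := cell_vol tpos us u1 sep si; have [-> ->] := nuE i.
  by rewrite -!EFinM -!EFinD.
have hreal : \sum_(i <- s) (Num.sqrt 12 * (t - nu i) + pi * nu i + 4 / 3 * pi) <= v.
  rewrite -lee_fin -sumEFin; apply: le_trans hsum.
  by rewrite !big_seq; apply: lee_sum => i; exact: hcell.
have hnu : \sum_(i <- s) nu i <= 2 * t0 R *+ size s.
  rewrite -lee_fin -sumEFin; apply: le_trans (total_unqualified (ltW tpos) us u1 sep).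
  by apply: lee_sum => i _; rewrite (proj1 (nuE i)).
apply: le_trans hreal.
(* Each unit of unqualified length costs [sqrt 12 - pi] of volume. *)
rewrite (eq_bigr (fun i => Num.sqrt 12 * t + 4 / 3 * pi - (Num.sqrt 12 - pi) * nu i));
  last first.
  by move=> i _; ring.
rewrite big_split/= sumrN -mulr_sumr big_const_seq count_predT iter_addr_0.
have k0 : 0 <= Num.sqrt 12 - pi :> R by rewrite subr_ge0 sqrt12E.
have : (Num.sqrt 12 - pi) * (\sum_(i <- s) nu i) <= (Num.sqrt 12 - pi) *
  (2 * t0 R *+ size s).
  by rewrite ler_wpM2l.
have e x : x *+ size s = x * (size s)%:R :> R by rewrite mulr_natr.
rewrite (e (2 * t0 R)) (e cell_bound) (e (_ + _)) /cell_bound => h.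
have -> : (Num.sqrt 12 * (t - 2 * t0 R) + 2 * pi * t0 R + 4 / 3 * pi) * (size s)%:R =
  (Num.sqrt 12 * t + 4 / 3 * pi) * (size s)%:R - (Num.sqrt 12 - pi) *
    (2 * t0 R * (size s)%:R) by ring.
by rewrite lerD2l lerN2.
Qed.

End finite_packing.

Theorem theorem1 (R : realType) (t r : R)
    (ht : 2 * t0 R <= t) (hr : 2 / Num.sqrt 3 <= r)
    (I : countType) (C : I -> set (R * R * R)) (hC : packing t C) :
  (density C (r - 2 / Num.sqrt 3) r <=
   ((t + 4 / 3) /
    (Num.sqrt 12 / pi * (t - 2 * t0 R) + 2 * t0 R + 4 / 3))%:E)%E.
Proof.
have p0 := @pi_gt0 R.
have T0 : 0 < t0 R.
  have q0 : 0 < 4 / Num.sqrt 3 + 1 :> R by rewrite addr_gt0// divr_gt0// sqrtr_gt0.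
  by rewrite /t0 mulr_gt0// exprn_gt0.
have tpos : 0 < t by lra.
have /choice[pu puP] : forall i, exists q : (R * R * R) * (R * R * R),
    enorm q.2 = 1 /\ C i = capped t q.1 q.2.
  by move=> i; have [p [u [h1 h2]]] := hC.1 i; exists (p, u).
pose p i := (pu i).1; pose u i := (pu i).2.
have K0 : 0 < cell_bound t.
  rewrite /cell_bound ltr_wpDl ?mulr_gt0// addr_ge0//.
    by rewrite mulr_ge0 ?sqrtr_ge0// subr_ge0.
  by rewrite !mulr_ge0// ltW.
have -> : (t + 4 / 3) / (Num.sqrt 12 / pi * (t - 2 * t0 R) + 2 * t0 R + 4 / 3) =
    pi * (t + 4 / 3) / cell_bound t.
  have -> : cell_bound t = pi * (Num.sqrt 12 / pi * (t - 2 * t0 R) + 2 * t0 R + 4 / 3).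
    rewrite /cell_bound; move: (pi : R) p0 => q q0; field; exact: lt0r_neq0.
  by rewrite -mulf_div divff ?mul1r// lt0r_neq0.
rewrite /density /esum; apply: ge_ereal_sup => _ [F [finF FS] <-].
rewrite fsbig_finite//=.
set s : seq I := finmap.enum_fset (fset_set F).
have us : uniq s by exact: finmap.fset_uniq.
have sF i : i \in s -> C i `<=` cball (r - 2 / Num.sqrt 3).
  have memF : s =i F by exact: in_fset_set finF.
  by rewrite memF inE => /FS.
have u1 : unit_axes s u by move=> i _; apply: enorm_eq1; exact: (puP i).1.
have sep : separated s t p u by apply: (packing_separated _ hC) => //; exact: ltW.
have inside i : i \in s -> capped t (p i) (u i) `<=` cball (r - hex_radius R).
  by move=> si; rewrite -(puP i).2; exact: sF.
have r0 : 0 <= r - hex_radius R by rewrite subr_ge0.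
have [v vE hv] := finite_packing_vol tpos r0 us u1 sep inside.
rewrite vE; have [s0|sn] := posnP (size s).
  rewrite (size0nil s0) big_nil lee_fin divr_ge0 ?(ltW K0)// mulr_ge0 ?(ltW p0)//.
  by lra.
have n0 : 0 < (size s)%:R :> R by rewrite ltr0n.
have v0 : 0 < v.
  by apply: lt_le_trans hv; rewrite -[_ *+ size s]mulr_natr mulr_gt0.
apply: (@le_trans _ _ (\sum_(i <- s) (pi * (t + 4 / 3) / v)%:E)%E).
  apply: lee_sum => i _; rewrite (puP i).2 inver gt_eqF//= EFinM.
  apply: lee_wpmul2r; first by rewrite lee_fin invr_ge0 ltW.
  by apply: capped_vol; [exact: ltW|exact: (puP i).1].
rewrite sumEFin lee_fin big_const_seq count_predT iter_addr_0.
rewrite -[_ *+ size s]mulr_natr mulrAC -mulrA ler_wpM2l//.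
  by rewrite mulr_ge0 ?(ltW p0)//; lra.
rewrite ler_pdivrMr// mulrC ler_pdivlMr//.
by rewrite mulrC mulr_natr.
Qed.
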